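(* For every $\mathbb C$-linear completely positive map $\beta:\mathcal B\langle\mathcal X\rangle\to\mathcal B$ one has $$\Phi[\beta]=\mu_{(0,\beta)}.$$ Consequently, $\Phi$ restricts to a bijection $$\{\mathbb C\text{-linear completely positive }\beta:\mathcal B\langle\mathcal X\rangle\to\mathcal B\}\longrightarrow\{\mu\in\Sigma(\mathcal B):\ \mu|_{\mathcal B\mathcal X\mathcal B}=0\},$$ and this bijection restricts to a bijection between those $\beta$ that satisfy the boundedness condition and those $\mu$ that belong to $\Sigma^0(\mathcal B)$. It also restricts to a bijection $$\{\mathbb C\text{-linear completely positive }\beta:\mathcal B\langle\mathcal X\rangle\to\mathcal B\ \text{with}\ \beta|_{\mathcal B}=\mathrm{id}_{\mathcal B}\}\longrightarrow\{\mu\in\Sigma(\mathcal B):\ \mu|_{\mathcal B\mathcal X\mathcal B}=0,\ \mu[\mathcal Xb\mathcal X]=b\ \text{for all }b\in\mathcal B\}.$$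
   Context: $\mathcal B$ is a fixed unital $C^*$-algebra. Distributions. $\mathcal B\langle \mathcal X\rangle$ is the $*$-algebra of polynomials in a self-adjoint formal variable $\mathcal X$ with coefficients in $\mathcal B$, where $\mathcal X$ and $\mathcal B$ are algebraically independent: as a vector space it is $\bigoplus_{n\ge 0}$ of the spans of the monomials $b_0\mathcal X b_1\cdots \mathcal X b_n$, the $n$-th span being isomorphic to $\mathcal B^{\otimes_{\mathbb C}(n+1)}$. $\mathcal B\mathcal X\mathcal B$ is the span of the $b_0\mathcal Xb_1$, and $\mathcal B_0\langle\mathcal X\rangle$ is the subspace of polynomials without constant term. $\Sigma_{alg}(\mathcal B)$ is the set of all $\mathbb C$-linear $\mathcal B$-bimodule maps $\mu:\mathcal B\langle\mathcal X\rangle\to\mathcal B$ with $\mu[b]=b$ for $b\in\mathcal B$. $\Sigma(\mathcal B)$ is the set of those $\mu\in\Sigma_{alg}(\mathcal B)$ that are positive ($\mu[P^*P]\ge 0$ for all $P$). $\Sigma^0(\mathcal B)\subset\Sigma(\mathcal B)$ is the set of distributions $\mu[b_0\mathcal Xb_1\cdots\mathcal Xb_n]=\mathbb E[b_0Xb_1\cdots Xb_n]$ of self-adjoint elements $X$ of $\mathcal B$-valued $C^*$-probability spaces $(\mathcal M,\mathbb E)$ ($\mathcal M\supseteq\mathcal B$ a $C^*$-algebra, $\mathbb E:\mathcal M\to\mathcal B$ a unital positive $\mathcal B$-bimodule map); equivalently, the $\mu \in \Sigma(\mathcal B)$ for which there is $M>0$ with $\|\mu[\mathcal X b_1\mathcal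 X\cdots b_{n-1}\mathcal X]\|\le M^n\|b_1\|\cdots\|b_{n-1}\|$ for all $n$ and all $b_i\in\mathcal B$. A $\mathbb C$-linear $\beta:\mathcal B\langle\mathcal X\rangle\to\mathcal B$ is completely positive if $\sum_{i,j}b_i^*\beta[P_i^*P_j]b_j\ge0$ for all finite families $P_i\in\mathcal B\langle\mathcal X\rangle$, $b_i\in\mathcal B$. It satisfies the boundedness condition if there is $M>0$ with $\|\beta[b_1\mathcal Xb_2\mathcal X\cdots\mathcal Xb_{n-1}]\|\le M^n\|b_1\|\cdots\|b_{n-1}\|$ for all $n\ge2$ and $b_i\in\mathcal B$. $B$-transform. $\mathrm{Ser}(\mathcal B)$ is the set of sequences $F=(F^{[n]})_{n\ge1}$ with $F^{[1]}\in\mathcal B$ and $F^{[n]}:\mathcal B^{n-1}\to\mathcal B$ $\mathbb C$-multilinear. For $\mu\in\Sigma_{alg}(\mathcal B)$, $B_\mu\in\mathrm{Ser}(\mathcal B)$ is the unique series such that for all $n\ge1$ and $b_i\in\mathcal B$, $$\mu[\mathcal Xb_1\mathcal X\cdots b_{n-1}\mathcal X]=\sum_{k=1}^n\ \sum_{0=q_0<q_1<\cdots<q_k=n}B_\mu^{[q_1-q_0]}(b_{q_0+1},\dots,b_{q_1-1})\,b_{q_1}\,B_\mu^{[q_2-q_1]}(b_{q_1+1},\dots,b_{q_2-1})\,b_{q_2}\cdots b_{q_{k-1}}B_\mu^{[q_k-q_{k-1}]}(b_{q_{k-1}+1},\dots,b_{q_k-1});$$ $\mu\mapsto B_\mu$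 is a bijection $\Sigma_{alg}(\mathcal B)\to\mathrm{Ser}(\mathcal B)$. The map $\Phi$. For a $\mathbb C$-linear map $\beta:\mathcal B\langle\mathcal X\rangle\to\mathcal B$, $\Phi[\beta]\in\Sigma_{alg}(\mathcal B)$ is the distribution with $B_{\Phi[\beta]}^{[1]}=0$ and $B_{\Phi[\beta]}^{[n]}(b_1,\dots,b_{n-1})=\beta[b_1\mathcal Xb_2\cdots\mathcal Xb_{n-1}]$ for $n\ge2$. The distribution $\mu_{(0,\beta)}$. For completely positive $\beta$, equip $\mathcal B_0\langle\mathcal X\rangle$ with the (possibly degenerate) $\mathcal B$-valued inner product $\langle b_0\mathcal X\cdots\mathcal Xb_n,c_0\mathcal X\cdots\mathcal Xc_k\rangle_\beta=c_k^*\beta[c_{k-1}^*\mathcal X\cdots\mathcal Xc_0^*b_0\mathcal X\cdots\mathcal Xb_{n-1}]b_n$, and $\mathcal B\langle\mathcal X\rangle=\mathcal B\oplus\mathcal B_0\langle\mathcal X\rangle$ with $\langle b\oplus m,b'\oplus m'\rangle=(b')^*b+\langle m,m'\rangle_\beta$. Define linear maps on $\mathcal B\oplus\mathcal B_0\langle\mathcal X\rangle$ by $a^*(b\oplus b_0\mathcal X\cdots\mathcal Xb_n)=0\oplus\mathcal Xb$, $p(b\oplus b_0\mathcal X\cdots\mathcal Xb_n)=0\oplus\mathcal Xb_0\mathcal X\cdots\mathcal Xb_n$, $a(b\oplus b_0\mathcal X\cdots\mathcal Xb_n)=\beta[b_0\mathcal X\cdots\mathcal Xb_{n-1}]b_n\oplus0$,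 and let $X=a^*+a+p$. Then $\mu_{(0,\beta)}[b_0\mathcal X\cdots\mathcal Xb_n]=\langle(b_0X\cdots Xb_n)(1\oplus0),1\oplus0\rangle$, where elements of $\mathcal B$ act by left multiplication. *)

(* Defs.v *)
From HB Require Import structures.
From mathcomp Require Import all_boot all_order all_algebra.
From mathcomp Require Import generic_quotient.
From mathcomp Require Import boolp classical_sets functions reals.
From mathcomp Require Import complex.

Set Implicit Arguments.
Unset Strict Implicit.
Unset Printing Implicit Defensive.

Import Order.TTheory GRing.Theory Num.Theory.
Local Open Scope classical_set_scope.
Local Open Scope quotient_scope.
Local Open Scope ring_scope.

(* The hierarchy has no common ancestor of normed modules and rings below
   numDomainType, so completeNormedModType R[i] and algType R[i] cannot be
   joined by HB: the norm and its completeness are given here. *)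
HB.mixin Record Algebra_isCStarAlgebra (R : realType) A
    of GRing.Algebra R[i] A := {
  star : A -> A;
  starK : forall x, star (star x) = x;
  starD : forall x y, star (x + y) = star x + star y;
  starZ : forall (c : R[i]) x, star (c *: x) = c^*%C *: star x;
  starM : forall x y, star (x * y) = star y * star x;
  cnorm : A -> R;
  cnorm_eq0 : forall x, cnorm x = 0 -> x = 0;
  cnormD : forall x y, cnorm (x + y) <= cnorm x + cnorm y;
  cnormZ : forall (c : R[i]) x, cnorm (c *: x) = complex.Re `|c| * cnorm x;
  cnormM : forall x y, cnorm (x * y) <= cnorm x * cnorm y;
  cnorm_star : forall x, cnorm (star x * x) = cnorm x ^+ 2;
  cnorm_complete : forall u : nat -> A,
    (forall e, 0 < e -> exists N, forall m n, (N <= m)%N -> (N <= n)%N ->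
       cnorm (u m - u n) < e) ->
    exists l, forall e, 0 < e -> exists N, forall n, (N <= n)%N ->
       cnorm (u n - l) < e
}.

#[short(type="cstarType")]
HB.structure Definition CStarAlgebra (R : realType) :=
  {A of GRing.Algebra R[i] A & Algebra_isCStarAlgebra R A}.

Definition cpos (R : realType) (A : cstarType R) (x : A) : Prop :=
  exists y : A, x = star y * y.

Section Words.
Variables (R : realType) (B : cstarType R).

(* (b0, [:: b1; ...; bn]) encodes the monomial b0 X b1 X ... X bn. *)
Definition word : Type := (B * seq B)%type.

Fixpoint wcat (b : B) (s : seq B) (v : word) : word :=
  if s is b' :: s' then
    let r := wcat b' s' v in (b, r.1 :: r.2)
  else (b * v.1, v.2).

(* (b0 X ... X bn) (c0 X ... X ck) = b0 X ... X (bn c0) X ... X ck *)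
Definition wmul (u v : word) : word := wcat u.1 u.2 v.

Definition wcst (b : B) : word := (b, [::]).

Definition wscale (c : R[i]) (u : word) : word := (c *: u.1, u.2).

Definition wstar (u : word) : word :=
  (star (last u.1 u.2), rev (map star (belast u.1 u.2))).

(* A sequence of words stands for the sum of its members.  When u ends in 1
   and v begins with 1, the words u x v are those with x in a given slot, so
   the last three rules are the relations that define the direct sum of the
   tensor powers of B over R[i]; the other cases are instances of these. *)
Inductive tensor_eq : seq word -> seq word -> Prop :=
| teq_refl s : tensor_eq s s
| teq_sym s t : tensor_eq s t -> tensor_eq t s
| teq_trans s t r : tensor_eq s t -> tensor_eq t r -> tensor_eq s r
| teq_cat s t s' t' :
    tensor_eq s t -> tensor_eq s' t' -> tensor_eq (s ++ s') (t ++ t')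
| teq_catC s t : tensor_eq (s ++ t) (t ++ s)
| teq_add u v x y :
    tensor_eq [:: wmul u (wmul (wcst (x + y)) v)]
              [:: wmul u (wmul (wcst x) v); wmul u (wmul (wcst y) v)]
| teq_zero u v : tensor_eq [:: wmul u (wmul (wcst 0) v)] [::]
| teq_scale u v (c : R[i]) x :
    tensor_eq [:: wmul u (wmul (wcst (c *: x)) v)]
              [:: wscale c (wmul u (wmul (wcst x) v))].

Definition tensor_eqb (s t : seq word) : bool := `[< tensor_eq s t >].

Lemma tensor_eqb_refl : reflexive tensor_eqb.
Proof. by move=> s; apply/asboolP; exact: teq_refl. Qed.

Lemma tensor_eqb_sym : symmetric tensor_eqb.
Proof.
by move=> s t; apply/asboolP/asboolP => /teq_sym.
Qed.

Lemma tensor_eqb_trans : transitive tensor_eqb.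
Proof.
move=> t s r /asboolP st /asboolP tr; apply/asboolP; exact: teq_trans tr.
Qed.

Canonical tensor_equiv :=
  EquivRel tensor_eqb tensor_eqb_refl tensor_eqb_sym tensor_eqb_trans.

Lemma wcatA b s v w : wmul (wcat b s v) w = wcat b s (wmul v w).
Proof.
elim: s b => [|c s IHs] b /=; last by rewrite -IHs.
by case: v => d [|e v]; rewrite /wmul/= ?mulrA.
Qed.

Lemma wmulA u v w : wmul u (wmul v w) = wmul (wmul u v) w.
Proof. exact: esym (wcatA _ _ _ _). Qed.

Lemma wmul1w u : wmul (wcst 1) u = u.
Proof. by case: u => b s; rewrite /wmul/= mul1r. Qed.

Lemma wmulw1 u : wmul u (wcst 1) = u.
Proof.
case: u => b s; rewrite /wmul/=; elim: s b => [|c s IHs] b /=.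
  by rewrite mulr1.
by rewrite IHs.
Qed.

Lemma wscaleE c u : wscale c u = wmul (wcst (c%:A)) u.
Proof. by case: u => b s; rewrite /wscale/wmul/= mulr_algl. Qed.

Lemma wordE u : u = wmul (wcst 1) (wmul (wcst u.1) (1, u.2)).
Proof. by case: u => b s; rewrite wmul1w /wmul/= mulr1. Qed.

Lemma teq_perm s t : perm_eq s t -> tensor_eq s t.
Proof.
elim: s t => [|x s IHs] t.
  by rewrite perm_sym => /perm_nilP ->; exact: teq_refl.
move=> xst; have xt : x \in t by rewrite -(perm_mem xst) mem_head.
case/splitPr: xt xst => p q.
rewrite perm_sym -cat1s perm_catCA /= perm_cons perm_sym => /IHs sq.
apply: teq_trans (teq_cat (teq_refl [:: x]) sq) _.
have -> : [:: x] ++ p ++ q = ([:: x] ++ p) ++ q by rewrite catA.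
have -> : p ++ x :: q = (p ++ [:: x]) ++ q by rewrite -catA.
by apply: teq_cat (teq_catC _ _) (teq_refl _).
Qed.

Lemma teq_flat (g : word -> seq word) :
    (forall u v x y, tensor_eq (g (wmul u (wmul (wcst (x + y)) v)))
       (g (wmul u (wmul (wcst x) v)) ++ g (wmul u (wmul (wcst y) v)))) ->
    (forall u v, tensor_eq (g (wmul u (wmul (wcst 0) v))) [::]) ->
    (forall u v c x, tensor_eq (g (wmul u (wmul (wcst (c *: x)) v)))
       (g (wscale c (wmul u (wmul (wcst x) v))))) ->
  forall s t, tensor_eq s t ->
    tensor_eq (flatten (map g s)) (flatten (map g t)).
Proof.
move=> gD g0 gZ s t; elim=> {s t} /=.
- by move=> s; exact: teq_refl.
- by move=> s t _; exact: teq_sym.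
- by move=> s t r _ ? _; exact: teq_trans.
- by move=> s t s' t' _ ? _ ?; rewrite !map_cat !flatten_cat; exact: teq_cat.
- by move=> s t; rewrite !map_cat !flatten_cat; exact: teq_catC.
- by move=> u v x y; rewrite !cats0; exact: gD.
- by move=> u v; rewrite !cats0; exact: g0.
- by move=> u v c x; rewrite !cats0; exact: gZ.
Qed.

Lemma teq_map (f : word -> word) :
    (forall u v x y, tensor_eq [:: f (wmul u (wmul (wcst (x + y)) v))]
       [:: f (wmul u (wmul (wcst x) v)); f (wmul u (wmul (wcst y) v))]) ->
    (forall u v, tensor_eq [:: f (wmul u (wmul (wcst 0) v))] [::]) ->
    (forall u v c x, tensor_eq [:: f (wmul u (wmul (wcst (c *: x)) v))]
       [:: f (wscale c (wmul u (wmul (wcst x) v)))]) ->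
  forall s t, tensor_eq s t -> tensor_eq (map f s) (map f t).
Proof.
move=> fD f0 fZ s t st.
have fE r : map f r = flatten (map (fun w => [:: f w]) r).
  by elim: r => //= w r ->.
by rewrite !fE; apply: teq_flat st.
Qed.

Lemma teq_scaleC u v c : tensor_eq [:: wmul u (wscale c v)]
  [:: wscale c (wmul u v)].
Proof.
rewrite [wscale c v]wscaleE; have := teq_scale u v c 1.
by rewrite wmul1w.
Qed.

Lemma teq_mulr v s t : tensor_eq s t ->
  tensor_eq (map (wmul^~ v) s) (map (wmul^~ v) t).
Proof.
apply: teq_map => [u w x y|u w|u w c x]; rewrite -!wmulA.
- exact: teq_add.
- exact: teq_zero.
- by rewrite wscaleE -!wmulA -wscaleE; exact: teq_scale.
Qed.

Lemma teq_mull v s t : tensor_eq s t ->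
  tensor_eq (map (wmul v) s) (map (wmul v) t).
Proof.
apply: teq_map => [u w x y|u w|u w c x]; rewrite !(wmulA v u).
- exact: teq_add.
- exact: teq_zero.
- apply: teq_trans (teq_scale _ _ _ _) _.
  by rewrite -wmulA; apply: teq_sym; exact: teq_scaleC.
Qed.

Lemma teq_wscale c s t : tensor_eq s t ->
  tensor_eq (map (wscale c) s) (map (wscale c) t).
Proof.
move=> /(teq_mull (wcst c%:A)).
by rewrite !(eq_map (fun w => esym (wscaleE c w))).
Qed.

Lemma wscaleA a b u : wscale a (wscale b u) = wscale (a * b) u.
Proof. by rewrite /wscale/= scalerA. Qed.

Lemma wscale1 u : wscale 1 u = u.
Proof. by case: u => b s; rewrite /wscale scale1r. Qed.

Lemma teq_wscaleD a b w :
  tensor_eq [:: wscale (a + b) w] [:: wscale a w; wscale b w].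
Proof.
have := teq_add (wcst 1) w (a%:A) (b%:A).
by rewrite -scalerDl !wmul1w -!wscaleE.
Qed.

Lemma teq_wscale0 w : tensor_eq [:: wscale 0 w] [::].
Proof.
by have := teq_zero (wcst 1) w; rewrite wmul1w wscaleE scale0r.
Qed.

Lemma teq_mul s t s' t' : tensor_eq s t -> tensor_eq s' t' ->
  tensor_eq [seq wmul u v | u <- s, v <- s'] [seq wmul u v | u <- t, v <- t'].
Proof.
move=> st st'; apply: (@teq_trans _ [seq wmul u v | u <- t, v <- s']).
  elim: s' {st'} => [|v s' IHs].
    by rewrite !allpairs0r; exact: teq_refl.
  have E r : tensor_eq [seq wmul u w | u <- r, w <- v :: s']
      (map (wmul^~ v) r ++ [seq wmul u w | u <- r, w <- s']).
    apply: teq_perm.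
    by rewrite (perm_allpairs_consr (fun u w => wmul u w) r (fun=> v) (fun=> s')).
  apply: teq_trans (E s) (teq_trans _ (teq_sym (E t))).
  by apply: teq_cat IHs; exact: teq_mulr.
elim: t {st} => /= [|u t IHt]; first exact: teq_refl.
by apply: teq_cat IHt; exact: teq_mull.
Qed.

Lemma wcat_rcons b s c t d :
  wcat b s (c, rcons t d) = ((wcat b s (c, t)).1, rcons (wcat b s (c, t)).2 d).
Proof. by elim: s b => [|a s IHs] b //=; rewrite IHs. Qed.

Lemma wstarM u v : wstar (wmul u v) = wmul (wstar v) (wstar u).
Proof.
case: u => b s; rewrite /wmul/=; elim: s b => [|a s IHs] b /=.
  case: v => c t; rewrite /wstar/wmul/=.
  case: t => [|d t] /=; first by rewrite starM.
  rewrite starM !rev_cons; set x := star _; set y := rev _.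
  have -> z : rcons y z = (y ++ [:: z]) by rewrite cats1.
  by elim: y x => [|e y IHy] x //=; rewrite -IHy.
have E w : wstar (b, w.1 :: w.2) = ((wstar w).1, rcons (wstar w).2 (star b)).
  by rewrite /wstar/= rev_cons.
rewrite E IHs -[(b, a :: s)]/(b, (a, s).1 :: (a, s).2) E.
case: (wstar (a, s)) => c t; rewrite wcat_rcons.
by case: (wstar v).
Qed.

Lemma wstar_cst b : wstar (wcst b) = wcst (star b).
Proof. by []. Qed.

Lemma star0 : star (0 : B) = 0.
Proof. by apply: (addrI (star 0)); rewrite -starD !addr0. Qed.

Lemma star1 : star (1 : B) = 1.
Proof. by rewrite -[LHS]mulr1 -[X in _ * X]starK -starM mulr1 starK. Qed.

Lemma teq_star s t : tensor_eq s t -> tensor_eq (map wstar s) (map wstar t).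
Proof.
apply: teq_map => [u v x y|u v|u v c x].
- by rewrite !wstarM !wstar_cst starD -!wmulA; exact: teq_add.
- by rewrite !wstarM !wstar_cst star0 -!wmulA; exact: teq_zero.
rewrite wscaleE !wstarM !wstar_cst !starZ star1 -!wmulA.
apply: teq_trans (teq_scale _ _ _ _) (teq_sym _).
have := teq_scale (wmul (wstar v) (wmul (wcst (star x)) (wstar u))) (wcst 1)
  c^*%C 1.
by rewrite !wmulw1 -!wmulA.
Qed.

(* B<X>: finite formal sums of words modulo the tensor relations. *)
Definition polyB : Type := {eq_quot tensor_equiv}%qT.
HB.instance Definition _ := Choice.on polyB.
HB.instance Definition _ := EqQuotient.on polyB.

Lemma pi_polyP s t : \pi_polyB s = \pi_polyB t <-> tensor_eq s t.
Proof. by split=> [/eqmodP/asboolP//|st]; apply/eqmodP/asboolP. Qed.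

Lemma repr_pi s : tensor_eq (repr (\pi_polyB s)) s.
Proof. by apply/pi_polyP; rewrite reprK. Qed.

Lemma polyW (K : polyB -> Prop) : (forall s, K (\pi_polyB s)) -> forall P, K P.
Proof. by move=> Ks P; rewrite -[P]reprK. Qed.

Definition mono (w : word) : polyB := \pi_polyB [:: w].

Definition addP (P Q : polyB) : polyB := \pi_polyB (repr P ++ repr Q).
Definition oppP (P : polyB) : polyB := \pi_polyB (map (wscale (- 1)) (repr P)).
Definition scaleP (c : R[i]) (P : polyB) : polyB :=
  \pi_polyB (map (wscale c) (repr P)).
Definition mulP (P Q : polyB) : polyB :=
  \pi_polyB [seq wmul u v | u <- repr P, v <- repr Q].
Definition starP (P : polyB) : polyB := \pi_polyB (map wstar (repr P)).

Lemma pi_add s t : addP (\pi_polyB s) (\pi_polyB t) = \pi_polyB (s ++ t).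
Proof. by apply/pi_polyP; apply: teq_cat; exact: repr_pi. Qed.

Lemma pi_scale c s : scaleP c (\pi_polyB s) = \pi_polyB (map (wscale c) s).
Proof. by apply/pi_polyP; apply: teq_wscale; exact: repr_pi. Qed.

Lemma pi_mul s t :
  mulP (\pi_polyB s) (\pi_polyB t) = \pi_polyB [seq wmul u v | u <- s, v <- t].
Proof. by apply/pi_polyP; apply: teq_mul; exact: repr_pi. Qed.

Lemma pi_star s : starP (\pi_polyB s) = \pi_polyB (map wstar s).
Proof. by apply/pi_polyP; apply: teq_star; exact: repr_pi. Qed.

Fact addPA : associative addP.
Proof.
move=> P Q S; elim/polyW: P => s; elim/polyW: Q => t; elim/polyW: S => r.
by rewrite !pi_add catA.
Qed.

Fact addPC : commutative addP.
Proof.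
move=> P Q; elim/polyW: P => s; elim/polyW: Q => t.
by rewrite !pi_add; apply/pi_polyP; exact: teq_catC.
Qed.

Fact add0P : left_id (\pi_polyB [::]) addP.
Proof. by move=> P; elim/polyW: P => s; rewrite pi_add. Qed.

Fact scalePDl P : {morph scaleP^~ P : a b / a + b >-> addP a b}.
Proof.
move=> a b; elim/polyW: P => s; rewrite !pi_scale pi_add.
apply/pi_polyP; elim: s => [|w s IHs] /=; first exact: teq_refl.
apply: teq_trans (teq_cat (teq_wscaleD a b w) IHs) _.
apply: teq_perm; rewrite /= perm_cons.
by rewrite (perm_catCA [:: wscale b w]).
Qed.

Fact scale1P : left_id 1 scaleP.
Proof.
by move=> P; elim/polyW: P => s; rewrite pi_scale (eq_map wscale1) map_id.
Qed.

Fact addNP : left_inverse (\pi_polyB [::]) oppP addP.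
Proof.
move=> P; rewrite -{2}[P]scale1P -[oppP P]/(scaleP (-1) P) -scalePDl addNr.
elim/polyW: P => s; rewrite pi_scale; apply/pi_polyP.
elim: s => [|w s IHs] /=; first exact: teq_refl.
by have := teq_cat (teq_wscale0 w) IHs.
Qed.

HB.instance Definition _ := GRing.isZmodule.Build polyB addPA addPC add0P addNP.

Lemma piD s t : \pi_polyB (s ++ t) = \pi_polyB s + \pi_polyB t.
Proof. by rewrite [RHS]pi_add. Qed.

Lemma piE s : \pi_polyB s = \sum_(w <- s) mono w.
Proof.
elim: s => [|w s IHs]; first by rewrite big_nil.
by rewrite big_cons -IHs -piD.
Qed.

(* The linear extension to B<X> of a function on words; it is meant for f that
   respect the tensor relations, for which it does not depend on repr. *)
Definition wlift (V : nmodType) (f : word -> V) (P : polyB) : V :=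
  \sum_(w <- repr P) f w.

Definition balanced (V : nmodType) (f : word -> V) : Prop :=
  (forall u v x y, f (wmul u (wmul (wcst (x + y)) v)) =
     f (wmul u (wmul (wcst x) v)) + f (wmul u (wmul (wcst y) v))) /\
  (forall u v c x, f (wmul u (wmul (wcst (c *: x)) v)) =
     f (wscale c (wmul u (wmul (wcst x) v)))).

Lemma wlift_pi (V : zmodType) (f : word -> V) s :
  balanced f -> wlift f (\pi_polyB s) = \sum_(w <- s) f w.
Proof.
move=> [fD fZ]; rewrite /wlift; move: (repr_pi s); move: (repr _) => r.
elim=> {r s} // [s t r _ -> _ -> //|s t s' t' _ Es _ Et|s t|u v x y|u v|u v c x].
- by rewrite !big_cat Es Et.
- by rewrite !big_cat /= addrC.
- by rewrite !big_cons !big_nil !addr0 fD.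
- rewrite big_cons !big_nil addr0.
  by apply: (addrI (f (wmul u (wmul (wcst 0) v)))); rewrite -fD !addr0.
- by rewrite !big_cons !big_nil fZ.
Qed.

Lemma wlift_mono (V : zmodType) (f : word -> V) w :
  balanced f -> wlift f (mono w) = f w.
Proof. by move=> fB; rewrite wlift_pi// big_cons big_nil addr0. Qed.

Lemma wliftD (V : zmodType) (f : word -> V) P Q :
  balanced f -> wlift f (P + Q) = wlift f P + wlift f Q.
Proof.
move=> fB; elim/polyW: P => s; elim/polyW: Q => t.
by rewrite -piD !wlift_pi// big_cat.
Qed.

Definition wconst (w : word) : B := if w.2 is [::] then w.1 else 0.

Lemma wconst_balanced : balanced wconst.
Proof.
split=> [[b [|? ?]] [c [|? ?]] x y|[b [|? ?]] [c [|? ?]] d x];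
  rewrite /wconst/= ?addr0//.
  by rewrite mulrDl mulrDr.
by rewrite -scalerAl -scalerAr.
Qed.

Definition constB (b : B) : polyB := mono (wcst b).
Definition varX : polyB := mono (1, [:: 1]).

Fact mulPA : associative mulP.
Proof.
move=> P Q S; elim/polyW: P => s; elim/polyW: Q => t; elim/polyW: S => r; rewrite !pi_mul.
congr (\pi_polyB _); elim: s => //= u s IHs; rewrite allpairs_cat -IHs.
congr (_ ++ _); elim: t {IHs} => //= v t IHt; rewrite map_cat IHt.
by congr (_ ++ _); rewrite -map_comp; apply: eq_map => w /=; rewrite wmulA.
Qed.

Fact mul1P : left_id (constB 1) mulP.
Proof.
move=> P; elim/polyW: P => s; rewrite [LHS]pi_mul /= cats0.
by rewrite (eq_map wmul1w) map_id.
Qed.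

Fact mulP1 : right_id (constB 1) mulP.
Proof.
move=> P; elim/polyW: P => s; rewrite [LHS]pi_mul allpairs1r.
by rewrite (eq_map wmulw1) map_id.
Qed.

Fact mulPDl : left_distributive mulP +%R.
Proof.
move=> P Q S; elim/polyW: P => s; elim/polyW: Q => t; elim/polyW: S => r.
by rewrite -piD !pi_mul allpairs_cat piD.
Qed.

Fact mulPDr : right_distributive mulP +%R.
Proof.
move=> P Q S; elim/polyW: P => s; elim/polyW: Q => t; elim/polyW: S => r.
rewrite -piD !pi_mul -piD; apply/pi_polyP/teq_perm.
by rewrite (perm_allpairs_catr (fun u w => wmul u w) s (fun=> t) (fun=> r)).
Qed.

Fact oneP_neq0 : constB 1 != 0.
Proof.
apply/eqP => /(congr1 (wlift wconst)).
rewrite wlift_mono; last exact: wconst_balanced.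
rewrite [X in _ = X](wlift_pi [::]); last exact: wconst_balanced.
by rewrite big_nil => /eqP; rewrite oner_eq0.
Qed.

HB.instance Definition _ := GRing.Zmodule_isNzRing.Build polyB
  mulPA mul1P mulP1 mulPDl mulPDr oneP_neq0.

Fact scalePA a b P : scaleP a (scaleP b P) = scaleP (a * b) P.
Proof.
elim/polyW: P => s; rewrite !pi_scale -map_comp.
by congr (\pi_polyB _); apply: eq_map => w; exact: wscaleA.
Qed.

Fact scalePDr : right_distributive scaleP +%R.
Proof.
move=> c P Q; elim/polyW: P => s; elim/polyW: Q => t.
by rewrite -piD !pi_scale map_cat piD.
Qed.

HB.instance Definition _ := GRing.Zmodule_isLmodule.Build R[i] polyB
  scalePA scale1P scalePDr scalePDl.

Fact scalePAl (c : R[i]) (P Q : polyB) : c *: (P * Q) = (c *: P) * Q.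
Proof.
elim/polyW: P => s; elim/polyW: Q => t.
rewrite [P in c *: P]pi_mul [LHS]pi_scale [P in _ = P * _]pi_scale [RHS]pi_mul.
congr (\pi_polyB _); elim: s => //= u s IHs; rewrite map_cat IHs; congr (_ ++ _).
by rewrite -map_comp; apply: eq_map => w /=; rewrite !wscaleE wmulA.
Qed.

HB.instance Definition _ := GRing.Lmodule_isLalgebra.Build R[i] polyB scalePAl.

Fact scalePAr (c : R[i]) (P Q : polyB) : c *: (P * Q) = P * (c *: Q).
Proof.
elim/polyW: P => s; elim/polyW: Q => t.
rewrite [P in c *: P]pi_mul [LHS]pi_scale [P in _ = _ * P]pi_scale [RHS]pi_mul.
apply/pi_polyP; elim: s => [|u s IHs] /=; first exact: teq_refl.
rewrite map_cat; apply: teq_cat IHs; rewrite -!map_comp.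
elim: t => [|v t IHt] /=; first exact: teq_refl.
exact: teq_cat (teq_sym (teq_scaleC u v c)) IHt.
Qed.

HB.instance Definition _ := GRing.Lalgebra_isAlgebra.Build R[i] polyB scalePAr.

Lemma monoM u v : mono u * mono v = mono (wmul u v).
Proof. by rewrite [LHS]pi_mul. Qed.

Lemma monoE b c s : mono (b, c :: s) = constB b * varX * mono (c, s).
Proof. by rewrite !monoM /wmul/= !mul1r mulr1. Qed.

Lemma monoZ (c : R[i]) w : mono (wscale c w) = c *: mono w.
Proof. by rewrite [RHS]pi_scale. Qed.

Lemma mono_balanced : balanced mono.
Proof.
split=> [u v x y|u v c x]; last by apply/pi_polyP; exact: teq_scale.
by rewrite -[RHS]piD; apply/pi_polyP; exact: teq_add.
Qed.

Lemma starP_mono w : starP (mono w) = mono (wstar w).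
Proof. by rewrite pi_star. Qed.

Lemma wliftZ (V : lmodType R[i]) (f : word -> V) c P : balanced f ->
  (forall w, f (wscale c w) = c *: f w) -> wlift f (c *: P) = c *: wlift f P.
Proof.
move=> fB fZ; elim/polyW: P => s; rewrite [P in wlift f P]pi_scale !wlift_pi//.
by rewrite big_map scaler_sumr; apply: eq_bigr => w _.
Qed.

End Words.

Section Distributions.
Variables (R : realType) (B : cstarType R).
Notation PB := (polyB B).
Implicit Types (mu beta : PB -> B).

Definition BXB (P : PB) : Prop :=
  exists s : seq (B * B), P = \sum_(bc <- s) mono (bc.1, [:: bc.2]).

Definition Sigma_alg mu : Prop :=
  [/\ linear mu,
      forall b P c, mu (constB b * P * constB c) = b * mu P * c
    & forall b, mu (constB b) = b].

Definition Sigma mu : Prop :=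
  Sigma_alg mu /\ forall P, cpos (mu (starP P * P)).

(* (M, E) is a B-valued C*-probability space, with B a unital C*-subalgebra of
   M through iota. *)
Definition cstar_probability (M : cstarType R) (iota : {lrmorphism B -> M})
    (E : M -> B) : Prop :=
  [/\ injective iota, forall b, iota (star b) = star (iota b),
      linear E /\ E 1 = 1,
      forall b m c, E (iota b * m * iota c) = b * E m * c
    & forall m, cpos m -> cpos (E m)].

Fixpoint word_eval (M : cstarType R) (iota : B -> M) (x : M) (b : B)
    (s : seq B) : M :=
  if s is c :: s' then iota b * x * word_eval iota x c s' else iota b.

Definition Sigma0 mu : Prop :=
  linear mu /\
  exists (M : cstarType R) (iota : {lrmorphism B -> M}) (E : M -> B) (x : M),
    [/\ cstar_probability iota E, star x = x
      & forall b s, mu (mono (b, s)) = E (word_eval iota x b s)].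

Definition cp beta : Prop :=
  forall (n : nat) (P : 'I_n -> PB) (b : 'I_n -> B),
    cpos (\sum_(i < n) \sum_(j < n)
            star (b i) * beta (starP (P i) * P j) * b j).

(* The word (b, s) has n - 1 = (size s).+1 coefficients. *)
Definition cp_bounded beta : Prop :=
  exists2 K : R, 0 < K & forall b s,
    cnorm (beta (mono (b, s))) <=
      K ^+ (size s).+2 * (cnorm b * \prod_(c <- s) cnorm c).

(* F : seq B -> B packs all the components of a series: F [:: b1; ...; b_(n-1)]
   is F^[n](b1, ..., b_(n-1)). *)
Definition is_series (F : seq B -> B) : Prop :=
  forall s t (c : R[i]) x y,
    F (s ++ (c *: x + y) :: t) = c *: F (s ++ x :: t) + F (s ++ y :: t).

Definition composition k n (q : {ffun 'I_k.+1 -> 'I_n.+1}) : bool :=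
  [&& q ord0 == 0%N :> nat, q ord_max == n :> nat
    & [forall i : 'I_k.+1, forall j : 'I_k.+1, (i < j)%N ==> (q i < q j)%N]].

(* For s = [:: b1; ...; b_(n-1)]: the entries b_(p+1), ..., b_(q-1). *)
Definition block (s : seq B) (p q : nat) : seq B := take (q - p).-1 (drop p s).

(* With s = [:: b1; ...; b_(n-1)], nth 1 s q.-1 is b_q for 0 < q < n, and is 1
   for q = n, so that no factor follows the last block. *)
Definition Btransform mu (F : seq B -> B) : Prop :=
  is_series F /\ forall s : seq B, let n := (size s).+1 in
    mu (mono (1, rcons s 1)) =
    \sum_(1 <= k < n.+1)
      \sum_(q : {ffun 'I_k.+1 -> 'I_n.+1} | composition q)
        \prod_(j < k)
          (let p := q (inord j) in let p' := q (inord j.+1) in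
           F (block s p p') * nth 1 s p'.-1).

Definition Phi_series beta (s : seq B) : B :=
  if s is b :: s' then beta (mono (b, s')) else 0.

(* The distribution whose B-transform is Phi_series beta; it is unique, and it
   exists when beta is linear. *)
Definition Phi beta : PB -> B :=
  xget (fun=> 0) [set mu | Sigma_alg mu /\ Btransform mu (Phi_series beta)].

(* B (+) B_0<X> is B<X>, with constant term [const_part]. *)
Definition const_part (P : PB) : B := wlift (@wconst R B) P.

(* For w = b0 X b1 ... X bn, given as (b0, b1 :: s), the word
   b0 X ... X b_(n-1) is (b0, belast b1 s), and bn is last b1 s. *)
Definition word_inner beta (w v : word B) : B :=
  match w, v with
  | (b0, b1 :: s), (c0, c1 :: t) =>
      star (last c1 t) *
      beta (starP (mono (c0, belast c1 t)) * mono (b0, belast b1 s)) *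
      last b1 s
  | _, _ => 0
  end.

Definition inner0 beta (P Q : PB) : B :=
  wlift (fun v => wlift (fun w => word_inner beta w v) P) Q.

Definition inner beta (P Q : PB) : B :=
  star (const_part Q) * const_part P + inner0 beta P Q.

Definition op_create (P : PB) : PB := varX B * constB (const_part P).

Definition op_preserve (P : PB) : PB :=
  varX B * (P - constB (const_part P)).

Definition word_annihilate beta (w : word B) : B :=
  if w is (b0, b1 :: s) then beta (mono (b0, belast b1 s)) * last b1 s else 0.

Definition op_annihilate beta (P : PB) : PB :=
  constB (wlift (word_annihilate beta) P).

Definition op_X beta (P : PB) : PB :=
  op_create P + op_annihilate beta P + op_preserve P.

Fixpoint word_act beta (b : B) (s : seq B) (P : PB) : PB :=
  if s is c :: s' then constB b * op_X beta (word_act beta c s' P)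
  else constB b * P.

Definition mu_0 beta (P : PB) : B :=
  wlift (fun w => inner beta (word_act beta w.1 w.2 1) 1) P.

Lemma wmul_rcons b s z : wmul (b, s) (1, [:: z]) = (b, rcons s z) :> word B.
Proof.
by rewrite /wmul/=; elim: s b => [|c s IHs] b /=; rewrite ?mulr1 ?IHs.
Qed.

Lemma word_split (w : word B) :
  (exists b, w = wcst b) \/ (exists p z, w = wmul p (1, [:: z])).
Proof.
case: w => b s; case/lastP: s => [|s z]; first by left; exists b.
by right; exists (b, s), z; rewrite wmul_rcons.
Qed.

Lemma constBD b c : constB (b + c) = constB b + constB c :> PB.
Proof.
have [D _] := mono_balanced B.
have := D (wcst 1) (wcst 1) b c.
by rewrite !wmul1w !wmulw1.
Qed.

Lemma constBZ (a : R[i]) b : constB (a *: b) = a *: constB b :> PB.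
Proof. by rewrite -monoZ. Qed.

Lemma constBM b c : constB (b * c) = constB b * constB c :> PB.
Proof. by rewrite monoM. Qed.

Lemma linear_balanced beta : linear beta -> balanced (fun w => beta (mono w)).
Proof.
move=> lb; have [D Z] := mono_balanced B.
have bD P Q : beta (P + Q) = beta P + beta Q.
  by have := lb 1 P Q; rewrite !scale1r.
by split=> [u v x y|u v c x]; rewrite ?D ?Z ?bD.
Qed.

Section Linear.
Variable beta : PB -> B.
Hypothesis lbeta : linear beta.

Let bD P Q : beta (P + Q) = beta P + beta Q.
Proof. by have := lbeta 1 P Q; rewrite !scale1r. Qed.

Let b0 : beta 0 = 0.
Proof. by apply: (addrI (beta 0)); rewrite -bD !addr0. Qed.

Let bZ c P : beta (c *: P) = c *: beta P.
Proof. by have := lbeta c P 0; rewrite b0 !addr0. Qed.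

Lemma word_annihilateE p z :
  word_annihilate beta (wmul p (1, [:: z])) = beta (mono p) * z.
Proof.
case: p => b s; rewrite wmul_rcons /word_annihilate.
case: s => [|c s] //=; rewrite last_rcons.
by congr (beta (mono (b, _)) * _); elim: s c => //= d s IHs c; rewrite IHs.
Qed.

Lemma word_annihilateZ c w :
  word_annihilate beta (wscale c w) = c *: word_annihilate beta w.
Proof.
have [[b ->]|[p [z ->]]] := word_split w; first by rewrite /= scaler0.
by rewrite wscaleE wmulA !word_annihilateE -wscaleE monoZ bZ scalerAl.
Qed.

Lemma word_annihilate_balanced : balanced (word_annihilate beta).
Proof.
have [D Z] := linear_balanced lbeta.
split=> [u v x y|u v c x]; last rewrite word_annihilateZ;
  (have [[b ->]|[p [z ->]]] := word_split v; last
    by rewrite !wmulA !word_annihilateE -!wmulA ?D ?mulrDl// Z monoZ bZ scalerAl);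
  (have [[a ->]|[p [z ->]]] := word_split u;
    first by rewrite /= ?addr0 ?scaler0);
  have E y' : wmul (wmul p (1, [:: z])) (wmul (wcst y') (wcst b)) =
    wmul p (1, [:: z * (y' * b)]) by rewrite -wmulA.
- by rewrite !E !word_annihilateE -mulrDr -mulrDr -mulrDl.
- by rewrite !E !word_annihilateE -!scalerAl -!scalerAr.
Qed.

Lemma op_XD P Q : op_X beta (P + Q) = op_X beta P + op_X beta Q.
Proof.
rewrite /op_X /op_create /op_annihilate /op_preserve /const_part.
rewrite (wliftD P Q (wconst_balanced B)) (wliftD P Q word_annihilate_balanced).
rewrite !constBD opprD [P + Q + _]addrACA !mulrDr.
by rewrite [X in X + _]addrACA [LHS]addrACA.
Qed.

Lemma op_XZ c P : op_X beta (c *: P) = c *: op_X beta P.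
Proof.
rewrite /op_X /op_create /op_annihilate /op_preserve /const_part.
rewrite (wliftZ P (wconst_balanced B)); last first.
  by case=> b [|? ?]; rewrite /wconst/= ?scaler0.
rewrite (wliftZ P word_annihilate_balanced); last exact: word_annihilateZ.
by rewrite !constBZ -!scalerAr -scalerBr -scalerAr !scalerDr.
Qed.

Lemma word_act_mul u v P :
  word_act beta (wmul u v).1 (wmul u v).2 P =
  word_act beta u.1 u.2 (word_act beta v.1 v.2 P).
Proof.
case: u => b s; rewrite /wmul/=; elim: s b => [|c s IHs] b /=.
  by case: v => d [|e v] /=; rewrite constBM -!mulrA.
by rewrite IHs.
Qed.

Lemma word_actD w P Q : word_act beta w.1 w.2 (P + Q) =
  word_act beta w.1 w.2 P + word_act beta w.1 w.2 Q.
Proof.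
case: w => b s; elim: s b => [|c s IHs] b /=; first by rewrite mulrDr.
by rewrite IHs op_XD mulrDr.
Qed.

Lemma word_actZ w c P :
  word_act beta w.1 w.2 (c *: P) = c *: word_act beta w.1 w.2 P.
Proof.
case: w => b s; elim: s b => [|d s IHs] b /=; first by rewrite -scalerAr.
by rewrite IHs op_XZ -scalerAr.
Qed.

Lemma word_act_scale c w P :
  word_act beta (wscale c w).1 (wscale c w).2 P = c *: word_act beta w.1 w.2 P.
Proof. by rewrite wscaleE word_act_mul /= constBZ -scalerAl mul1r. Qed.

Lemma word_act_balanced P : balanced (fun w => word_act beta w.1 w.2 P).
Proof.
split=> [u v x y|u v c x]; rewrite ?word_act_scale !word_act_mul /=.
  by rewrite constBD mulrDl word_actD.
by rewrite constBZ -scalerAl word_actZ.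
Qed.

End Linear.

Section LinearInner.
Variable beta : PB -> B.
Hypothesis lbeta : linear beta.

Let bD P Q : beta (P + Q) = beta P + beta Q.
Proof. by have := lbeta 1 P Q; rewrite !scale1r. Qed.

Let b0 : beta 0 = 0.
Proof. by apply: (addrI (beta 0)); rewrite -bD !addr0. Qed.

Let bZ c P : beta (c *: P) = c *: beta P.
Proof. by have := lbeta c P 0; rewrite b0 !addr0. Qed.

Lemma word_innerE w c0 c1 t : word_inner beta w (c0, c1 :: t) =
  word_annihilate (fun P => star (last c1 t) *
    beta (starP (mono (c0, belast c1 t)) * P)) w.
Proof. by case: w => ? [|? ?]. Qed.

Lemma word_inner_balanced v : balanced (fun w => word_inner beta w v).
Proof.
case: v => c0 [|c1 t].
  have E w : word_inner beta w (c0, [::]) = 0 by case: w => ? [|? ?].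
  by split=> *; rewrite !E ?addr0.
set b' := fun P : PB => star (last c1 t) *
  beta (starP (mono (c0, belast c1 t)) * P).
have lb' : linear b'.
  by move=> c P Q; rewrite /b' mulrDr -scalerAr bD bZ mulrDr -scalerAr.
have [D Z] := word_annihilate_balanced lb'.
by split=> *; rewrite !word_innerE ?D ?Z.
Qed.

Lemma starPD (P Q : PB) : starP (P + Q) = starP P + starP Q.
Proof.
elim/polyW: P => s; elim/polyW: Q => t.
by rewrite -piD !pi_star map_cat piD.
Qed.

Lemma starPZ (c : R[i]) (P : PB) : starP (c *: P) = c^*%C *: starP P.
Proof.
elim/polyW: P => s; rewrite [X in starP X]pi_scale !pi_star.
rewrite [RHS]pi_scale; elim: s => //= w s IHs.
rewrite -cat1s piD IHs -[in RHS]cat1s [RHS]piD; congr (_ + _).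
rewrite -![\pi_(polyB B) [:: _]]/(mono _) wscaleE wstarM wstar_cst starZ star1.
by rewrite -monoM [mono (wcst _)]constBZ monoZ -scalerAr mulr1.
Qed.

Lemma word_inner_starE b0' b1 s v : word_inner beta (b0', b1 :: s) v =
  star (word_annihilate (fun Q =>
    star (beta (starP Q * mono (b0', belast b1 s)) * last b1 s)) v).
Proof.
by case: v => ? [|? ?] /=; rewrite ?star0// starM starK mulrA.
Qed.

Lemma inner0_balanced P :
  balanced (fun v => wlift (fun w => word_inner beta w v) P).
Proof.
have H w : balanced (word_inner beta w).
  case: w => a [|a' s].
    have E v : word_inner beta (a, [::]) v = 0 by [].
    by split=> *; rewrite !E ?addr0.
  set g := fun Q => star (beta (starP Q * mono (a, belast a' s)) * last a' s).
  have lg : linear g.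
    move=> c Q S; rewrite /g starPD starPZ mulrDl -scalerAl bD bZ mulrDl.
    by rewrite -scalerAl starD starZ conjcK.
  have [D Z] := word_annihilate_balanced lg.
  by split=> *; rewrite !word_inner_starE ?D ?Z ?starD.
split=> *; rewrite /wlift -?big_split; apply: eq_bigr => w _ /=;
  by have [D Z] := H w; rewrite ?D ?Z.
Qed.

Lemma inner0_mono w v : inner0 beta (mono w) (mono v) = word_inner beta w v.
Proof.
by rewrite /inner0 (wlift_mono v (inner0_balanced _)) (wlift_mono w (word_inner_balanced v)).
Qed.

Lemma innerDl P P' Q : inner beta (P + P') Q = inner beta P Q + inner beta P' Q.
Proof.
rewrite /inner /const_part (wliftD P P' (wconst_balanced B)) mulrDr addrACA.
congr (_ + _); rewrite /inner0 /wlift -big_split; apply: eq_bigr => v _.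
exact: wliftD (word_inner_balanced v).
Qed.

End LinearInner.

Lemma mu_0_mono beta b s : linear beta ->
  mu_0 beta (mono (b, s)) = inner beta (word_act beta b s 1) 1.
Proof.
move=> lb; rewrite /mu_0 wlift_mono//.
have [D Z] := word_act_balanced lb 1.
by split=> *; rewrite ?D ?Z ?(innerDl lb).
Qed.

End Distributions.

(* Main.v *)
Require Import Defs.
From HB Require Import structures.
From mathcomp Require Import all_boot all_order all_algebra.
From mathcomp Require Import generic_quotient.
From mathcomp Require Import boolp classical_sets functions reals.
From mathcomp Require Import complex ring lra zify.

Set Implicit Arguments.
Unset Strict Implicit.
Unset Printing Implicit Defensive.

Import Order.TTheory GRing.Theory Num.Theory.
Local Open Scope classical_set_scope.
Local Open Scope ring_scope.

(**
The series [Phi_series beta] is a sequence of first-return weights.  Splitting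
each composition of n at its first part turns the defining relation of the
B-transform into the triangular recursion [first_return] on the moments
([Btransform_first_return]), so that a distribution and its B-transform
determine each other.

The same recursion holds for every right B-linear operator [Op] on B<X> and
every unital B-bimodule map [phi : B<X> -> B]: decompose the vector
[b1 Op b2 Op ... bk Op 1] according to its last visit to the constants.  The
weights are then [phi (Op (b1 T b2 T ... bk T 1))], where
[T = Op - phi o Op] is the compression of [Op] to the kernel of [phi]
([compression_first_return]).  It is used twice.
- With [Op = a^* + a + p] and [phi] the constant term, [T] is multiplication by
  X and the weights are the values of [beta]; this is [Phi beta = mu_0 beta].
  The operator is symmetric for the inner product given by [beta], which is
  positive when [beta] is completely positive, so [mu_0 beta] is positive
  ([mu_0_pos]).
- With [Op] multiplication by X and [phi = mu], for a positive [mu] that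
  vanishes on BXB, one gets [mu = Phi beta] for
  [beta P = <P(T) X, X>_mu = mu (X * P(T) X)] ([Phi_Phi_inv]).  Since [T] is
  symmetric on the kernel of [mu], the sum in the definition of complete
  positivity is [mu (xi^* xi)] with [xi] the sum of the [P_j(T) X b_j]
  ([Phi_inv_cp]).

For the boundedness condition, the recursion shows that the moments grow
exponentially if and only if the weights do, with the constant doubled at worst
([cp_bounded_moment]).  The moments of an element of a C*-probability space
grow exponentially because the expectation and the inclusion of B are
contractive.  Conversely, if the moments of [mu] grow exponentially, then left
multiplication by X is bounded for the B-valued inner product of [mu]: the
squares [y_k] of the vectors [(X/2K)^k xi] form a convex sequence in the ordered
space B which tends to 0, hence they decrease ([op_bound_varX]).  The operator
norm of left multiplications is a C*-seminorm on B<X>, and the completion for it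
is a C*-probability space that realizes [mu] ([exp_bounded_Sigma0]).

Positivity is the existence of a factorization [y^* y], so the order properties
of C*-algebras used above (sums of positive elements are positive, positive
elements form a closed set, the norm is monotone) have to be derived.  They
follow from the description of the positive elements as the self-adjoint [a]
with [|t - a| <= t] for some [t >= 0], for which sums are immediate
([nneg], [cposP]).
*)

(** * Sequences of real numbers *)

Notation "t *r x" := ((t%:C)%C *: x) (at level 40, left associativity).

Section Small.
Variables (R : realType) (I : Type) (deg : I -> nat).
Implicit Types r s t : I -> R.

(** Null sequences are the case where n has degree n, and the Cauchy condition
    is the case where (m, n) has degree min m n. *)
Definition small r := forall e, 0 < e ->
  exists N, forall i, (N <= deg i)%N -> r i < e.

Lemma small_le2 (C : R) r s t : 0 <= C -> small r -> small s ->
  (forall i, t i <= C * (r i + s i)) -> small t.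
Proof.
move=> C0 sr ss h e e0.
have C1 : 0 < C + 1 by rewrite ltr_wpDl.
have e'0 : 0 < e / (C + 1) / 2 by rewrite !divr_gt0.
have [N hN] := sr _ e'0; have [M hM] := ss _ e'0.
exists (maxn N M) => i; rewrite geq_max => /andP[/hN Ni /hM Mi].
apply: le_lt_trans (h i) _.
have rs : r i + s i <= e / (C + 1).
  have -> : e / (C + 1) = e / (C + 1) / 2 + e / (C + 1) / 2.
    by field; rewrite lt0r_neq0.
  by rewrite ltW ?ltrD.
apply: le_lt_trans (ler_wpM2l C0 rs) _.
by rewrite mulrCA gtr_pMr// ltr_pdivrMr// mul1r ltrDl.
Qed.

Lemma small_le (C : R) r t : 0 <= C -> small r ->
  (forall i, t i <= C * r i) -> small t.
Proof.
move=> C0 sr h; apply: (@small_le2 (C / 2) r r) => //;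
  first by rewrite divr_ge0.
by move=> i; have -> : C / 2 * (r i + r i) = C * r i by field.
Qed.

End Small.

Notation null := (small (fun n : nat => n)).
Notation small2 := (small (fun ij : nat * nat => minn ij.1 ij.2)).

Section RealSequences.
Variable R : realType.
Implicit Types r s : nat -> R.

Lemma eventually_bounded r N C : (forall n, (N <= n)%N -> r n <= C) ->
  exists2 D, 0 <= D & forall n, r n <= D.
Proof.
move=> h; exists (`|C| + \sum_(i < N) `|r i|) => [|n].
  by rewrite addr_ge0// sumr_ge0.
have [Nn|nN] := leqP N n.
  by rewrite (le_trans (h n Nn))// ler_wpDr ?sumr_ge0// ler_norm.
rewrite ler_wpDl// (bigD1 (Ordinal nN))//= ler_wpDr ?sumr_ge0//.
exact: ler_norm.
Qed.

Lemma real_cauchy r : small2 (fun ij => `|r ij.1 - r ij.2|) ->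
  exists l, null (fun n => `|r n - l|).
Proof.
(* S consists of the eventual lower bounds of r. *)
move=> cr; pose S := [set x | exists N, forall n, (N <= n)%N -> x <= r n].
have loc e : 0 < e -> exists N0, forall N, (N0 <= N)%N ->
    S (r N - e) /\ forall x, S x -> x <= r N + e.
  move=> e0; have [N0 hN] := cr e e0; exists N0 => N N0N; split.
    exists N0 => n Nn; have /= := hN (N, n).
    rewrite leq_min N0N Nn => /(_ isT); rewrite ltr_norml; lra.
  move=> x [M hM]; have /= := hN (N, maxn N M).
  rewrite leq_min N0N (leq_trans N0N (leq_maxl _ _)) => /(_ isT).
  rewrite ltr_norml; have := hM _ (leq_maxr N M); lra.
have supS : has_sup S.
  have [N /(_ _ (leqnn N)) [SN uN]] := loc 1 ltr01.
  by split; [exists (r N - 1) | exists (r N + 1)].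
exists (sup S) => e e0; have e2 : 0 < e / 2 by rewrite divr_gt0.
have [N hN] := loc _ e2; exists N => n /hN[SN uN].
have lo := ub_le_sup supS.2 SN; have up := ge_sup supS.1 uN.
by rewrite ltr_norml; apply/andP; split; lra.
Qed.

End RealSequences.

(** * Submultiplicative seminorms *)

Section AlgebraNorm.
Variables (R : realType) (A : algType R[i]) (p : A -> R).
Implicit Types (x y z : A) (u v : nat -> A).

Record algebra_norm : Prop := AlgebraNorm {
  an_triangle : forall x y, p (x + y) <= p x + p y;
  an_scale : forall (c : R[i]) x, p (c *: x) = complex.Re `|c| * p x;
  an_mul : forall x y, p (x * y) <= p x * p y }.

Lemma Re_norm_real (t : R) : complex.Re `|(t%:C)%C| = `|t|.
Proof. by rewrite normc_def /= expr0n /= addr0 sqrtr_sqr. Qed.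

Hypothesis np : algebra_norm.

Lemma an_real t x : p (t *r x) = `|t| * p x.
Proof. by rewrite (an_scale np) Re_norm_real. Qed.

Lemma an0 : p 0 = 0.
Proof. by rewrite -(scale0r 0) (an_scale np) normr0 mul0r. Qed.

Lemma anN x : p (- x) = p x.
Proof. by rewrite -scaleN1r (an_scale np) normrN normr1 mul1r. Qed.

Lemma an_ge0 x : 0 <= p x.
Proof.
have := an_triangle np x (- x); rewrite subrr an0 anN; lra.
Qed.

Lemma anB x y : p (x - y) <= p x + p y.
Proof. by rewrite -(anN y) (an_triangle np). Qed.

Lemma an_distC x y : p (x - y) = p (y - x).
Proof. by rewrite -opprB anN. Qed.

Lemma an_dist_triangle x y z : p (x - z) <= p (x - y) + p (y - z).
Proof. by apply: le_trans (an_triangle np _ _); rewrite addrA subrK. Qed.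

Lemma an_dist_dist x y : `|p x - p y| <= p (x - y).
Proof.
have := an_triangle np (x - y) y; rewrite subrK => h1.
have := an_triangle np (y - x) x; rewrite subrK an_distC => h2.
rewrite ler_norml; apply/andP; split; lra.
Qed.

Lemma an_star_eq (st : A -> A) : involutive st ->
  (forall x, p (st x * x) = p x ^+ 2) -> forall x, p (st x) = p x.
Proof.
move=> stK pst x; have le z : p z <= p (st z).
  have := an_mul np (st z) z; rewrite pst.
  have := an_ge0 z; have := an_ge0 (st z).
  have [->//|] := eqVneq (p z) 0; nra.
by apply/eqP; rewrite eq_le le andbT -{2}(stK x) le.
Qed.

Definition cauchy u := small2 (fun ij => p (u ij.1 - u ij.2)).

Definition tends u x := null (fun n => p (u n - x)).

Lemma cauchy_bounded u : cauchy u -> exists2 D, 0 <= D & forall n, p (u n) <= D.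
Proof.
move=> cu; have [N hN] := cu 1 ltr01.
apply: (@eventually_bounded _ _ N (1 + p (u N))) => n Nn.
have /= := hN (n, N); rewrite leq_min Nn leqnn => /(_ isT).
have := an_triangle np (u n - u N) (u N); rewrite subrK; lra.
Qed.

Lemma cauchyD u v : cauchy u -> cauchy v -> cauchy (fun n => u n + v n).
Proof.
move=> cu cv; apply: (small_le2 ler01 cu cv) => -[i j] /=.
by rewrite mul1r opprD addrACA (an_triangle np).
Qed.

Lemma cauchyZ (c : R[i]) u : cauchy u -> cauchy (fun n => c *: u n).
Proof.
move=> cu; apply: (@small_le _ _ _ (complex.Re `|c|) _ _ _ cu) => [|[i j]/=].
  by rewrite normc_def /= sqrtr_ge0.
by rewrite -scalerBr (an_scale np).
Qed.

Lemma an_prod_dist x y x' y' :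
  p (x * y - x' * y') <= p x * p (y - y') + p (x - x') * p y'.
Proof.
have -> : x * y - x' * y' = x * (y - y') + (x - x') * y'.
  by rewrite mulrBr mulrBl addrA subrK.
apply: le_trans (an_triangle np _ _) _.
by apply: lerD; exact: (an_mul np).
Qed.

Lemma cauchyM u v : cauchy u -> cauchy v -> cauchy (fun n => u n * v n).
Proof.
move=> cu cv; have [D D0 uD] := cauchy_bounded cu.
have [E E0 vE] := cauchy_bounded cv.
apply: (small_le2 (addr_ge0 D0 E0) cv cu) => -[i j] /=.
apply: le_trans (an_prod_dist _ _ _ _) _.
have := an_ge0 (v i - v j); have := an_ge0 (u i - u j).
have := uD i; have := vE j; have := an_ge0 (u i); have := an_ge0 (v j); nra.
Qed.

Lemma cauchy_cst x : cauchy (fun=> x).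
Proof. by move=> e e0; exists 0%N => i _; rewrite subrr an0. Qed.

Lemma tends_cauchy u x : tends u x -> cauchy u.
Proof.
move=> ux e e0; have [N hN] := ux _ (divr_gt0 e0 (ltr0n _ 2)).
exists N => -[i j] /=; rewrite leq_min => /andP[/hN hi /hN hj].
have := an_dist_triangle (u i) x (u j); rewrite (an_distC x (u _)); lra.
Qed.

Lemma tends_cst x : tends (fun=> x) x.
Proof. by move=> e e0; exists 0%N => i _; rewrite subrr an0. Qed.

Lemma tendsD u v x y : tends u x -> tends v y ->
  tends (fun n => u n + v n) (x + y).
Proof.
move=> ux vy; apply: (small_le2 ler01 ux vy) => n.
by rewrite mul1r opprD addrACA (an_triangle np).
Qed.

Lemma tendsZ (c : R[i]) u x : tends u x -> tends (fun n => c *: u n) (c *: x).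
Proof.
move=> ux; apply: (@small_le _ _ _ (complex.Re `|c|) _ _ _ ux) => [|n].
  by rewrite normc_def /= sqrtr_ge0.
by rewrite -scalerBr (an_scale np).
Qed.

Lemma tendsM u v x y : tends u x -> tends v y ->
  tends (fun n => u n * v n) (x * y).
Proof.
move=> ux vy; have [D D0 uD] := cauchy_bounded (tends_cauchy ux).
apply: (small_le2 (addr_ge0 D0 (an_ge0 y)) vy ux) => n.
apply: le_trans (an_prod_dist _ _ _ _) _.
have := an_ge0 (v n - y); have := an_ge0 (u n - x).
have := uD n; have := an_ge0 y; have := an_ge0 (u n); nra.
Qed.

Lemma tends_le u x C : tends u x -> (forall n, p (u n) <= C) -> p x <= C.
Proof.
move=> ux uC; rewrite leNgt; apply/negP => Cx.
have xC0 : 0 < p x - C by rewrite subr_gt0.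
have [N /(_ N (leqnn N))] := ux _ xC0.
have := an_dist_triangle x (u N) 0; rewrite !subr0 (an_distC x); have := uC N;
  lra.
Qed.

Lemma tends_dist u x y : tends u x -> tends u y -> p (x - y) = 0.
Proof.
move=> ux uy; apply/eqP; rewrite eq_le an_ge0 andbT.
apply/ler_addgt0Pl => e e0; rewrite addr0.
have [N hN] := ux _ (divr_gt0 e0 (ltr0n _ 2)).
have [M hM] := uy _ (divr_gt0 e0 (ltr0n _ 2)).
have := hN _ (leq_maxl N M); have := hM _ (leq_maxr N M).
have := an_dist_triangle x (u (maxn N M)) y; rewrite (an_distC x (u _)); lra.
Qed.

End AlgebraNorm.

(** * Square roots in C*-algebras *)

Section CStarTheory.
Variables (R : realType) (A : cstarType R).
Implicit Types (x y z a b c : A) (t : R).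

Lemma cnorm_algebra_norm : algebra_norm (@cnorm R A).
Proof. by split; [exact: cnormD | exact: cnormZ | exact: cnormM]. Qed.

Let np := cnorm_algebra_norm.

Lemma cnorm_star_eq x : cnorm (star x) = cnorm x.
Proof. exact: (an_star_eq np (@starK R A) (@cnorm_star R A)). Qed.

Lemma starN x : star (- x) = - star x.
Proof. by apply/eqP; rewrite -addr_eq0 -starD addNr star0. Qed.

Lemma starB x y : star (x - y) = star x - star y.
Proof. by rewrite starD starN. Qed.

Lemma star_real t x : star (t *r x) = t *r star x.
Proof. by rewrite starZ conjc_real. Qed.

Lemma star_i x : star ('i%C *: x) = - ('i%C *: star x).
Proof.
by rewrite starZ -scaleNr; congr (_ *: _); apply/eqP;
  rewrite eq_complex /= oppr0 !eqxx.
Qed.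

Lemma cnorm1 : cnorm (1 : A) = 1.
Proof.
have := cnorm_star (1 : A); rewrite star1 mulr1.
have n1 : cnorm (1 : A) != 0 by apply: contra (oner_neq0 A) => /eqP/cnorm_eq0
  ->.
by rewrite expr2 => h; apply: (mulfI n1); rewrite mulr1.
Qed.

Lemma cnorm_real1 t : 0 <= t -> cnorm (t *r (1 : A)) = t.
Proof. by move=> t0; rewrite (an_real np) cnorm1 mulr1 ger0_norm. Qed.

Lemma cnorm_sa a : star a = a -> cnorm (a * a) = cnorm a ^+ 2.
Proof. by move=> sa; rewrite -{1}sa cnorm_star. Qed.

Lemma realrA (s t : R) x : s *r (t *r x) = (s * t) *r x.
Proof. by rewrite scalerA -rmorphM. Qed.

Lemma realrDl (s t : R) x : (s + t) *r x = s *r x + t *r x.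
Proof. by rewrite -scalerDl -rmorphD. Qed.

Lemma real1r x : 1 *r x = x.
Proof. by rewrite rmorph1 scale1r. Qed.

Lemma realr_half x : (2^-1) *r (x + x) = x.
Proof.
by rewrite scalerDr -realrDl (_ : 2^-1 + 2^-1 = 1 :> R) ?real1r//; field.
Qed.

Lemma commZ (k : R[i]) x y : GRing.comm x y -> GRing.comm x (k *: y).
Proof. by move=> xy; rewrite /GRing.comm -scalerAr -scalerAl xy. Qed.

(** If s is the limit of this sequence then s = (a + s^2)/2, that is,
    (1 - s)^2 = 1 - a. *)
Fixpoint sqrt_iter a n : A :=
  if n is n'.+1 then 2^-1 *r (a + sqrt_iter a n' * sqrt_iter a n') else 0.

(** The same iteration for the scalar 1: it majorizes both the iterates for a in
    the unit ball and their increments, so that the latter are summable even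
    when a has norm 1. *)
Fixpoint sqrt_iter_bound n : R :=
  if n is n'.+1 then 2^-1 * (1 + sqrt_iter_bound n' ^+ 2) else 0.

Lemma sqrt_iter_comm a c n : GRing.comm c a -> GRing.comm c (sqrt_iter a n).
Proof.
move=> ca; elim: n => [|n IHn] /=; first exact: commr0.
by apply/commZ/commrD => //; exact: commrM.
Qed.

Lemma sqrt_iter_sa a n : star a = a -> star (sqrt_iter a n) = sqrt_iter a n.
Proof.
move=> sa; elim: n => [|n IHn] /=; first exact: star0.
by rewrite star_real starD starM IHn sa.
Qed.

Lemma sqrt_iter_bound01 n : 0 <= sqrt_iter_bound n <= 1.
Proof.
by elim: n => [|n /andP[h0 h1]] /=; [rewrite lexx ler01 | apply/andP; split;
  nra].
Qed.

Lemma sqrt_iter_norm a n : cnorm a <= 1 ->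
  cnorm (sqrt_iter a n) <= sqrt_iter_bound n.
Proof.
move=> a1; elim: n => [|n IHn] /=; first by rewrite (an0 np).
rewrite (an_real np) gtr0_norm ?invr_gt0// ler_pM2l ?invr_gt0//.
apply: le_trans (cnormD _ _) (lerD a1 _); apply: le_trans (cnormM _ _) _.
by rewrite expr2 ler_pM// (an_ge0 np).
Qed.

Lemma sqrt_iter_step a n : cnorm a <= 1 ->
  cnorm (sqrt_iter a n.+1 - sqrt_iter a n) <=
  sqrt_iter_bound n.+1 - sqrt_iter_bound n.
Proof.
move=> a1; elim: n => [|n IHn].
  rewrite /= subr0 mulr0 addr0 (an_real np) gtr0_norm ?invr_gt0//.
  by rewrite subr0 expr0n addr0 ler_pM2l ?invr_gt0.
set s := sqrt_iter a n in IHn *; set s' := sqrt_iter a n.+1 in IHn *.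
have ss' : GRing.comm s s' by apply/sqrt_iter_comm/commr_sym/sqrt_iter_comm.
have -> : sqrt_iter a n.+2 - s' = 2^-1 *r ((s' + s) * (s' - s)).
  rewrite {1}/s' /= -/s -/s' -scalerBr opprD addrACA subrr add0r.
  by rewrite mulrDl !mulrBr ss' addrA subrK.
rewrite (an_real np) gtr0_norm ?invr_gt0//.
have h1 := sqrt_iter_norm n a1; have h2 := sqrt_iter_norm n.+1 a1.
rewrite -/s in h1; rewrite -/s' in h2.
have h3 := cnormM (s' + s) (s' - s); have h4 := cnormD s' s.
have := an_ge0 np (s' + s); have := an_ge0 np (s' - s).
have -> : sqrt_iter_bound n.+2 = 2^-1 * (1 + sqrt_iter_bound n.+1 ^+ 2) by [].
have : sqrt_iter_bound n.+1 = 2^-1 * (1 + sqrt_iter_bound n ^+ 2) by [].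
move: (sqrt_iter_bound n.+1) (sqrt_iter_bound n) IHn h1 h2 => r' r hd h1 h2 E
  d0 a0.
have : cnorm ((s' + s) * (s' - s)) <= (r' + r) * (r' - r).
  apply: le_trans h3 (ler_pM a0 d0 _ hd).
  exact: le_trans h4 (lerD h2 h1).
suff : 2^-1 * (1 + r' ^+ 2) - r' = 2^-1 * ((r' + r) * (r' - r)) :> R.
  by move=> ->; rewrite ler_pM2l ?invr_gt0.
by rewrite {2}E; field.
Qed.

Lemma sqrt_iter_dist a n k : cnorm a <= 1 ->
  cnorm (sqrt_iter a (n + k) - sqrt_iter a n) <=
  sqrt_iter_bound (n + k) - sqrt_iter_bound n.
Proof.
move=> a1; elim: k => [|k IHk]; first by rewrite addn0 !subrr (an0 np).
have := an_dist_triangle np (sqrt_iter a (n + k.+1)) (sqrt_iter a (n + k))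
  (sqrt_iter a n).
have := sqrt_iter_step (n + k) a1; rewrite -addnS; lra.
Qed.

Lemma sqrt_iter_bound_mono n k : sqrt_iter_bound n <= sqrt_iter_bound (n + k).
Proof.
elim: k => [|k IHk]; rewrite ?addn0// addnS /=; apply: le_trans IHk _.
by have /andP[] := sqrt_iter_bound01 (n + k); move: (sqrt_iter_bound _) => r;
  nra.
Qed.

Lemma sqrt_iter_cauchy a : cnorm a <= 1 -> cauchy (@cnorm R A) (sqrt_iter a).
Proof.
move=> a1 e e0; pose S := range sqrt_iter_bound.
have supS : has_sup S.
  split; first by exists (sqrt_iter_bound 0), 0%N.
  by exists 1 => _ [n _ <-]; have /andP[] := sqrt_iter_bound01 n.
have [_ [N _ <-] hN] := sup_adherent e0 supS.
have bd n k : (N <= n)%N -> cnorm (sqrt_iter a (n + k) - sqrt_iter a n) < e.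
  move=> Nn; apply: le_lt_trans (sqrt_iter_dist n k a1) _.
  have := sqrt_iter_bound_mono N (n - N); rewrite subnKC//.
  have := ub_le_sup supS.2 (imageT sqrt_iter_bound (n + k)).
  by move: hN; rewrite /S; lra.
exists N => -[i j] /=; rewrite leq_min => /andP[Ni Nj].
have [ij|/ltnW ji] := leqP i j; last by rewrite -(subnKC ji) bd.
by rewrite -(subnKC ij) (an_distC np) bd.
Qed.

Lemma tends_eq u x y : tends (@cnorm R A) u x -> tends (@cnorm R A) u y ->
  x = y.
Proof.
by move=> ux uy; apply/eqP; rewrite -subr_eq0;
  apply/eqP/cnorm_eq0/(tends_dist np ux uy).
Qed.

Lemma complete u : cauchy (@cnorm R A) u -> exists x, tends (@cnorm R A) u x.
Proof.
move=> cu; have [e e0|x ux] := cnorm_complete u; last by exists x => e /ux.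
have [N hN] := cu e e0; exists N => m n Nm Nn.
by apply: (hN (m, n)); rewrite leq_min Nm.
Qed.

Lemma tends_star u x : tends (@cnorm R A) u x ->
  tends (@cnorm R A) (fun n => star (u n)) (star x).
Proof.
by move=> ux e /ux[N hN]; exists N => n /hN; rewrite -starB cnorm_star_eq.
Qed.

(** The square root is a limit of polynomials in a, hence it commutes with
    whatever commutes with a. *)
Lemma sqrt_one_minus a : star a = a -> cnorm a <= 1 -> exists s,
  [/\ star s = s, s * s = 1 - a, cnorm (1 - s) <= 1
    & forall c, GRing.comm c a -> GRing.comm c s].
Proof.
move=> sa a1; have [l hl] := complete (sqrt_iter_cauchy a1).
exists (1 - l); split.
- rewrite starB star1; congr (_ - _); apply: (tends_eq _ hl).
  have := tends_star hl; congr tends; apply/funext => n.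
  exact: sqrt_iter_sa.
- have hS : tends (@cnorm R A) (fun n => sqrt_iter a n.+1) l.
    by move=> e /hl[N hN]; exists N => n Nn; apply: hN; rewrite leqW.
  have hS' : tends (@cnorm R A) (fun n => sqrt_iter a n.+1) (2^-1 *r (a + l *
    l)).
    apply: (tendsZ np); apply: (tendsD np); first exact: (tends_cst np).
    exact: (tendsM np).
  have E := tends_eq hS hS'.
  have {E} : l + l = a + l * l.
    by rewrite {1 2}E -scalerDr realr_half.
  move=> E; rewrite mulrBl !mulrBr !mul1r mulr1 -[in RHS](addrK (l * l) a) -E.
  by rewrite !opprD !opprK !addrA.
- rewrite opprB addrC subrK; apply: (tends_le np hl) => n.
  apply: le_trans (sqrt_iter_norm n a1) _.
  by have /andP[] := sqrt_iter_bound01 n.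
- move=> c ca; apply: commrB (commr1 _) _;
  apply: (@tends_eq (fun n => c * sqrt_iter a n)).
    exact: (tendsM np (tends_cst np _)).
  have := tendsM np hl (tends_cst np c); congr tends; apply/funext => n.
  by have := sqrt_iter_comm n ca.
Qed.

End CStarTheory.

(** * The positive cone *)

Section Cone.
Variables (R : realType) (A : cstarType R).
Implicit Types (x y z a b c s : A) (t : R).

Let np := @cnorm_algebra_norm R A.

(** With u = c + is one has u* u = c^2 + s^2, and c is the real part of u. *)
Lemma cnorm_sa_commute s c : star s = s -> star c = c -> GRing.comm c s ->
  cnorm c ^+ 2 <= cnorm (c * c + s * s).
Proof.
move=> ss sc cs; pose u := c + 'i%C *: s.
have su : star u = c - 'i%C *: s by rewrite /u starD star_i ss sc.
have uu : star u * u = c * c + s * s.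
  rewrite su /u mulrBl !mulrDr -!scalerAl -!scalerAr scalerA.
  by rewrite -(expr2 'i%C) sqr_i scaleN1r cs opprD opprK addrA addrK.
rewrite -uu cnorm_star ler_pXn2r ?nnegrE ?(an_ge0 np)//.
have -> : c = 2^-1 *r (u + star u).
  by rewrite su /u addrACA subrr addr0 realr_half.
rewrite (an_real np) gtr0_norm ?invr_gt0//.
have := cnormD u (star u); rewrite cnorm_star_eq; lra.
Qed.

(** For c the square root of 1 - s^2, the element c + is is unitary. *)
Lemma cnorm_one_minus_sqr s : star s = s -> cnorm s <= 1 ->
  cnorm (1 - s * s) <= 1.
Proof.
move=> ss s1; have [||c [sc cc _ cs]] := @sqrt_one_minus _ _ (s * s).
- by rewrite starM ss.
- by rewrite cnorm_sa// expr2 mulr_ile1 ?(an_ge0 np).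
have := cnorm_sa_commute ss sc.
rewrite cc subrK cnorm1 -cc cnorm_sa//; apply.
by apply/commr_sym/cs/commrM; exact: commr_refl.
Qed.

(** In terms of the spectrum of the self-adjoint a, the inequality says that it
    lies in [0, 2t]. *)
Definition nneg a := star a = a /\ exists2 t, 0 <= t & cnorm (t *r 1 - a) <= t.

Lemma real_sa t : star (t *r (1 : A)) = t *r 1.
Proof. by rewrite star_real star1. Qed.

Lemma real_mull t x : (t *r 1) * x = t *r x.
Proof. by rewrite -scalerAl mul1r. Qed.

Lemma real_mulr t x : x * (t *r 1) = t *r x.
Proof. by rewrite -scalerAr mulr1. Qed.

Lemma nneg0 : nneg 0.
Proof. by split; [exact: star0 | exists 0; rewrite ?subr0 ?cnorm_real1]. Qed.

Lemma nnegD a b : nneg a -> nneg b -> nneg (a + b).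
Proof.
move=> [sa [t t0 ta]] [sb [u u0 ub]]; split; first by rewrite starD sa sb.
exists (t + u); first exact: addr_ge0.
by rewrite realrDl opprD addrACA (le_trans (cnormD _ _))// lerD.
Qed.

Lemma nnegZ t a : 0 <= t -> nneg a -> nneg (t *r a).
Proof.
move=> t0 [sa [u u0 ua]]; split; first by rewrite star_real sa.
exists (t * u); first exact: mulr_ge0.
by rewrite -realrA -scalerBr (an_real np) ger0_norm// ler_wpM2l.
Qed.

Lemma nneg_ball t a : 0 <= t -> star a = a -> cnorm a <= t -> nneg (t *r 1 - a).
Proof.
move=> t0 sa ta; split; first by rewrite starB real_sa sa.
by exists t => //; rewrite opprB addrC subrK.
Qed.

Lemma sqr_ball s t : 0 < t -> star s = s -> cnorm s ^+ 2 <= t ->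
  cnorm (t *r 1 - s * s) <= t.
Proof.
move=> t0 ss st; pose r := Num.sqrt t; have r0 : 0 < r by rewrite sqrtr_gt0.
have rr : r * r = t by rewrite -expr2 sqr_sqrtr// ltW.
have s1 : cnorm (r^-1 *r s) <= 1.
  rewrite (an_real np) gtr0_norm ?invr_gt0// mulrC ler_pdivrMr// mul1r.
  by rewrite -(@ler_pXn2r _ 2) ?nnegrE ?(an_ge0 np) ?(ltW r0)// [r ^+ 2]expr2
    rr.
have := cnorm_one_minus_sqr _ s1; rewrite star_real ss => /(_ erefl) h.
have -> : t *r 1 - s * s = t *r (1 - (r^-1 *r s) * (r^-1 *r s)).
  rewrite scalerBr -scalerAl -scalerAr !realrA -rr.
  by rewrite (_ : r * r * r^-1 * r^-1 = 1) ?real1r//; field; rewrite lt0r_neq0.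
by rewrite (an_real np) gtr0_norm// ger_pMr.
Qed.

Lemma nneg_sqr s : star s = s -> nneg (s * s).
Proof.
move=> ss; split; first by rewrite starM ss.
have s0 := an_ge0 np s.
exists (cnorm s ^+ 2 + 1); first by rewrite ltW// ltr_wpDl// sqr_ge0.
by apply: sqr_ball => //; rewrite ?ltr_wpDl ?sqr_ge0// lerDl.
Qed.

Lemma nneg_sqrt a : nneg a -> exists s,
  [/\ star s = s, s * s = a, nneg s & forall c, GRing.comm c a ->
    GRing.comm c s].
Proof.
move=> [sa [t]]; rewrite le_eqVlt => /orP[/eqP<-|t0 ta].
  rewrite scale0r sub0r (anN np) => a0.
  have -> : a = 0 by apply/cnorm_eq0/eqP; rewrite eq_le a0 (an_ge0 np).
  by exists 0; split; rewrite ?star0 ?mul0r//; exact: nneg0.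
pose r := Num.sqrt t; have r0 : 0 < r by rewrite sqrtr_gt0.
have rr : r * r = t by rewrite -expr2 sqr_sqrtr// ltW.
have [||q [sq qq q1 qc]] := @sqrt_one_minus _ _ (1 - t^-1 *r a).
- by rewrite starB star1 star_real sa.
- have -> : 1 - t^-1 *r a = t^-1 *r (t *r 1 - a).
    by rewrite scalerBr realrA mulVf ?real1r// lt0r_neq0.
  rewrite (an_real np) gtr0_norm ?invr_gt0// mulrC ler_pdivrMr//.
  by rewrite mul1r.
exists (r *r q); split.
- by rewrite star_real sq.
- rewrite -scalerAl -scalerAr realrA rr qq opprB addrC subrK realrA.
  by rewrite mulfV ?real1r// lt0r_neq0.
- split; first by rewrite star_real sq.
  exists r; first exact: ltW.
  by rewrite -scalerBr (an_real np) gtr0_norm// ger_pMr.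
- move=> c ca; apply/commZ/qc/commrB; first exact: commr1.
  exact: commZ.
Qed.

Lemma nneg_bound a t : nneg a -> cnorm a <= t -> cnorm (t *r 1 - a) <= t.
Proof.
move=> /nneg_sqrt[s [ss sa _ _]] at_.
have [t0|t0] := ltP 0 t; first by rewrite -sa sqr_ball// -cnorm_sa// sa.
have a0 := an_ge0 np a; have -> : a = 0.
  by apply/cnorm_eq0/eqP; rewrite eq_le a0 (le_trans at_).
have {t0 at_ a0} -> : t = 0 by lra.
by rewrite scale0r subr0 (an0 np).
Qed.

(** Commuting square roots r of a and s of t - a satisfy r^2 + s^2 = t. *)
Lemma nneg_norm_le a t : 0 <= t -> nneg a -> nneg (t *r 1 - a) -> cnorm a <= t.
Proof.
move=> t0 /nneg_sqrt[r [sr ra _ rc]] /nneg_sqrt[s [ss sa _ sc]].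
have rs : GRing.comm r s.
  apply/sc/commrB; first exact/commZ/commr1.
  by rewrite -ra; apply: commrM.
have := cnorm_sa_commute ss sr rs.
by rewrite ra sa addrC subrK cnorm_real1// -ra cnorm_sa.
Qed.

(** If a and - a are both nonnegative, then e - a is nonnegative for each
    e > 0, so the norm of a is at most e. *)
Lemma nneg_antisym a : nneg a -> nneg (- a) -> a = 0.
Proof.
move=> pa na; apply/cnorm_eq0/eqP; rewrite eq_le (an_ge0 np) andbT.
apply/ler_addgt0Pl => e e0; rewrite addr0; apply: nneg_norm_le pa _;
  first exact: ltW.
apply: nnegD => //; rewrite -[X in nneg X]subr0; apply: nneg_ball;
  first exact: ltW.
  exact: star0.
by rewrite (an0 np) ltW.
Qed.

Lemma power_sa a n : star a = a -> star (a ^+ n) = a ^+ n.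
Proof.
move=> sa; elim: n => [|n IHn]; first by rewrite expr0 star1.
by rewrite exprSr starM IHn sa -exprS -exprSr.
Qed.

Lemma cnorm_sa_power a n : star a = a ->
  cnorm (a ^+ (2 ^ n)) = cnorm a ^+ (2 ^ n).
Proof.
move=> sa; elim: n => [|n IHn]; first by rewrite expn0 !expr1.
by rewrite expnS mul2n -addnn !exprD cnorm_sa ?power_sa// IHn expr2.
Qed.

(** Conjugation moves y across the powers of t - y* y, so the norms of these
    powers grow like those of t - y y* up to a factor linear in the exponent. *)
Lemma power_swap y t n : exists2 q,
  (t *r 1 - star y * y) ^+ n = t ^+ n *r 1 - star y * q * y
  & 0 <= t -> cnorm (t *r 1 - y * star y) <= t -> cnorm q * t <= n%:R * t ^+ n.
Proof.
elim: n => [|n [q Eq hq]].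
  exists 0; first by rewrite !expr0 real1r mulr0 mul0r subr0.
  by rewrite (an0 np) !mul0r.
exists (t ^+ n *r 1 + (t *r 1 - y * star y) * q).
  rewrite exprS Eq mulrBr real_mulr scalerBr realrA -exprSr -addrA -opprD.
  congr (_ - _); rewrite mulrDr mulrDl real_mulr -scalerAl; congr (_ + _).
  rewrite !mulrA; congr (_ * _ * _).
  by rewrite mulrBl mulrBr real_mull real_mulr mulrA.
move=> t0 yt; have {}hq := hq t0 yt.
have tn : 0 <= t ^+ n by exact: exprn_ge0.
have h1 := cnormD (t ^+ n *r 1) ((t *r 1 - y * star y) * q).
have h2 := cnormM (t *r 1 - y * star y) q.
rewrite cnorm_real1// in h1.
have h3 : cnorm (t *r 1 - y * star y) * cnorm q <= t * cnorm q.
  by rewrite ler_wpM2r// (an_ge0 np).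
rewrite exprSr -natr1.
have : cnorm (t ^+ n *r 1 + (t *r 1 - y * star y) * q) * t <= (t ^+ n + t *
  cnorm q) * t.
  by rewrite ler_wpM2r//; lra.
nra.
Qed.

Lemma bernoulli t n : 0 <= t -> 1 + n%:R * t <= (1 + t) ^+ n.
Proof.
move=> t0; elim: n => [|n IHn]; first by rewrite mul0r addr0 expr0.
rewrite exprS -natr1; have := ler_wpM2l (addr_ge0 ler01 t0) IHn.
have : 0 <= n%:R :> R by []. nra.
Qed.

(** If r > 1, then by the Bernoulli inequality, applied to half the exponent,
    the powers of r grow at least quadratically. *)
Lemma subexponential_le1 r (K : R) : 0 <= r ->
  (forall n, r ^+ (2 ^ n) <= 1 + (2 ^ n)%:R * K) -> r <= 1.
Proof.
move=> r0 h; rewrite leNgt; apply/negP => r1.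
pose d := r - 1; have d0 : 0 < d by rewrite subr_gt0.
have rd : r = 1 + d by rewrite /d addrC subrK.
have K0 : 0 <= K.
  have := h 0%N; rewrite expr1 mul1r; lra.
pose M := K * 2 / d ^+ 2.
have [n Mn] : exists n : nat, M < (2 ^ n)%:R.
  exists (Num.bound M); apply: lt_trans (archi_boundP _) _.
    by apply: divr_ge0; [exact: mulr_ge0 | exact: sqr_ge0].
  by rewrite ltr_nat ltn_expl.
have := h n.+1; rewrite expnS mulnC exprM expr2 natrM.
have := bernoulli (2 ^ n) (ltW d0); rewrite -rd.
rewrite /M ltr_pdivrMr ?exprn_gt0// in Mn.
move: (r ^+ (2 ^ n)) ((2 ^ n)%:R : R) Mn => X m Mn X1 X2.
have m0 : 0 < m.
  have d2 : 0 < d ^+ 2 by rewrite exprn_gt0.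
  have : 0 < m * d ^+ 2 by apply: le_lt_trans _ Mn; rewrite mulr_ge0.
  by rewrite pmulr_lgt0.
have : (1 + m * d) ^+ 2 <= X * X by rewrite -expr2 ler_pXn2r ?nnegrE//; nra.
have : m * (K * 2) < m * (m * d ^+ 2) by rewrite ltr_pM2l.
have : 0 < m * d by rewrite mulr_gt0.
nra.
Qed.

(** The elements y* y and y y* have the same spectrum up to 0.  Instead of the
    spectrum, the norms of the powers of t - y* y are compared with those of
    t - y y*. *)
Lemma nneg_swap y : nneg (y * star y) -> nneg (star y * y).
Proof.
move=> py; pose t := cnorm (y * star y) + 1.
have y0 := an_ge0 np (y * star y).
have t0 : 0 < t by rewrite ltr_wpDl.
have yt : cnorm (t *r 1 - y * star y) <= t by rewrite nneg_bound// lerDl.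
have sy : star (star y * y) = star y * y by rewrite starM starK.
split=> //; exists t; first exact: ltW.
set d := t *r 1 - star y * y.
have sd : star d = d by rewrite starB real_sa sy.
suff : cnorm d / t <= 1 by rewrite ler_pdivrMr// mul1r.
apply: (@subexponential_le1 _ (cnorm (star y) * cnorm y / t)).
  by rewrite divr_ge0 ?(an_ge0 np)// ltW.
move=> n; rewrite expr_div_n -cnorm_sa_power//.
have [q Eq /(_ (ltW t0) yt) hq] := power_swap y t (2 ^ n).
rewrite -/d in Eq; rewrite Eq ler_pdivrMr ?exprn_gt0//.
have tn : 0 < t ^+ (2 ^ n) by rewrite exprn_gt0.
apply: le_trans (anB np _ _) _; rewrite cnorm_real1 ?(ltW tn)//.
set K := cnorm (star y) * cnorm y; set m := (2 ^ n)%N in tn hq *.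
have -> : (1 + m%:R * (K / t)) * t ^+ m = t ^+ m + K * (m%:R * t ^+ m) / t.
  by move: (t ^+ m) (m%:R) => X Y; field; rewrite lt0r_neq0.
have K0 : 0 <= K by rewrite mulr_ge0 ?(an_ge0 np).
rewrite lerD2l ler_pdivlMr//; apply: le_trans (ler_wpM2l K0 hq).
rewrite mulrA ler_pM2r//; apply: le_trans (cnormM _ _) _.
by rewrite /K mulrAC ler_wpM2r ?(an_ge0 np)// cnormM.
Qed.

(** With d = |x* x| and b = d - x* x, the element y = x b satisfies
    y* y = - b d b <= 0, hence also y y* >= 0 and y* y >= 0; so y* y = 0,
    which forces b = 0. *)
Lemma nneg_starM x : nneg (star x * x).
Proof.
set a := star x * x.
have sa : star a = a by rewrite starM starK.
have aa : GRing.comm a (a * a) by apply: commrM.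
have [d [sd dd pd dc]] := nneg_sqrt (nneg_sqr sa).
have ad : GRing.comm a d by exact: dc.
have [h [sh hh _ hc]] := nneg_sqrt pd.
have ah : GRing.comm a h by exact: hc.
have hd : GRing.comm d h by exact: hc.
pose b := d - a; have sb : star b = b by rewrite starB sd sa.
have bh : GRing.comm b h by apply/commr_sym/commrB; apply: commr_sym.
have db : GRing.comm d b by apply: commrB => //; apply: commr_sym.
have abE : a * b = - (b * d).
  by rewrite /b mulrBr mulrBl -dd opprB ad.
pose y := x * b.
have yyE : star y * y = - ((b * h) * (b * h)).
  rewrite /y starM sb -!mulrA (mulrA (star x)) -/a abE mulrN; congr (- (_ * _)).
  by rewrite [RHS]mulrA -bh -hh mulrA.
have sbh : star (b * h) = b * h by rewrite starM sb sh bh.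
have nyy : nneg (- (star y * y)) by rewrite yyE opprK; apply: nneg_sqr.
have yy0 : star y * y = 0.
  apply: nneg_antisym => //; apply: nneg_swap.
  (* The sum y y* + y* y is 2 (u^2 + v^2) for y = u + iv. *)
  pose u := 2^-1 *r (y + star y); pose v := (- 'i)%C *: (2^-1 *r (y - star y)).
  have su : star u = u by rewrite /u star_real starD starK addrC.
  have ii : ('i%C : R[i]) * 'i%C = -1 by rewrite -expr2 sqr_i.
  have sv : star v = v.
    by rewrite /v !scaleNr starN star_i opprK star_real starB starK -opprB
      !scalerN.
  have yE : y = u + 'i%C *: v.
    rewrite /v scalerA mulrN ii opprK scale1r -scalerDr addrACA subrr addr0.
    by rewrite realr_half.
  clearbody u v.
  have -> : y * star y = (u * u + v * v) + (u * u + v * v) + - (star y * y).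
    rewrite {1 2 3 4}yE starD star_i su sv.
    rewrite !mulrDl !mulrDr !mulNr !mulrN -!scalerAl -!scalerAr !scalerA ii.
    rewrite !scaleN1r !opprK.
    move: (u * u) (v * v) ('i%C *: (u * v)) ('i%C *: (v * u)) => uu vv uv vu.
    rewrite !opprD !opprK.
    have -> : - uu - uv + (vu - vv) = (vu - uv) - (uu + vv).
      by rewrite (addrC (- uu)) addrACA (addrC vu) -opprD.
    have -> (S D : A) : S + S + (D - S) = S + D.
      by rewrite -addrA; congr (_ + _); rewrite addrCA subrr addr0.
    rewrite addrACA [RHS]addrACA.
    by rewrite (addrC vv).
  by do 3?apply: nnegD => //; apply: nneg_sqr.
have bh0 : b * h = 0.
  apply/cnorm_eq0/eqP; rewrite -sqrf_eq0 -cnorm_sa//.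
  by rewrite -[_ * _]opprK -yyE yy0 oppr0 (an0 np).
have bd0 : b * d = 0 by rewrite -hh mulrA bh0 mul0r.
have bb0 : b * b = 0 by rewrite {1}/b mulrBl db abE opprK bd0 addr0.
have b0 : b = 0.
  by apply/cnorm_eq0/eqP; rewrite -sqrf_eq0 -cnorm_sa// bb0 (an0 np).
by have -> : a = d by apply/esym/eqP; rewrite -subr_eq0 -/b b0.
Qed.

Lemma cposP a : cpos a <-> nneg a.
Proof.
split=> [[y ->]|/nneg_sqrt[s [ss <- _ _]]]; first exact: nneg_starM.
by exists s; rewrite ss.
Qed.

Lemma cpos_starM x : cpos (star x * x). Proof. by exists x. Qed.

Lemma cpos_sa a : cpos a -> star a = a.
Proof. by move=> /cposP[]. Qed.

Lemma cpos0 : cpos (0 : A).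
Proof. by apply/cposP/nneg0. Qed.

Lemma cposD a b : cpos a -> cpos b -> cpos (a + b).
Proof. by move=> /cposP pa /cposP pb; apply/cposP/nnegD. Qed.

Lemma cposZ t a : 0 <= t -> cpos a -> cpos (t *r a).
Proof. by move=> t0 /cposP pa; apply/cposP/nnegZ. Qed.

Lemma cpos_ball t a : 0 <= t -> star a = a -> cnorm a <= t -> cpos (t *r 1 - a).
Proof. by move=> *; apply/cposP/nneg_ball. Qed.

Lemma cpos_norm_le a t : 0 <= t -> cpos a -> cpos (t *r 1 - a) -> cnorm a <= t.
Proof. by move=> t0 /cposP pa /cposP pt; apply: nneg_norm_le. Qed.

(** The defining inequality of the cone may be tested with any t beyond the
    norm of a, hence with the same t for all elements close to a. *)
Lemma cpos_closed a :
  (forall e, 0 < e -> exists2 b, cpos b & cnorm (a - b) < e) -> cpos a.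
Proof.
move=> ha; apply/cposP; split.
  apply/eqP; rewrite -subr_eq0; apply/eqP/cnorm_eq0/eqP.
  rewrite eq_le (an_ge0 np) andbT; apply/ler_addgt0Pl => e e0; rewrite addr0.
  have [b /cpos_sa sb ab] := ha _ (divr_gt0 e0 (ltr0n _ 2)).
  have := an_dist_triangle np (star a) b a.
  rewrite -{1}sb -starB cnorm_star_eq (an_distC np b a); lra.
have a0 := an_ge0 np a.
exists (cnorm a + 1); first by rewrite addr_ge0.
apply/ler_addgt0Pr => e e0.
have m0 : 0 < Num.min 1 e by rewrite lt_min ltr01.
have [b /cposP pb ab] := ha _ m0.
have [a1 ae] : cnorm (a - b) < 1 /\ cnorm (a - b) < e by apply/andP;
  rewrite -lt_min.
have b1 : cnorm b <= cnorm a + 1.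
  have := an_dist_triangle np b a 0; rewrite !subr0 (an_distC np b a); lra.
have := nneg_bound pb b1.
have := cnormD ((cnorm a + 1) *r 1 - b) (b - a).
rewrite addrA subrK (an_distC np b a); lra.
Qed.

End Cone.

(** * Compositions of an integer *)

Section Compositions.
Variables (V : nzRingType) (N : nat) (w : nat -> nat -> V).

(** Compositions started at p instead of 0, with the same end point N: after
    removing the first step, a chain is again a chain with the same codomain. *)
Definition chain k p (q : {ffun 'I_k.+1 -> 'I_N.+1}) : bool :=
  [&& q ord0 == p :> nat, q ord_max == N :> nat
    & [forall i : 'I_k.+1, forall j : 'I_k.+1, (i < j)%N ==> (q i < q j)%N]].

Definition chain_weight k (q : {ffun 'I_k.+1 -> 'I_N.+1}) : V :=
  \prod_(j < k) w (q (inord j)) (q (inord j.+1)).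

Definition chain_sum k p : V := \sum_(q | @chain k p q) chain_weight q.

Definition chain_cons k (x : 'I_N.+1) (q : {ffun 'I_k.+1 -> 'I_N.+1}) :
    {ffun 'I_k.+2 -> 'I_N.+1} :=
  [ffun i => if unlift ord0 i is Some j then q j else x].

Lemma chain_cons0 k x q : @chain_cons k x q ord0 = x.
Proof. by rewrite ffunE unlift_none. Qed.

Lemma chain_consS k x q j : @chain_cons k x q (lift ord0 j) = q j.
Proof. by rewrite ffunE liftK. Qed.

Lemma chain_consE k p x (q : {ffun 'I_k.+1 -> 'I_N.+1}) :
  chain p (chain_cons x q) =
  (x == p :> nat) && ((p < q ord0)%N && chain (q ord0) q).
Proof.
have max_lift : (ord_max : 'I_k.+2) = lift ord0 ord_max by apply/val_inj.
rewrite /chain chain_cons0 max_lift chain_consS eqxx /=.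
case: eqP => //= <-; rewrite [RHS]andbCA; congr (_ && _).
apply/forallP/andP => [h|[lt0 /forallP h] i].
  split; first by have /forallP/(_ (lift ord0 ord0)) := h ord0;
    rewrite chain_cons0 chain_consS.
  apply/forallP => i; apply/forallP => j; apply/implyP => ij.
  have /forallP/(_ (lift ord0 j))/implyP := h (lift ord0 i).
  by rewrite !chain_consS; apply.
apply/forallP => j; apply/implyP.
case: (unliftP ord0 j) => [j'|] ->; last by rewrite ltn0.
rewrite chain_consS; case: (unliftP ord0 i) => [i'|] -> ij; last first.
  rewrite chain_cons0; case: (posnP j') => [j0|j0].
    by rewrite (_ : j' = ord0)//; apply: val_inj.
  have /forallP/(_ j')/implyP/(_ j0) := h ord0; exact: ltn_trans.
by rewrite chain_consS; have /forallP/(_ j')/implyP := h i'; apply.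
Qed.

Lemma chain_weight_cons k x (q : {ffun 'I_k.+1 -> 'I_N.+1}) :
  chain_weight (chain_cons x q) = w x (q ord0) * chain_weight q.
Proof.
rewrite /chain_weight big_ord_recl.
have in0 : inord 0 = ord0 :> 'I_k.+2 by apply: val_inj; rewrite /= inordK.
have inS j : (j < k.+1)%N -> inord j.+1 = lift ord0 (inord j) :> 'I_k.+2.
  by move=> jk; apply: val_inj; rewrite /= /bump /= !inordK.
rewrite [(@ord0 k : nat)]/= in0 inS// chain_cons0 chain_consS.
congr (w _ (q _) * _); first by apply: val_inj; rewrite /= inordK.
apply: eq_bigr => j _; have jk := ltn_ord j.
rewrite (_ : (lift ord0 j : nat) = j.+1)// !inS ?chain_consS//.
exact: ltnW.
Qed.

Lemma chain_sumS k (p : 'I_N.+1) :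
  chain_sum k.+1 p = \sum_(x : 'I_N.+1 | (p < x)%N) w p x * chain_sum k x.
Proof.
pose Q (q : {ffun 'I_k.+1 -> 'I_N.+1}) := (p < q ord0)%N && chain (q ord0) q.
transitivity (\sum_(q | Q q) w p (q ord0) * chain_weight q).
  rewrite /chain_sum (reindex (fun xq => chain_cons xq.1 xq.2)) /=; last first.
    exists (fun q => (q ord0, [ffun j => q (lift ord0 j)])) => [[x q] _|q _] /=.
      rewrite chain_cons0; congr (_, _); apply/ffunP => j.
      by rewrite ffunE chain_consS.
    apply/ffunP => i; rewrite ffunE; case: unliftP => [j|] -> //.
    by rewrite ffunE.
  under eq_bigl do rewrite chain_consE.
  under eq_bigr do rewrite chain_weight_cons.
  rewrite -(pair_big (fun x : 'I_N.+1 => x == p :> nat) Q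
    (fun x q => w x (q ord0) * chain_weight q)) /=.
  by rewrite (eq_bigl (pred1 p)) ?big_pred1_eq.
under [RHS]eq_bigr do rewrite /chain_sum big_distrr.
rewrite (exchange_big_dep Q) /=; last first.
  by move=> x q px /[dup] /andP[/eqP qx _] cq; rewrite /Q qx px cq.
apply: eq_bigr => q Qq; rewrite (big_pred1 (q ord0))// => x /=.
apply/andP/eqP => [[_ /andP[/eqP qx _]]|->]; first exact: val_inj.
by move: Qq; rewrite /Q => /andP[].
Qed.

Lemma chain_sum0 (p : 'I_N.+1) : chain_sum 0 p = if p == N :> nat then 1 else 0.
Proof.
rewrite /chain_sum; under eq_bigr do rewrite /chain_weight big_ord0.
case: eqP => pN; last first.
  rewrite big1 // => q /andP[/eqP q0 /andP[/eqP qN _]]; case: pN.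
  by apply: etrans (esym q0) (etrans _ qN); congr (nat_of_ord (q _));
    apply: val_inj.
rewrite (big_pred1 [ffun=> p])// => q; apply/andP/eqP => [[/eqP q0 _]|->].
  by apply/ffunP => i; rewrite ffunE (ord1 i); apply: val_inj.
rewrite !ffunE pN eqxx; split=> //=; apply/forallP => i; apply/forallP => j.
by rewrite !ord1.
Qed.

Lemma chain_sum_eq0 k (p : 'I_N.+1) : (N < p + k)%N -> chain_sum k p = 0.
Proof.
elim: k p => [|k IHk] p h.
  by have := ltn_ord p; rewrite addn0 in h; rewrite ltnS leqNgt h.
rewrite chain_sumS big1// => x px; rewrite IHk ?mulr0//.
by apply: leq_trans h _; rewrite addnS -addSn leq_add2r.
Qed.

(** The sum over all chains solves the linear system obtained by splitting off
    the first step, and this system is triangular. *)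
Lemma chain_sum_unique (h : nat -> V) : h N = 1 ->
  (forall p : 'I_N.+1, (p < N)%N ->
     h p = \sum_(x : 'I_N.+1 | (p < x)%N) w p x * h x) ->
  forall p : 'I_N.+1, h p = \sum_(k < N.+1) chain_sum k p.
Proof.
move=> hN hrec.
have last_point (p : 'I_N.+1) :
  p = N :> nat -> h p = \sum_(k < N.+1) chain_sum k p.
  move=> pN; have -> : h p = 1 by rewrite pN.
  rewrite big_ord_recl chain_sum0 ifT; last exact/eqP.
  rewrite big1 ?addr0// => k _.
  by apply: chain_sum_eq0; rewrite pN /= /bump /=; lia.
suff main m (p : 'I_N.+1) : (N - p <= m)%N ->
  h p = \sum_(k < N.+1) chain_sum k p.
  by move=> p; exact: main (leqnn _).
elim: m p => [|m IHm] p pm.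
  by apply: last_point; have := ltn_ord p; lia.
have [/last_point//|pN] := eqVneq (p : nat) N.
have pltN : (p < N)%N by have := ltn_ord p; lia.
rewrite big_ord_recl chain_sum0 (negPf pN) add0r hrec//.
under [RHS]eq_bigr do rewrite chain_sumS.
rewrite exchange_big /=; apply: eq_bigr => x px; rewrite -big_distrr /=.
rewrite IHm; last lia.
by rewrite big_ord_recr /= chain_sum_eq0 ?addr0//; lia.
Qed.

End Compositions.

(** * The first-return recursion *)

Section FirstReturn.
Variables (R : realType) (B : cstarType R).
Implicit Types (F m : seq B -> B) (s t : seq B).

(** For m the moments of mu, this is the expectation of b1 X b2 X ... bk X. *)
Definition after_return m t : B := if t is b :: t' then b * m t' else 1.

Definition first_return F m := forall s,
  m s = \sum_(j < (size s).+1) F (take j s) * after_return m (drop j s).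

Definition composition_sum F s : B :=
  let n := (size s).+1 in
  \sum_(1 <= k < n.+1)
    \sum_(q : {ffun 'I_k.+1 -> 'I_n.+1} | composition q)
      \prod_(j < k)
        (let p := q (inord j) in let p' := q (inord j.+1) in
         F (block s p p') * nth 1 s p'.-1).

Lemma first_return_composition_sum F m : first_return F m ->
  forall s, m s = composition_sum F s.
Proof.
move=> hm s; set N := (size s).+1.
pose w p p' := F (block s p p') * nth 1 s p'.-1.
pose h p := if p == N then 1 else m (drop p s).
have hN : h N = 1 by rewrite /h eqxx.
have hrec (p : 'I_N.+1) : (p < N)%N ->
    h p = \sum_(x : 'I_N.+1 | (p < x)%N) w p x * h x.
  move=> pN; rewrite {1}/h ltn_eqF// hm size_drop.
  have ps : (p <= size s)%N by rewrite -ltnS.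
  rewrite -(big_mkord (fun x => (p < x)%N) (fun x => w p x * h x)).
  rewrite (big_cat_nat (n := p.+1))//= [X in _ = X + _]big_nat_cond [X in _ = X
    + _]big_pred0; last first.
    by move=> i; apply/negbTE; lia.
  rewrite add0r [RHS]big_nat_cond (eq_bigl (fun i => (p.+1 <= i < N.+1)%N));
    last by move=> i; lia.
  rewrite -big_nat -{1}[p.+1]add0n big_addn.
  rewrite (_ : (N.+1 - p.+1 = (size s - p).+1)%N); last by rewrite subSS subSn.
  rewrite big_mkord; apply: eq_bigr => j _; have jn := ltn_ord j.
  rewrite /w /block (_ : (j + p.+1 - p).-1 = j)%N; last lia.
  rewrite -mulrA; congr (_ * _); rewrite drop_drop.
  rewrite (_ : (j + p.+1).-1 = (j + p)%N); last lia.
  (* At the end of s the default value 1 of nth is the empty tail. *)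
  rewrite /h addnS; have [e|ne] := eqVneq (j + p)%N (size s).
    by rewrite /N e eqxx drop_size nth_default ?mulr1.
  have lt : (j + p < size s)%N by lia.
  by rewrite (drop_nth 1 lt) /= eqSS (negPf ne).
have -> : m s = h (@ord0 N) by rewrite /h /= drop0.
rewrite (chain_sum_unique hN hrec) /composition_sum -/N.
rewrite -(big_mkord xpredT (fun k => @chain_sum _ N w k (@ord0 N))) big_ltn//.
by rewrite chain_sum0 /= add0r.
Qed.

(** The recursion consumes at least one entry of s at each level, so n = size s
    levels are enough. *)
Fixpoint moments F n s : B :=
  \sum_(j < (size s).+1) F (take j s) *
    after_return (if n is n'.+1 then moments F n' else fun=> 0) (drop j s).

Lemma moments_fuel F n s : (size s <= n)%N ->
  moments F n s = moments F (size s) s.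
Proof.
elim/ltn_ind: n s => n IHn s sn; case: n IHn sn => [|n] IHn sn.
  by move: sn; rewrite leqn0 => /eqP ->.
case: s sn => [|b s] sn; first by rewrite /= !big_ord1.
apply: eq_bigr => j _; congr (_ * _).
case E : (drop j (b :: s)) => [|c t]; first by [].
have : (size t <= size s)%N by have := size_drop j (b :: s); rewrite E /=; lia.
move=> ts; suff Et : moments F n t = moments F (size s) t by exact: (congr1
  (fun x => c * x) Et).
rewrite (IHn n)//; last exact: leq_trans ts _.
have [lt|] := ltnP (size s) n.+1; first by rewrite -(IHn _ lt).
by move: sn => /=; lia.
Qed.

Lemma moments_first_return F : first_return F (fun s => moments F (size s) s).
Proof.
move=> s; case: s => [|b s] /=; first by rewrite !big_ord1.
apply: eq_bigr => j _; congr (_ * _).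
case E : (drop j (b :: s)) => [|c t]; first by [].
suff Et : moments F (size s) t = moments F (size t) t by exact: (congr1 (fun x
  => c * x) Et).
apply: moments_fuel.
by have := size_drop j (b :: s); rewrite E /=; lia.
Qed.

(** The recursion has a solution, which is given by the sum over compositions;
    so the sum over compositions satisfies the recursion. *)
Lemma composition_sum_first_return F m :
  (forall s, m s = composition_sum F s) -> first_return F m.
Proof.
move=> hm; rewrite (_ : m = fun s => moments F (size s) s).
  exact: moments_first_return.
apply/funext => s; rewrite hm; apply/esym.
exact: (first_return_composition_sum (@moments_first_return F)).
Qed.

(** The last term of the recursion for s is F s, which makes the recursion
    triangular in F as well. *)
Lemma first_return_last F m s : first_return F m ->
  F s = m s - \sum_(j < size s) F (take j s) * after_return m (drop j s).
Proof.
move=> ->; rewrite big_ord_recr /= take_size drop_size /= mulr1.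
by rewrite addrAC subrr add0r.
Qed.

Lemma first_return_inj F F' m : first_return F m -> first_return F' m ->
  F =1 F'.
Proof.
move=> hF hF' s; have [n] := ubnP (size s); elim: n s => // n IHn s sn.
rewrite (first_return_last s hF) (first_return_last s hF'); congr (_ - _).
apply: eq_bigr => j _; rewrite IHn// size_takel; last exact: ltnW.
by apply: leq_trans (ltn_ord j) _.
Qed.

Definition moment (mu : polyB B -> B) s : B := mu (mono (1, rcons s 1)).

Lemma Btransform_first_return mu F :
  Btransform mu F <-> is_series F /\ first_return F (moment mu).
Proof.
split=> -[sF h]; split=> //; last first.
  by move=> s; exact: (first_return_composition_sum h).
exact: composition_sum_first_return.
Qed.

Lemma mono_rcons (b c : B) s : mono (b, rcons s c) = constB b * mono (1,
  rcons s 1) * constB c.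
Proof.
rewrite !monoM -(wmul_rcons 1 s 1) -(wmul_rcons b s c) -!wmulA; congr mono.
by rewrite (wmulA (wcst b)) /wmul /= mulr1 mul1r.
Qed.

End FirstReturn.

(** * Operators on the polynomials *)

Section LinearMaps.
Variables (K : nzRingType) (U V : lmodType K) (f : U -> V).
Hypothesis lf : linear f.

Lemma linD u v : f (u + v) = f u + f v.
Proof. by have := lf 1 u v; rewrite !scale1r. Qed.

Lemma lin0 : f 0 = 0.
Proof. by apply: (addrI (f 0)); rewrite -linD !addr0. Qed.

Lemma linZ a u : f (a *: u) = a *: f u.
Proof. by have := lf a u 0; rewrite lin0 !addr0. Qed.

Lemma linB u v : f (u - v) = f u - f v.
Proof. by rewrite linD -scaleN1r linZ scaleN1r. Qed.

Lemma lin_sum I (r : seq I) P (E : I -> U) :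
  f (\sum_(i <- r | P i) E i) = \sum_(i <- r | P i) f (E i).
Proof. exact: (big_morph f linD lin0). Qed.

End LinearMaps.

Section Polynomials.
Variables (R : realType) (B : cstarType R).
Notation PB := (polyB B).
Implicit Types (P Q v : PB) (b c : B).

Lemma constB_linear : linear (@constB R B).
Proof. by move=> a b c; rewrite constBD constBZ. Qed.

Lemma constB0 : constB 0 = 0 :> PB. Proof. exact: (lin0 constB_linear). Qed.

Lemma constBN b : constB (- b) = - constB b :> PB.
Proof. by rewrite -scaleN1r constBZ scaleN1r. Qed.

Lemma polyE P : P = \sum_(w <- repr P) mono w.
Proof. by rewrite -Defs.piE reprK. Qed.

Lemma linear_mono_eq (V : lmodType R[i]) (f g : PB -> V) :
  linear f -> linear g ->
  (forall w, f (mono w) = g (mono w)) -> f =1 g.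
Proof.
move=> lf lg fg P; rewrite [P]polyE (lin_sum lf) (lin_sum lg).
by apply: eq_bigr => w _.
Qed.

Lemma wlift_linear (V : lmodType R[i]) (f : word B -> V) : balanced f ->
  (forall (a : R[i]) w, f (wscale a w) = a *: f w) -> linear (wlift f).
Proof. by move=> bf fZ a P Q; rewrite wliftD// wliftZ. Qed.

Lemma const_part_linear : linear (@const_part R B).
Proof.
apply: wlift_linear (wconst_balanced B) _ => c [b [|? ?]] //=.
by rewrite [LHS]/= scaler0.
Qed.

Lemma const_part_mono (w : word B) : const_part (mono w) = wconst w.
Proof. exact: wlift_mono (wconst_balanced B). Qed.

Lemma const_part_constB b : const_part (constB b) = b.
Proof. exact: const_part_mono. Qed.

Lemma const_partMl b P : const_part (constB b * P) = b * const_part P.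
Proof.
move: P; apply: linear_mono_eq.
- by move=> a P Q; rewrite mulrDr -scalerAr const_part_linear.
- by move=> a P Q; rewrite const_part_linear mulrDr -scalerAr.
- move=> [c [|d s]]; rewrite monoM !const_part_mono /wmul /wconst //=.
  by rewrite mulr0.
Qed.

Lemma const_partMr P c : const_part (P * constB c) = const_part P * c.
Proof.
move: P; apply: linear_mono_eq.
- by move=> a P Q; rewrite mulrDl -scalerAl const_part_linear.
- by move=> a P Q; rewrite const_part_linear mulrDl -scalerAl.
- move=> [b [|d s]]; rewrite monoM !const_part_mono /wmul /wconst //=.
  by rewrite mul0r.
Qed.

Lemma const_part_varX P : const_part (varX B * P) = 0.
Proof.
move: P; apply: linear_mono_eq.
- by move=> a P Q; rewrite mulrDr -scalerAr const_part_linear.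
- by move=> a P Q; rewrite scaler0 addr0.
- by move=> [b s]; rewrite monoM const_part_mono.
Qed.

(** * Words acting through an operator substituted for X *)

Fixpoint op_word (Op : PB -> PB) b (s : seq B) v : PB :=
  constB b * (if s is c :: s' then Op (op_word Op c s' v) else v).

Definition op_act Op P v : PB := wlift (fun w => op_word Op w.1 w.2 v) P.

Lemma word_act_op beta b s v : word_act beta b s v = op_word (op_X beta) b s v.
Proof. by elim: s b => //= c s IHs b; rewrite IHs. Qed.

Lemma op_word_varX b s v : op_word ( *%R (varX B)) b s v = mono (b, s) * v.
Proof.
elim: s b => [|c s IHs] b //=; by rewrite IHs [in RHS]monoE !mulrA.
Qed.

Section OpAct.
Variable Op : PB -> PB.
Hypothesis lOp : linear Op.

Lemma op_word_linear b s : linear (op_word Op b s).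
Proof.
elim: s b => [|c s IHs] b a u v /=; first by rewrite mulrDr -scalerAr.
by rewrite IHs lOp mulrDr -scalerAr.
Qed.

Lemma op_word_wmul u w v : op_word Op (wmul u w).1 (wmul u w).2 v =
  op_word Op u.1 u.2 (op_word Op w.1 w.2 v).
Proof.
case: u => b s; rewrite /wmul/=; elim: s b => [|c s IHs] b /=;
  last by rewrite IHs.
by case: w => d [|e w] /=; rewrite constBM -!mulrA.
Qed.

Lemma op_word_wscale a w v :
  op_word Op (wscale a w).1 (wscale a w).2 v = a *: op_word Op w.1 w.2 v.
Proof. by rewrite wscaleE op_word_wmul /= constBZ -scalerAl mul1r. Qed.

Lemma op_word_balanced v : balanced (fun w => op_word Op w.1 w.2 v).
Proof.
split=> [u w x y|u w a x]; rewrite ?op_word_wscale !op_word_wmul /=.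
  by rewrite constBD mulrDl (linD (@op_word_linear _ _)).
by rewrite constBZ -scalerAl (linZ (@op_word_linear _ _)).
Qed.

Lemma op_act_linear v : linear (fun P => op_act Op P v).
Proof.
apply: wlift_linear (op_word_balanced v) _ => a w; exact: op_word_wscale.
Qed.

Lemma op_act_mono w v : op_act Op (mono w) v = op_word Op w.1 w.2 v.
Proof. exact: wlift_mono (op_word_balanced v). Qed.

Lemma op_act_linear_r P : linear (op_act Op P).
Proof.
move=> a u v; rewrite /op_act /wlift scaler_sumr -big_split.
by apply: eq_bigr => w _; exact: op_word_linear.
Qed.

Lemma op_actM P Q v : op_act Op (P * Q) v = op_act Op P (op_act Op Q v).
Proof.
move: P; apply: linear_mono_eq => [a P P'|a P P'|w].
- by rewrite mulrDl -scalerAl op_act_linear.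
- exact: op_act_linear.
move: Q; apply: linear_mono_eq => [a Q Q'|a Q Q'|u].
- by rewrite mulrDr -scalerAr op_act_linear.
- by rewrite op_act_linear op_act_linear_r.
by rewrite monoM !op_act_mono op_word_wmul.
Qed.

Lemma op_act_constB b v : op_act Op (constB b) v = constB b * v.
Proof. exact: op_act_mono. Qed.

Hypothesis OpMr : forall v c, Op (v * constB c) = Op v * constB c.

Lemma op_wordMr b s v c : op_word Op b s (v * constB c) = op_word Op b s v *
  constB c.
Proof. by elim: s b => [|d s IHs] b /=; rewrite ?IHs ?OpMr mulrA. Qed.

Lemma op_actMr P v c : op_act Op P (v * constB c) = op_act Op P v * constB c.
Proof.
by rewrite /op_act /wlift big_distrl; apply: eq_bigr => w _; exact: op_wordMr.
Qed.

End OpAct.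

(** * First return to the constants *)

Definition op_iter (Op : PB -> PB) (s : seq B) : PB :=
  foldr (fun b v => constB b * Op v) 1 s.

Lemma op_word_rcons Op b s : op_word Op b (rcons s 1) 1 = constB b * Op
  (op_iter Op s).
Proof.
elim: s b => [|c s IHs] b /=; first by rewrite mul1r.
by rewrite IHs.
Qed.

Lemma op_iter_word Op b s : op_iter Op (b :: s) = op_word Op b s (Op 1).
Proof. by elim: s b => //= c s IHs b; rewrite -IHs. Qed.

Definition compression (phi : PB -> B) (Op : PB -> PB) v : PB :=
  Op v - constB (phi (Op v)).

Section Compression.
Variables (Op : PB -> PB) (phi : PB -> B).
Hypotheses (lOp : linear Op) (lphi : linear phi).
Hypothesis OpMr : forall v c, Op (v * constB c) = Op v * constB c.
Hypothesis phiMl : forall b v, phi (constB b * v) = b * phi v.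
Hypothesis phiMr : forall v c, phi (v * constB c) = phi v * c.
Hypothesis phi1 : phi 1 = 1.

Notation T := (compression phi Op).

Lemma phi_constB b : phi (constB b) = b.
Proof. by rewrite -[constB b]mulr1 phiMl phi1 mulr1. Qed.

Lemma compression_linear : linear T.
Proof.
move=> a u v; rewrite /compression lOp lphi constBD constBZ opprD addrACA.
by rewrite -scalerBr.
Qed.

Lemma phi_compression v : phi (T v) = 0.
Proof. by rewrite /compression (linB lphi) phi_constB subrr. Qed.

(** Each vector is decomposed according to its last visit to the constants:
    applying Op to v is applying the compression and adding a constant. *)
Lemma op_iter_compression s : op_iter Op s =
  \sum_(j < (size s).+1)
    op_iter T (take j s) * constB (phi (op_iter Op (drop j s))).
Proof.
elim: s => [|b s IHs]; first by rewrite big_ord1 /= phi1 mul1r.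
have E : Op (op_iter Op s) = \sum_(j < (size s).+1)
    (T (op_iter T (take j s)) * constB (phi (op_iter Op (drop j s))))
    + constB (phi (Op (op_iter Op s))).
  rewrite {2}IHs (lin_sum lOp) (lin_sum lphi) (lin_sum constB_linear)
    -big_split /=.
  rewrite {1}IHs (lin_sum lOp); apply: eq_bigr => j _.
  by rewrite OpMr phiMr constBM -mulrDl subrK.
rewrite big_ord_recl /= mul1r phiMl {1}E mulrDr addrC -constBM; congr (_ + _).
by rewrite big_distrr; apply: eq_bigr => j _; rewrite /= mulrA.
Qed.

Lemma compression_first_return : first_return
  (fun s => phi (Op (op_iter T s))) (fun s => phi (Op (op_iter Op s))).
Proof.
move=> s; rewrite {1}op_iter_compression (lin_sum lOp) (lin_sum lphi).
apply: eq_bigr => j _; rewrite OpMr phiMr; congr (_ * _).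
by case: (drop j s) => [|b t]; rewrite /= ?phiMl.
Qed.

End Compression.

End Polynomials.

(** * The distribution of the Fock space operator *)

(** Polarization with 1 + x and 1 + i x. *)
Lemma hermitian_of_squares (R : realType) (A : algType R[i]) (B : cstarType R)
    (st : A -> A) (f : A -> B) :
    (forall x y, st (x + y) = st x + st y) ->
    (forall (c : R[i]) x, st (c *: x) = c^*%C *: st x) -> st 1 = 1 ->
    linear f -> (forall x, star (f (st x * x)) = f (st x * x)) ->
  forall x, f (st x) = star (f x).
Proof.
move=> stD stZ st1 lf sf P.
have h1 : star (f P) + star (f (st P)) = f P + f (st P).
  have := sf (1 + P); rewrite stD st1 mulrDl !mulrDr mul1r !mulr1 mul1r.
  rewrite !(linD lf) !starD sf.
  have := sf 1; rewrite st1 mulr1 => ->.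
  by rewrite -!addrA => /addrI; rewrite !addrA => /addIr.
have h2 : star (f P) - star (f (st P)) = f (st P) - f P.
  have := sf (1 + 'i%C *: P).
  have ic : ('i%C : R[i])^*%C = - 'i%C by apply/eqP;
    rewrite eq_complex /= oppr0 !eqxx.
  rewrite stD stZ ic st1 mulrDl !mulrDr mul1r !mulr1 mul1r.
  rewrite -scalerAl -scalerAr scalerA mulNr -expr2 sqr_i opprK scale1r.
  rewrite !(linD lf) !starD sf.
  have := sf 1; rewrite st1 mulr1 => ->.
  rewrite -!addrA => /addrI; rewrite !addrA => /addIr.
  rewrite !(linZ lf) !scaleNr starN !star_i opprK addrC -!scalerBr.
  move=> /(congr1 (fun x => - 'i%C *: x));
    rewrite !scalerA mulNr -expr2 sqr_i opprK !scale1r.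
  by move=> /(congr1 -%R); rewrite !opprB.
have : star (f P) + star (f P) = f (st P) + f (st P).
  have := congr2 +%R h1 h2; rewrite addrACA subrr addr0 => ->.
  by rewrite addrC addrA subrK.
by move=> /(congr1 (fun x => 2^-1 *r x)); rewrite !realr_half.
Qed.

Section Transform.
Variables (R : realType) (B : cstarType R).
Notation PB := (polyB B).
Implicit Types (P Q : PB) (b c : B) (w : word B) (beta mu nu : PB -> B).

Lemma additive_mono_eq (V : zmodType) (f g : PB -> V) :
  {morph f : P Q / P + Q} -> {morph g : P Q / P + Q} ->
  (forall w, f (mono w) = g (mono w)) -> f =1 g.
Proof.
move=> fD gD fg P.
have add0 (h : PB -> V) : {morph h : P Q / P + Q} -> h 0 = 0.
  by move=> hD; apply: (addrI (h 0)); rewrite -hD !addr0.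
rewrite [P]polyE (big_morph f fD (add0 f fD)) (big_morph g gD (add0 g gD)).
by apply: eq_bigr => w _.
Qed.

Lemma mono_slot b s x t : mono (b, s ++ x :: t) = mono (b,
  rcons s 1) * constB x * mono (1, t).
Proof.
rewrite !monoM -wmulA (_ : wmul (wcst x) (1, t) = (x, t));
  last by rewrite /wmul /= mulr1.
congr mono; rewrite /wmul /=.
elim: s b => [|c s IHs] b /=; first by rewrite mul1r.
by rewrite -IHs.
Qed.

Lemma linear_is_series beta : linear beta -> is_series (Phi_series beta).
Proof.
move=> lb [|b s] t a x y /=.
  rewrite -lb; congr beta; apply/esym.
  have E z : mono (z, t) = constB z * mono (1,
    t) by rewrite monoM /wmul /= mulr1.
  by rewrite (E x) (E y) (E (_ + _)) scalerAl -mulrDl constBD constBZ.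
by rewrite -lb !mono_slot constBD constBZ mulrDr mulrDl -scalerAr -scalerAl.
Qed.

Lemma Sigma_alg_mono_rcons mu b s c : Sigma_alg mu ->
  mu (mono (b, rcons s c)) = b * moment mu s * c.
Proof. by move=> [_ bimod _]; rewrite mono_rcons bimod. Qed.

Lemma moment_inj mu nu : Sigma_alg mu -> Sigma_alg nu ->
  moment mu =1 moment nu -> mu = nu.
Proof.
move=> smu snu mn; have [lmu _ mu1] := smu; have [lnu _ nu1] := snu.
apply/funext; apply: linear_mono_eq => // -[b s].
case/lastP: s => [|s c]; first by rewrite -[mono _]/(constB b) mu1 nu1.
by rewrite !Sigma_alg_mono_rcons// mn.
Qed.

Lemma Phi_eq beta mu : Sigma_alg mu -> linear beta ->
  first_return (Phi_series beta) (moment mu) -> Phi beta = mu.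
Proof.
move=> smu lb fr.
have hmu : Sigma_alg mu /\ Btransform mu (Phi_series beta).
  by split=> //; apply/Btransform_first_return; split=> //;
    exact: linear_is_series.
have [snu /Btransform_first_return[_ frnu]] := xgetPex (fun=> 0)
  (ex_intro [set nu | Sigma_alg nu /\ Btransform nu (Phi_series beta)] mu hmu).
apply: moment_inj => // s.
by rewrite (first_return_composition_sum fr) (first_return_composition_sum
  frnu).
Qed.

Section Fock.
Variable beta : PB -> B.
Hypothesis lb : linear beta.

Definition annihilate P : B := wlift (word_annihilate beta) P.

Lemma annihilate_linear : linear annihilate.
Proof.
apply: wlift_linear; first exact: word_annihilate_balanced.
by move=> a w; exact: word_annihilateZ.
Qed.

Lemma annihilate_mono w : annihilate (mono w) = word_annihilate beta w.
Proof. exact: wlift_mono (word_annihilate_balanced lb). Qed.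

Lemma annihilateMr P c : annihilate (P * constB c) = annihilate P * c.
Proof.
move: P; apply: linear_mono_eq => [a P Q|a P Q|w].
- by rewrite mulrDl -scalerAl annihilate_linear.
- by rewrite annihilate_linear mulrDl -scalerAl.
rewrite monoM !annihilate_mono.
have [[b ->]|[p [z ->]]] := word_split w; first by rewrite mul0r.
rewrite -wmulA (_ : wmul (1, [:: z]) (wcst c) = (1, [:: z * c])) //.
by rewrite !word_annihilateE mulrA.
Qed.

(** Creation and preservation add up to multiplication by X, on the constants
    and on their complement respectively. *)
Lemma op_XE P : op_X beta P = varX B * P + constB (annihilate P).
Proof.
rewrite /op_X /op_create /op_preserve -/(annihilate P) mulrBr.
by rewrite addrC addrA subrK.
Qed.

Lemma op_X_linear : linear (op_X beta).
Proof. by move=> a P Q; rewrite op_XD// op_XZ. Qed.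

Lemma op_XMr P c : op_X beta (P * constB c) = op_X beta P * constB c.
Proof. by rewrite !op_XE annihilateMr constBM mulrDl mulrA. Qed.

Lemma const_part_op_X P : const_part (op_X beta P) = annihilate P.
Proof.
by rewrite op_XE (linD (@const_part_linear _ _)) const_part_varX add0r
  const_part_constB.
Qed.

Lemma inner_1r P : inner beta P 1 = const_part P.
Proof.
rewrite /inner const_part_constB star1 mul1r /inner0 wlift_mono;
  last exact: inner0_balanced.
rewrite /wlift big1 ?addr0// => -[b [|c s]] _ //.
Qed.

Lemma mu_0E P : mu_0 beta P = const_part (op_act (op_X beta) P 1).
Proof.
rewrite /mu_0 /op_act /wlift (lin_sum (@const_part_linear _ _)).
by apply: eq_bigr => -[b s] _; rewrite inner_1r word_act_op.
Qed.

Lemma mu_0_Sigma_alg : Sigma_alg (mu_0 beta).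
Proof.
split.
- by move=> a P Q; rewrite !mu_0E (op_act_linear op_X_linear) const_part_linear.
- move=> b P c; rewrite !mu_0E !(op_actM op_X_linear) !(op_act_constB
  op_X_linear).
  rewrite mulr1 const_partMl -{1}[constB c]mul1r (op_actMr op_XMr).
  by rewrite const_partMr mulrA.
- by move=> b; rewrite mu_0E (op_act_constB op_X_linear) mulr1
  const_part_constB.
Qed.

(** The compression of the operator to the complement of the constants is
    multiplication by X. *)
Lemma mu_0_first_return : first_return (Phi_series beta) (moment (mu_0 beta)).
Proof.
have -> : moment (mu_0 beta) = fun s => const_part (op_X beta (op_iter (op_X
  beta) s)).
  apply/funext => s; rewrite /moment mu_0E (op_act_mono op_X_linear) /=.
  by rewrite op_word_rcons mul1r.
have -> : Phi_series beta = fun s => const_part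
    (op_X beta (op_iter (compression (@const_part R B) (op_X beta)) s)).
  have compE : compression (@const_part R B) (op_X beta) = *%R (varX B).
    by apply/funext => v; rewrite /compression const_part_op_X op_XE addrK.
  apply/funext => -[|b s]; rewrite const_part_op_X compE.
    by rewrite /= -[1]/(mono (wcst 1)) annihilate_mono.
  rewrite op_iter_word op_word_varX mulr1 monoM annihilate_mono.
  by rewrite word_annihilateE mulr1.
apply: compression_first_return.
- exact: op_X_linear.
- exact: const_part_linear.
- exact: op_XMr.
- exact: const_partMl.
- exact: const_partMr.
- exact: const_part_constB.
Qed.

Lemma Phi_mu_0 : Phi beta = mu_0 beta.
Proof.
by apply: Phi_eq => //; [exact: mu_0_Sigma_alg | exact: mu_0_first_return].
Qed.

End Fock.

(** * Positivity of the Fock space distribution *)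

Lemma starPM P Q : starP (P * Q) = starP Q * starP P.
Proof.
move: P; apply: additive_mono_eq => [P P'|P P'|w].
- by rewrite mulrDl starPD.
- by rewrite starPD mulrDr.
move: Q; apply: additive_mono_eq => [P P'|P P'|w'].
- by rewrite mulrDr starPD.
- by rewrite starPD mulrDl.
by rewrite !starP_mono !monoM starP_mono wstarM.
Qed.

Lemma starP_constB b : starP (constB b) = constB (star b).
Proof. by rewrite starP_mono. Qed.

Lemma starP_varX : starP (varX B) = varX B.
Proof. by rewrite starP_mono /wstar /= star1. Qed.

Lemma starP1 : starP (1 : PB) = 1.
Proof. by rewrite starP_constB star1. Qed.

Lemma starPK P : starP (starP P) = P.
Proof.
move: P; apply: additive_mono_eq => [P P'|P P'|[b s]] //.
  by rewrite !starPD.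
elim: s b => [|c s IHs] b; first by rewrite !starP_constB starK.
by rewrite monoE !starPM !starP_constB !starP_varX IHs starK.
Qed.

Lemma cp_hermitian beta : linear beta -> cp beta ->
  forall P, beta (starP P) = star (beta P).
Proof.
move=> lb cpb; apply: (hermitian_of_squares (@starPD R B) (@starPZ R B) starP1
  lb) => P.
have := cpb 1%N (fun=> P) (fun=> 1).
by rewrite !big_ord1 star1 mul1r mulr1 => /cpos_sa.
Qed.

Lemma Sigma_hermitian mu : Sigma mu -> forall P, mu (starP P) = star (mu P).
Proof.
by move=> [[lmu _ _] pos];
  apply: (hermitian_of_squares (@starPD R B) (@starPZ R B) starP1 lmu) => P;
  exact: cpos_sa.
Qed.

(** The subspace D is there because a compression is symmetric only on the
    kernel of the map it comes from. *)
Lemma op_act_adjoint (Op : PB -> PB) (form : PB -> PB -> B) (D : PB -> Prop) :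
    linear Op ->
    (forall v, {morph form^~ v : u u' / u + u'}) ->
    (forall u, {morph form u : v v' / v + v'}) ->
    (forall b u, D u -> D (constB b * u)) -> (forall u, D u -> D (Op u)) ->
    (forall b u v, D u -> D v ->
       form (constB b * u) v = form u (constB (star b) * v)) ->
    (forall u v, D u -> D v -> form (Op u) v = form u (Op v)) ->
  forall P u v, D u -> D v ->
    form (op_act Op P u) v = form u (op_act Op (starP P) v).
Proof.
move=> lOp formDl formDr Db DOp formb formOp P u v Du.
move: P v; suff main w v : D v -> form (op_act Op (mono w) u) v =
    form u (op_act Op (starP (mono w)) v).
  move=> P v Dv; move: P; apply: additive_mono_eq => [P Q|P Q|w];
    last exact: main.
    by rewrite (linD (op_act_linear lOp u)) formDl.
  by rewrite starPD (linD (op_act_linear lOp v)) formDr.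
case: w => b s; have Dw c t : D (op_word Op c t u).
  by elim: t c => [|d t IHt] c /=; apply: Db => //; exact: DOp.
rewrite op_act_mono//=; elim: s b v => [|c s IHs] b v Dv /=.
  by rewrite starP_constB op_act_constB// formb.
rewrite formb//; last exact: DOp.
rewrite formOp//; last exact: Db.
rewrite IHs; last exact/DOp/Db.
rewrite monoE !starPM starP_constB starP_varX !op_actM// op_act_constB//.
by rewrite [op_act Op (varX B) _]op_act_mono//= !mul1r.
Qed.

Section FockPositive.
Variable beta : PB -> B.
Hypotheses (lb : linear beta) (cpb : cp beta).

Lemma word_inner_const_l b w : word_inner beta (wcst b) w = 0.
Proof. by []. Qed.

Lemma word_inner_const_r b w : word_inner beta w (wcst b) = 0.
Proof. by case: w => ? []. Qed.

Lemma wlast p z : exists c t,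
  [/\ wmul p (1, [:: z]) = (p.1, c :: t), belast c t = p.2 & last c t = z :> B].
Proof.
case: p => b s; case: s => [|d s]; rewrite wmul_rcons.
  by exists z, [::].
exists d, (rcons s z); split => //=; last by rewrite last_rcons.
by elim: s d => //= e s IHs d; rewrite IHs.
Qed.

Lemma word_inner_X p z q y : word_inner beta (wmul p (1, [:: z])) (wmul q (1,
  [:: y])) =
  star y * beta (starP (mono q) * mono p) * z.
Proof.
have [c [t [-> bt <-]]] := wlast p z; have [d [r [-> br <-]]] := wlast q y.
by rewrite /= bt br -!surjective_pairing.
Qed.

Lemma innerDr P : {morph inner beta P : Q Q' / Q + Q'}.
Proof.
move=> Q Q'; rewrite /inner (linD (@const_part_linear _ _)) starD mulrDl
  addrACA.
by congr (_ + _); apply: wliftD; exact: inner0_balanced.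
Qed.

Lemma inner_mono w v : inner beta (mono w) (mono v) =
  star (wconst v) * wconst w + word_inner beta w v.
Proof. by rewrite /inner !const_part_mono inner0_mono. Qed.

Lemma biadditive_mono_eq (f g : PB -> PB -> B) :
  (forall Q, {morph f^~ Q : P P' / P + P'}) ->
    (forall P, {morph f P : Q Q' / Q + Q'}) ->
  (forall Q, {morph g^~ Q : P P' / P + P'}) ->
    (forall P, {morph g P : Q Q' / Q + Q'}) ->
  (forall w v, f (mono w) (mono v) = g (mono w) (mono v)) ->
    forall P Q, f P Q = g P Q.
Proof.
move=> fl fr gl gr fg P Q; move: P.
apply: (additive_mono_eq (fl Q) (gl Q)) => w; move: Q.
exact: (additive_mono_eq (fr _) (gr _)).
Qed.

Lemma inner_constBl b P Q : inner beta (constB b * P) Q = inner beta P (constB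
  (star b) * Q).
Proof.
move: P Q; apply: biadditive_mono_eq.
- by move=> Q P P'; rewrite mulrDr innerDl.
- by move=> P Q Q'; rewrite innerDr.
- by move=> Q P P'; rewrite innerDl.
- by move=> P Q Q'; rewrite mulrDr innerDr.
move=> w v; rewrite !monoM !inner_mono; congr (_ + _).
  by case: w v => [c [|? ?]] [d [|? ?]];
    rewrite /wconst /wmul /= ?mulr0 ?star0 ?mul0r// starM starK mulrA.
have [[c ->]|[p [z ->]]] := word_split w; first by [].
have [[d ->]|[q [y ->]]] := word_split v; first by rewrite !word_inner_const_r.
rewrite !wmulA !word_inner_X -!monoM starPM starP_constB starK -[mono (wcst
  b)]/(constB b).
by rewrite mulrA.
Qed.

(** Creation and annihilation are adjoint to each other, and preservation is
    symmetric; beta is hermitian because it is completely positive. *)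
Lemma inner_op_X P Q : inner beta (op_X beta P) Q = inner beta P (op_X beta Q).
Proof.
have lX := op_X_linear lb.
move: P Q; apply: biadditive_mono_eq.
- by move=> Q P P'; rewrite (linD lX) innerDl.
- by move=> P Q Q'; rewrite innerDr.
- by move=> Q P P'; rewrite innerDl.
- by move=> P Q Q'; rewrite (linD lX) innerDr.
have E w : op_X beta (mono w) = mono (wmul (1,
  [:: 1]) w) + constB (word_annihilate beta w).
  by rewrite op_XE// monoM annihilate_mono.
have X1 b : wmul (1, [:: 1]) (wcst b) = wmul (wcst 1) (1, [:: b]) :> word B.
  by rewrite /wmul /= !mul1r.
have Xc w : wconst (wmul (1, [:: 1]) w) = 0 :> B by [].
have inner_mc w c : inner beta (mono w) (constB c) = star c * wconst w.
  by rewrite inner_mono word_inner_const_r addr0.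
have inner_cm w c : inner beta (constB c) (mono w) = star (wconst w) * c.
  by rewrite inner_mono addr0.
have wX q z : wconst (wmul q (1, [:: z])) = 0 :> B.
  by case: q => ? [|? ?]; rewrite wmul_rcons.
move=> w v; rewrite !E innerDl// innerDr inner_mc inner_cm !inner_mono.
rewrite !Xc star0 mul0r mulr0 !add0r.
have [[b ->]|[p [z ->]]] := word_split w;
  have [[c ->]|[q [y ->]]] := word_split v;
    rewrite ?X1 ?word_inner_const_r ?word_inner_const_l.
- by rewrite /= mulr0 star0 mul0r.
- rewrite word_inner_X word_annihilateE wX star0 mul0r addr0 add0r starM.
  by rewrite -[mono (wcst 1)]/(1 : PB) mulr1 cp_hermitian.
- rewrite word_inner_X word_annihilateE wX mulr0 addr0 add0r.
  by rewrite -[mono (wcst 1)]/(1 : PB) starP1 mul1r mulrA.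
- by rewrite !wmulA !word_inner_X !wX -!monoM starPM starP_varX mulrA star0
  mul0r mulr0.
Qed.

Lemma inner_mu_0 P Q : mu_0 beta (starP Q * P) =
  inner beta (op_act (op_X beta) P 1) (op_act (op_X beta) Q 1).
Proof.
have lX := op_X_linear lb.
rewrite mu_0E// op_actM// -(inner_1r lb).
rewrite (op_act_adjoint (D := fun=> True) (form := inner beta) lX)//.
- by rewrite starPK.
- by move=> R0 P1 P2; rewrite innerDl.
- exact: innerDr.
- by move=> *; exact: inner_constBl.
- by move=> *; exact: inner_op_X.
Qed.

(** A word b0 X ... X bn contributes (b0 X ... X b(n-1)) bn to the sum that is
    nonnegative by complete positivity; the constant term adds a square. *)
Lemma inner_pos P : cpos (inner beta P P).
Proof.
rewrite /inner; apply: cposD; first exact: cpos_starM.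
pose p w : PB := if w is (b, c :: s) then mono (b, belast c s) else 0.
pose z w : B := if w is (b, c :: s) then last c s else 0.
have E w v : word_inner beta w v = star (z v) * beta (starP (p v) * p w) * z w.
  by case: w v => [b [|c s]] [d [|e t]]; rewrite /= ?mulr0 ?star0 ?mul0r.
rewrite /inner0 /wlift (big_tnth _ _ (repr P)).
have := cpb (fun i => p (tnth (in_tuple (repr P)) i)) (fun i => z (tnth
  (in_tuple (repr P)) i)).
congr cpos; apply: eq_bigr => i _; rewrite (big_tnth _ _ (repr P)).
by apply: eq_bigr => j _; rewrite E.
Qed.

Lemma mu_0_pos P : cpos (mu_0 beta (starP P * P)).
Proof. by rewrite inner_mu_0; exact: inner_pos. Qed.

End FockPositive.

(** * The inverse of Phi *)

Section Compressed.
Variable mu : PB -> B.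
Hypotheses (smu : Sigma mu) (mu0 : forall P, BXB P -> mu P = 0).

Let lmu : linear mu. Proof. by have [[]] := smu. Qed.

Lemma mu_constB b : mu (constB b) = b.
Proof. by have [[]] := smu. Qed.

Lemma mu_constBl b P : mu (constB b * P) = b * mu P.
Proof. by have [[_ /(_ b P 1)]] := smu; rewrite !mulr1. Qed.

Lemma mu_constBr P c : mu (P * constB c) = mu P * c.
Proof. by have [[_ /(_ 1 P c)]] := smu; rewrite !mul1r. Qed.

Lemma mu_varX : mu (varX B) = 0.
Proof. by apply: mu0; exists [:: (1, 1)]; rewrite big_seq1. Qed.

Definition shifted_op : PB -> PB := compression mu ( *%R (varX B)).

Lemma mulX_linear : linear ( *%R (varX B)).
Proof. by move=> a P Q; rewrite mulrDr -scalerAr. Qed.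

Lemma shifted_op_linear : linear shifted_op.
Proof. by apply: compression_linear => //; exact: mulX_linear. Qed.

(** The value at X of P applied to the compression of multiplication by X to
    the kernel of mu, paired with X.  As mu vanishes on BXB, the vector X lies
    in this kernel. *)
Definition Phi_inv P : B := mu (varX B * op_act shifted_op P (varX B)).

Lemma Phi_inv_linear : linear Phi_inv.
Proof.
move=> a P Q; rewrite /Phi_inv (op_act_linear shifted_op_linear).
by rewrite mulX_linear lmu.
Qed.

(** The correction in the compression is a constant, hence orthogonal to the
    kernel of mu, where the symmetry of multiplication by X is therefore kept.
      *)
Lemma Phi_inv_starM P Q : Phi_inv (starP P * Q) =
  mu (starP (op_act shifted_op P (varX B)) * op_act shifted_op Q (varX B)).
Proof.
rewrite /Phi_inv op_actM//; last exact: shifted_op_linear.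
set u := op_act shifted_op Q (varX B).
have hmu := Sigma_hermitian smu.
have Db b v : mu v = 0 -> mu (constB b * v) = 0 by rewrite mu_constBl => ->;
  rewrite mulr0.
have DT v : mu (shifted_op v) = 0.
  by apply: phi_compression => //; [exact: mu_constBl | exact: mu_constB].
have Du : mu u = 0.
  rewrite /u [Q]polyE (lin_sum (op_act_linear shifted_op_linear _)) (lin_sum
    lmu).
  rewrite big1// => -[b s] _; rewrite (op_act_mono shifted_op_linear) /=.
  elim: s b => [|c s IHs] b /=; apply: Db => //; exact: mu_varX.
have := @op_act_adjoint shifted_op (fun u v => mu (starP v * u)) (fun u => mu u
  = 0)
  shifted_op_linear.
move=> /(_ _ _ _ _ _ _ (starP P) u (varX B) Du mu_varX).
rewrite starPK starP_varX; apply => //.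
- by move=> v w w'; rewrite mulrDr (linD lmu).
- by move=> v w w'; rewrite starPD mulrDl (linD lmu).
- by move=> b v w _ _; rewrite starPM starP_constB starK mulrA.
- move=> v w v0 w0; rewrite /shifted_op /compression.
  rewrite mulrBr (linB lmu) mu_constBr hmu w0 star0 mul0r subr0.
  rewrite starPD starPM starP_varX mulrDl mulrA (linD lmu).
  by rewrite -constBN starP_constB mu_constBl v0 mulr0 addr0.
Qed.

Lemma Phi_inv_cp : cp Phi_inv.
Proof.
move=> n P b; pose xi := \sum_(i < n) op_act shifted_op (P i) (varX B) * constB
  (b i).
have [_ /(_ xi)] := smu; congr cpos.
have starP_sum I (r : seq I) (E : I -> PB) :
  starP (\sum_(i <- r) E i) = \sum_(i <- r) starP (E i).
  by apply: (big_morph (@starP R B) (@starPD R B));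
    rewrite -(mul0r 0) starPM -constB0 starP_constB star0 constB0 mulr0.
rewrite {1}/xi starP_sum mulr_suml (lin_sum lmu); apply: eq_bigr => i _.
rewrite /xi mulr_sumr (lin_sum lmu); apply: eq_bigr => j _.
by rewrite starPM starP_constB [_ * (_ * _)]mulrA mu_constBr -[_ * _ * _]mulrA
  mu_constBl Phi_inv_starM.
Qed.

Lemma Phi_Phi_inv : Phi Phi_inv = mu.
Proof.
have [sa _] := smu; apply: Phi_eq => //; first exact: Phi_inv_linear.
have -> : moment mu = fun s => mu (varX B * op_iter ( *%R (varX B)) s).
  apply/funext => s; have := @op_word_rcons _ _ ( *%R (varX B)) 1 s.
  by rewrite op_word_varX mulr1 mul1r /moment => ->.
have -> : Phi_series Phi_inv = fun s => mu (varX B * op_iter shifted_op s).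
  apply/funext => -[|b s] /=; first by rewrite mulr1 mu_varX.
  rewrite -[constB b * _]/(op_iter shifted_op (b :: s)) op_iter_word /Phi_inv.
  rewrite op_act_mono//=; last exact: shifted_op_linear.
  suff -> : shifted_op 1 = varX B by [].
  by rewrite /shifted_op /compression mulr1 mu_varX constB0 subr0.
apply: compression_first_return => //.
- exact: mulX_linear.
- by move=> v c; rewrite mulrA.
- exact: mu_constBl.
- exact: mu_constBr.
- exact: mu_constB.
Qed.

End Compressed.

End Transform.

(** * Growth of moments and of first-return weights *)

Section Bounds.
Variables (R : realType) (B : cstarType R).
Implicit Types (F m : seq B -> B) (s : seq B) (K : R).

Let np := @cnorm_algebra_norm R B.

Definition cprod s : R := \prod_(c <- s) cnorm c.

Definition exp_bounded K F := forall s,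
  cnorm (F s) <= K ^+ (size s).+1 * cprod s.

Lemma cprod_ge0 s : 0 <= cprod s.
Proof. by apply: prodr_ge0 => c _; exact: (an_ge0 np). Qed.

Lemma cnorm_sum n (E : 'I_n -> B) : cnorm (\sum_i E i) <= \sum_i cnorm (E i).
Proof.
elim/big_rec2: _ => [|i y x _ h]; first by rewrite (an0 np).
by apply: le_trans (cnormD _ _) _; rewrite lerD2l.
Qed.

(** When one of the constants is twice the other one, the bounds on the terms of
    the recursion are in geometric progression. *)
Lemma geometric_sum k : 1 + \sum_(j < k) 2 ^+ j.+1 <= 2 ^+ k.+1 :> R.
Proof.
suff -> : \sum_(j < k) 2 ^+ j.+1 = 2 ^+ k.+1 - 2 :> R by lra.
elim: k => [|k IHk]; first by rewrite big_ord0 expr1 subrr.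
by rewrite big_ord_recr /= IHk [in RHS]exprS; field.
Qed.

(** The exponents of K1 and K2 add up to the exponent size s + 1 that is wanted,
    and the norms of the entries of s are distributed over the two factors. *)
Lemma first_return_term F m s (j : 'I_(size s)) K1 K2 : 0 <= K1 -> 0 <= K2 ->
  cnorm (F (take j s)) <= K1 ^+ j.+1 * cprod (take j s) ->
  (forall t, (size t < size s)%N ->
    cnorm (m t) <= K2 ^+ (size t).+1 * cprod t) ->
  cnorm (F (take j s) * after_return m (drop j s)) <=
    K1 ^+ j.+1 * K2 ^+ (size s - j) * cprod s.
Proof.
move=> K10 K20 hF hm; have js := ltn_ord j.
have E := cat_take_drop j s; rewrite (drop_nth 1 js) in E *.
set t := drop j.+1 s in E *; set b := nth 1 s j in E *.
have -> : cprod s = cprod (take j s) * (cnorm b * cprod t).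
  by rewrite -{1}E /cprod big_cat big_cons.
have st : (size s - j = (size t).+1)%N by rewrite size_drop; lia.
have ht := hm t ltac:(rewrite size_drop; lia); rewrite st /=.
apply: le_trans (cnormM _ _) _.
have -> : K1 ^+ j.+1 * K2 ^+ (size t).+1 * (cprod (take j s) * (cnorm b * cprod
  t)) =
  K1 ^+ j.+1 * cprod (take j s) * (cnorm b * (K2 ^+ (size t).+1 * cprod t)).
  by ring.
apply: ler_pM => //; try exact: (an_ge0 np).
by apply: le_trans (cnormM _ _) _; rewrite ler_wpM2l ?(an_ge0 np).
Qed.

Lemma first_return_bound_series F m K : 0 <= K -> first_return F m ->
  exp_bounded K m -> exp_bounded (2 * K) F.
Proof.
move=> K0 fr bm s; have [n] := ubnP (size s); elim: n s => // n IHn s sn.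
rewrite (first_return_last s fr); apply: le_trans (anB np _ _) _.
apply: le_trans (lerD (bm s) (cnorm_sum _)) _.
have K20 : 0 <= 2 * K by rewrite mulr_ge0.
apply: le_trans (_ : (K ^+ (size s).+1 * cprod s) *
    (1 + \sum_(j < size s) 2 ^+ j.+1) <= _).
  rewrite mulrDr mulr1 lerD2l big_distrr; apply: ler_sum => j _.
  have js := ltn_ord j.
  have hF : cnorm (F (take j s)) <= (2 * K) ^+ j.+1 * cprod (take j s).
    have := IHn (take j s); rewrite (size_takel (ltnW js)); apply;
      exact: leq_trans js _.
  apply: le_trans (first_return_term K20 K0 hF (fun t _ => bm t)) _.
  rewrite le_eqVlt; apply/orP; left; apply/eqP; rewrite exprMn.
  have -> : K ^+ (size s).+1 = K ^+ j.+1 * K ^+ (size s - j) by rewrite -exprD;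
    congr (_ ^+ _); lia.
  by rewrite /=; move: (2 ^+ j.+1) (K ^+ j.+1) (K ^+ _) (cprod s) => *; ring.
rewrite exprMn mulrC -mulrA ler_wpM2r ?geometric_sum//.
by rewrite mulr_ge0 ?exprn_ge0 ?cprod_ge0.
Qed.

Lemma first_return_bound_moment F m K : 0 <= K -> first_return F m ->
  exp_bounded K F -> exp_bounded (2 * K) m.
Proof.
move=> K0 fr bF s; have [n] := ubnP (size s); elim: n s => // n IHn s sn.
rewrite fr big_ord_recr /= take_size drop_size /= mulr1.
apply: le_trans (cnormD _ _) _; rewrite addrC.
apply: le_trans (lerD (bF s) (cnorm_sum _)) _.
have K20 : 0 <= 2 * K by rewrite mulr_ge0.
apply: le_trans (_ : (K ^+ (size s).+1 * cprod s) *
    (1 + \sum_(j < size s) 2 ^+ j.+1) <= _).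
  rewrite mulrDr mulr1 lerD2l big_distrr (reindex_inj rev_ord_inj).
  apply: ler_sum => j _; have js := ltn_ord j.
  have hm t : (size t < size s)%N ->
    cnorm (m t) <= (2 * K) ^+ (size t).+1 * cprod t.
    by move=> ts; apply: IHn; lia.
  apply: le_trans (first_return_term K0 K20 (_ : _ <= K ^+ (rev_ord j).+1 * _)
    hm) _.
    by have := bF (take (rev_ord j) s); rewrite size_takel//;
      exact/ltnW/ltn_ord.
  rewrite le_eqVlt; apply/orP; left; apply/eqP.
  have -> : (size s - rev_ord j = j.+1)%N by rewrite /=; lia.
  have -> : K ^+ (size s).+1 = K ^+ (rev_ord j).+1 * K ^+ j.+1.
    by rewrite -exprD; congr (_ ^+ _); rewrite /=; lia.
  rewrite exprMn.
  by rewrite /=; move: (2 ^+ j.+1) (K ^+ j.+1) (K ^+ _) (cprod s) => *; ring.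
rewrite exprMn mulrC -mulrA ler_wpM2r ?geometric_sum//.
by rewrite mulr_ge0 ?exprn_ge0 ?cprod_ge0.
Qed.

Lemma cp_bounded_series (beta : polyB B -> B) :
  cp_bounded beta <-> exists2 K, 0 < K & exp_bounded K (Phi_series beta).
Proof.
split=> -[K K0 bK]; exists K => //.
  move=> [|b s]; last by rewrite /= /cprod big_cons; exact: bK.
  by rewrite /= (an0 np) /cprod big_nil mulr1 expr1 ltW.
by move=> b s; have := bK (b :: s); rewrite /= /cprod big_cons.
Qed.

Lemma cp_bounded_moment (beta mu : polyB B -> B) :
  first_return (Phi_series beta) (moment mu) ->
  cp_bounded beta <-> exists2 K, 0 < K & exp_bounded K (moment mu).
Proof.
move=> fr; rewrite cp_bounded_series; split=> -[K K0 bK]; exists (2 * K);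
  rewrite ?mulr_gt0//.
  exact: first_return_bound_moment (ltW K0) fr bK.
exact: first_return_bound_series (ltW K0) fr bK.
Qed.

End Bounds.

Section CStarProbability.
Variables (R : realType) (B M : cstarType R).

(** For t the square of the norm of b, the element t - b* b has the form c* c,
    and a *-homomorphism preserves this form. *)
Lemma hom_contractive (iota : {lrmorphism B -> M}) :
  (forall b, iota (star b) = star (iota b)) ->
    forall b, cnorm (iota b) <= cnorm b.
Proof.
move=> istar b; have npB := @cnorm_algebra_norm R B.
have npM := @cnorm_algebra_norm R M.
have b0 := an_ge0 npB b; have ib0 := an_ge0 npM (iota b).
rewrite -(@ler_pXn2r _ 2)// -cnorm_star.
apply: cpos_norm_le; [exact: sqr_ge0 | exact: cpos_starM|].
have [|||y Ey] := @cpos_ball _ B (cnorm b ^+ 2) (star b * b).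
- exact: sqr_ge0.
- by rewrite starM starK.
- by rewrite cnorm_star.
by exists (iota y); rewrite -!istar -!rmorphM -Ey rmorphB /= rmorph_alg.
Qed.

(** The inequality E(m)* E(m) <= E(m* m) is the positivity of E at
    (m - E(m))* (m - E(m)). *)
Lemma expectation_contractive (iota : {lrmorphism B -> M}) (E : M -> B) :
  cstar_probability iota E -> forall m, cnorm (E m) <= cnorm m.
Proof.
move=> [_ istar [lE E1] bimod pos] m; have npB := @cnorm_algebra_norm R B.
have npM := @cnorm_algebra_norm R M.
have El (b : B) (x : M) : E (iota b * x) = b * E x by have := bimod b x 1;
  rewrite rmorph1 !mulr1.
have Er (x : M) (b : B) : E (x * iota b) = E x * b by have := bimod 1 x b;
  rewrite rmorph1 !mul1r.
have Eh x : E (star x) = star (E x).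
  apply: (hermitian_of_squares (@starD R M) (@starZ R M) (star1 M) lE) => y.
  by apply/cpos_sa/pos/cpos_starM.
have m0 := an_ge0 npM m; have Em0 := an_ge0 npB (E m).
rewrite -(@ler_pXn2r _ 2)// -(cnorm_star (E m)).
apply: cpos_norm_le; [exact: sqr_ge0 | exact: cpos_starM|].
pose e := iota (E m).
have Ere x : E (x * e) = E x * E m by exact: Er.
have Ele x : E (star e * x) = star (E m) * E x by rewrite -istar; exact: El.
have Ee : E e = E m by rewrite -[e]mul1r Ere E1 mul1r.
have := pos _ (cpos_starM (m - e)).
rewrite starB mulrBl !mulrBr !(linB lE) !Ere Ele !Eh Ee subrr subr0 => h1.
have h2 : cpos (E (cnorm m ^+ 2 *r 1 - star m * m)).
  apply/pos/cpos_ball; [exact: sqr_ge0 | by rewrite starM starK | by rewrite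
    cnorm_star].
have := cposD h2 h1; rewrite (linB lE) (linZ lE) E1.
by rewrite addrA subrK.
Qed.

Lemma Sigma0_exp_bounded (mu : polyB B -> B) (iota : {lrmorphism B ->
  M}) (E : M -> B) x :
  cstar_probability iota E ->
    (forall b s, mu (mono (b, s)) = E (word_eval iota x b s)) ->
  exists2 K, 0 < K & exp_bounded K (moment mu).
Proof.
move=> pE Emu; have npM := @cnorm_algebra_norm R M.
have npB := @cnorm_algebra_norm R B.
have istar : forall b, iota (star b) = star (iota b) by have [] := pE.
have x0 := an_ge0 npM x.
exists (cnorm x + 1) => [|s]; first by rewrite ltr_wpDl.
have bw b t : cnorm (word_eval iota x b t) <= (cnorm x + 1) ^+ size t * (cnorm
  b * cprod t).
  elim: t b => [|c t IHt] b /=.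
    by rewrite mul1r /cprod big_nil mulr1; exact: hom_contractive.
  apply: le_trans (cnormM _ _) _.
  rewrite /cprod big_cons -/(cprod t) exprS.
  have -> : (cnorm x + 1) * (cnorm x + 1) ^+ size t * (cnorm b * (cnorm c *
    cprod t)) =
    cnorm b * (cnorm x + 1) * ((cnorm x + 1) ^+ size t * (cnorm c * cprod t))
      by ring.
  apply: ler_pM (IHt c); try exact: (an_ge0 npM).
  apply: le_trans (cnormM _ _) _.
  apply: ler_pM; try exact: (an_ge0 npM); first exact: hom_contractive.
  by rewrite lerDl.
rewrite /moment Emu; apply: le_trans (expectation_contractive pE _) _.
have -> : cprod s = cprod (rcons s 1).
  by rewrite /cprod -cats1 big_cat /= big_seq1 cnorm1 mulr1.
by have := bw 1 (rcons s 1); rewrite size_rcons cnorm1 mul1r.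
Qed.

End CStarProbability.

Local Open Scope quotient_scope.

(** * Completion for a C*-seminorm *)

Record cstar_seminorm (R : realType) (A : algType R[i]) := CStarSeminorm {
  csn :> A -> R;
  csn_star : A -> A;
  csn_starK : forall x, csn_star (csn_star x) = x;
  csn_starD : forall x y, csn_star (x + y) = csn_star x + csn_star y;
  csn_starZ : forall (c : R[i]) x, csn_star (c *: x) = c^*%C *: csn_star x;
  csn_starM : forall x y, csn_star (x * y) = csn_star y * csn_star x;
  csn_norm : algebra_norm csn;
  csn_id : forall x, csn (csn_star x * x) = csn x ^+ 2;
  csn_one : csn 1 != 0 }.

Section RealLimits.
Variable R : realType.
Implicit Types (r s : nat -> R) (l k : R).

Definition rlim r l := null (fun n => `|r n - l|).

Lemma rlim_cst l : rlim (fun=> l) l.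
Proof. by move=> e e0; exists 0%N => n _; rewrite subrr normr0. Qed.

Lemma rlimD r s l k : rlim r l -> rlim s k -> rlim (fun n => r n + s n) (l + k).
Proof.
move=> rl sk; apply: (small_le2 ler01 rl sk) => n.
by rewrite mul1r opprD addrACA ler_normD.
Qed.

Lemma rlimM r s l k : rlim r l -> rlim s k -> rlim (fun n => r n * s n) (l * k).
Proof.
move=> rl sk; have [N hN] := rl 1 ltr01.
have [D D0 rD] : exists2 D, 0 <= D & forall n, `|r n| <= D.
  apply: (@eventually_bounded _ _ N (1 + `|l|)) => n /hN h.
  by have := ler_normD (r n - l) l; rewrite subrK; lra.
apply: (small_le2 (addr_ge0 D0 (normr_ge0 k)) sk rl) => n.
have -> : r n * s n - l * k = r n * (s n - k) + (r n - l) * k by ring.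
apply: le_trans (ler_normD _ _) _; rewrite !normrM.
have := rD n; have := normr_ge0 (r n); have := normr_ge0 (s n - k).
have := normr_ge0 (r n - l); have := normr_ge0 k; nra.
Qed.

Lemma rlim_le r s l k : rlim r l -> rlim s k -> (forall n, r n <= s n) ->
  l <= k.
Proof.
move=> rl sk rs; apply/ler_addgt0Pr => e e0.
have [N hN] := rl _ (divr_gt0 e0 (ltr0n _ 2)).
have [M hM] := sk _ (divr_gt0 e0 (ltr0n _ 2)).
have := hN _ (leq_maxl N M); have := hM _ (leq_maxr N M).
have := rs (maxn N M); rewrite !ltr_norml => h /andP[h1 h2] /andP[h3 h4]; lra.
Qed.

Lemma rlim_eq r l k : rlim r l -> rlim r k -> l = k.
Proof.
by move=> rl rk; apply/eqP; rewrite eq_le (rlim_le rl rk)//= (rlim_le rk rl).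
Qed.

End RealLimits.

Section Completion.
Variables (R : realType) (A : algType R[i]) (p : cstar_seminorm A).
Implicit Types (x y : A).

Let np : algebra_norm p := csn_norm p.
Local Notation st := (csn_star p).

Lemma csn_star_eq x : p (st x) = p x.
Proof. exact: (an_star_eq np (csn_starK p) (csn_id p)). Qed.

Lemma csn_starN x : st (- x) = - st x.
Proof.
have s0 : st 0 = 0 by apply: (addrI (st 0)); rewrite -csn_starD !addr0.
by apply/eqP; rewrite -addr_eq0 -csn_starD addNr s0.
Qed.

Lemma csn_starB x y : st (x - y) = st x - st y.
Proof. by rewrite csn_starD csn_starN. Qed.

Record cauchy_seq := CauchySeq { cs_fun :> nat -> A;
  cs_cauchy : cauchy p cs_fun }.

HB.instance Definition _ := gen_eqMixin cauchy_seq.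
HB.instance Definition _ := gen_choiceMixin cauchy_seq.
Implicit Types u v w : cauchy_seq.

Definition cs_close u v := null (fun n => p (u n - v n)).

Definition cs_equivb u v : bool := `[< cs_close u v >].

Lemma cs_close_refl u : cs_close u u.
Proof. by move=> e e0; exists 0%N => n _; rewrite subrr (an0 np). Qed.

Lemma cs_close_sym u v : cs_close u v -> cs_close v u.
Proof. by move=> uv e /uv[N hN]; exists N => n /hN; rewrite (an_distC np). Qed.

Lemma cs_close_trans u v w : cs_close u v -> cs_close v w -> cs_close u w.
Proof.
by move=> uv vw; apply: (small_le2 ler01 uv vw) => n;
  rewrite mul1r (an_dist_triangle np).
Qed.

Lemma cs_equivb_refl : reflexive cs_equivb.
Proof. by move=> u; apply/asboolP/cs_close_refl. Qed.

Lemma cs_equivb_sym : symmetric cs_equivb.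
Proof. by move=> u v; apply/asboolP/asboolP; exact: cs_close_sym. Qed.

Lemma cs_equivb_trans : transitive cs_equivb.
Proof.
by move=> v u w /asboolP uv /asboolP vw; apply/asboolP/(cs_close_trans uv).
Qed.

Canonical cs_equiv := EquivRel cs_equivb cs_equivb_refl cs_equivb_sym
  cs_equivb_trans.

Definition completion : Type := {eq_quot cs_equiv}%qT.
HB.instance Definition _ := Choice.on completion.
HB.instance Definition _ := EqQuotient.on completion.

Definition cls u : completion := \pi_completion u.

Lemma clsP u v : cls u = cls v <-> cs_close u v.
Proof. by split=> [/eqmodP/asboolP//|uv]; apply/eqmodP/asboolP. Qed.

Lemma cls_repr (X : completion) : cls (repr X) = X.
Proof. exact: reprK. Qed.

Lemma clsW (K : completion -> Prop) : (forall u, K (cls u)) -> forall X, K X.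
Proof. by move=> Ku X; rewrite -[X]cls_repr. Qed.

Lemma repr_cls u : cs_close (repr (cls u)) u.
Proof. by apply/clsP; rewrite cls_repr. Qed.

Lemma cls_ext u v : (forall n, u n = v n) -> cls u = cls v.
Proof.
by move=> uv; apply/clsP => e e0; exists 0%N => n _; rewrite uv subrr (an0 np).
Qed.

Definition cs_add u v := CauchySeq (cauchyD np (cs_cauchy u) (cs_cauchy v)).
Definition cs_scale (c : R[i]) u := CauchySeq (cauchyZ np c (cs_cauchy u)).
Definition cs_mul u v := CauchySeq (cauchyM np (cs_cauchy u) (cs_cauchy v)).
Definition cs_const x := CauchySeq (cauchy_cst np x).

Lemma cs_star_cauchy u : cauchy p (fun n => st (u n)).
Proof.
move=> e /(cs_cauchy u)[N hN]; exists N => -[m n] /hN /=.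
by rewrite -csn_starB csn_star_eq.
Qed.

Definition cs_star u := CauchySeq (cs_star_cauchy u).

Definition c_add (X Y : completion) := cls (cs_add (repr X) (repr Y)).
Definition c_scale c (X : completion) := cls (cs_scale c (repr X)).
Definition c_opp (X : completion) := c_scale (-1) X.
Definition c_mul (X Y : completion) := cls (cs_mul (repr X) (repr Y)).
Definition c_star (X : completion) := cls (cs_star (repr X)).

Lemma cls_add u v : c_add (cls u) (cls v) = cls (cs_add u v).
Proof.
apply/clsP; apply: (small_le2 ler01 (repr_cls u) (repr_cls v)) => n /=.
by rewrite mul1r opprD addrACA (an_triangle np).
Qed.

Lemma cls_scale c u : c_scale c (cls u) = cls (cs_scale c u).
Proof.
apply/clsP; apply: (@small_le _ _ _ (complex.Re `|c|) _ _ _ (repr_cls u)) =>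
  [|n].
  by rewrite normc_def /= sqrtr_ge0.
by rewrite /= -scalerBr (an_scale np).
Qed.

Lemma cls_mul u v : c_mul (cls u) (cls v) = cls (cs_mul u v).
Proof.
apply/clsP; have [D D0 uD] := cauchy_bounded np (cs_cauchy (repr (cls u))).
have [E E0 vE] := cauchy_bounded np (cs_cauchy v).
apply: (small_le2 (addr_ge0 D0 E0) (repr_cls v) (repr_cls u)) => n /=.
apply: le_trans (an_prod_dist np _ _ _ _) _.
have := uD n; have := vE n; have := an_ge0 np (repr (cls u) n).
have := an_ge0 np (repr (cls v) n - v n);
  have := an_ge0 np (repr (cls u) n - u n).
have := an_ge0 np (v n); nra.
Qed.

Lemma cls_star u : c_star (cls u) = cls (cs_star u).
Proof.
by apply/clsP => e /(repr_cls u)[N hN]; exists N => n /hN;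
  rewrite -csn_starB csn_star_eq.
Qed.

Fact c_addA : associative c_add.
Proof.
elim/clsW => u; elim/clsW => v; elim/clsW => w; rewrite !cls_add.
by apply: cls_ext => n /=; rewrite addrA.
Qed.

Fact c_addC : commutative c_add.
Proof.
by elim/clsW => u; elim/clsW => v; rewrite !cls_add; apply: cls_ext => n;
  rewrite /= addrC.
Qed.

Fact c_add0 : left_id (cls (cs_const 0)) c_add.
Proof.
by elim/clsW => u; rewrite cls_add; apply: cls_ext => n; rewrite /= add0r.
Qed.

Fact c_addN : left_inverse (cls (cs_const 0)) c_opp c_add.
Proof.
elim/clsW => u; rewrite /c_opp cls_scale cls_add.
by apply: cls_ext => n; rewrite /= scaleN1r addNr.
Qed.

HB.instance Definition _ := GRing.isZmodule.Build completion c_addA c_addC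
  c_add0 c_addN.

Lemma clsD u v : cls u + cls v = cls (cs_add u v). Proof. exact: cls_add. Qed.

Fact c_mulA : associative c_mul.
Proof.
elim/clsW => u; elim/clsW => v; elim/clsW => w; rewrite !cls_mul.
by apply: cls_ext => n /=; rewrite mulrA.
Qed.

Fact c_mul1 : left_id (cls (cs_const 1)) c_mul.
Proof.
by elim/clsW => u; rewrite cls_mul; apply: cls_ext => n; rewrite /= mul1r.
Qed.

Fact c_mulr1 : right_id (cls (cs_const 1)) c_mul.
Proof.
by elim/clsW => u; rewrite cls_mul; apply: cls_ext => n; rewrite /= mulr1.
Qed.

Fact c_mulDl : left_distributive c_mul +%R.
Proof.
elim/clsW => u; elim/clsW => v; elim/clsW => w.
rewrite !(clsD, cls_mul).
by apply: cls_ext => n; rewrite /= mulrDl.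
Qed.

Fact c_mulDr : right_distributive c_mul +%R.
Proof.
elim/clsW => u; elim/clsW => v; elim/clsW => w.
rewrite !(clsD, cls_mul).
by apply: cls_ext => n; rewrite /= mulrDr.
Qed.

Fact c_one_neq0 : cls (cs_const 1) != 0.
Proof.
apply/eqP => /clsP/(_ (p 1));
  have p1 : 0 < p 1 by rewrite lt_def csn_one (an_ge0 np).
by case=> // N /(_ N (leqnn N)) /=; rewrite subr0 ltxx.
Qed.

HB.instance Definition _ := GRing.Zmodule_isNzRing.Build completion
  c_mulA c_mul1 c_mulr1 c_mulDl c_mulDr c_one_neq0.

Fact c_scaleA a b X : c_scale a (c_scale b X) = c_scale (a * b) X.
Proof.
by elim/clsW: X => u; rewrite !cls_scale; apply: cls_ext => n;
  rewrite /= scalerA.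
Qed.

Fact c_scale1 : left_id 1 c_scale.
Proof.
by elim/clsW => u; rewrite cls_scale; apply: cls_ext => n; rewrite /= scale1r.
Qed.

Fact c_scaleDr : right_distributive c_scale +%R.
Proof.
move=> c; elim/clsW => u; elim/clsW => v.
rewrite !(clsD, cls_scale).
by apply: cls_ext => n; rewrite /= scalerDr.
Qed.

Fact c_scaleDl X : {morph c_scale^~ X : a b / a + b}.
Proof.
move=> a b; elim/clsW: X => u; rewrite !cls_scale clsD.
by apply: cls_ext => n; rewrite /= scalerDl.
Qed.

HB.instance Definition _ := GRing.Zmodule_isLmodule.Build R[i] completion
  c_scaleA c_scale1 c_scaleDr c_scaleDl.

Lemma clsZ c u : c *: cls u = cls (cs_scale c u). Proof. exact: cls_scale. Qed.
Lemma clsM u v : cls u * cls v = cls (cs_mul u v). Proof. exact: cls_mul. Qed.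

Fact c_scaleAl (c : R[i]) (X Y : completion) : c *: (X * Y) = (c *: X) * Y.
Proof.
elim/clsW: X => u; elim/clsW: Y => v;
  rewrite (clsZ c u) !clsM (clsZ c (cs_mul u v)).
by apply: cls_ext => n; rewrite /= scalerAl.
Qed.

HB.instance Definition _ := GRing.Lmodule_isLalgebra.Build R[i] completion
  c_scaleAl.

Fact c_scaleAr (c : R[i]) (X Y : completion) : c *: (X * Y) = X * (c *: Y).
Proof.
elim/clsW: X => u; elim/clsW: Y => v;
  rewrite (clsZ c v) !clsM (clsZ c (cs_mul u v)).
by apply: cls_ext => n; rewrite /= scalerAr.
Qed.

HB.instance Definition _ := GRing.Lalgebra_isAlgebra.Build R[i] completion
  c_scaleAr.

(** * The norm of the completion *)

Definition c_norm (X : completion) :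
  R := xget 0 [set l | rlim (fun n => p (repr X n)) l].

Lemma c_norm_cls u : rlim (fun n => p (u n)) (c_norm (cls u)).
Proof.
have [l hl] : exists l, rlim (fun n => p (repr (cls u) n)) l.
  apply: real_cauchy => e /(cs_cauchy (repr (cls u)))[N hN];
    exists N => -[i j] /hN.
  exact: le_lt_trans (an_dist_dist np _ _).
have /= hr := xgetPex 0 (ex_intro [set l | rlim (fun n => p (repr (cls u) n))
  l] l hl).
apply: (small_le2 ler01 (cs_close_sym (repr_cls u)) hr) => n /=; rewrite mul1r.
rewrite -[X in `|X|](subrKA (p (repr (cls u) n))).
apply: le_trans (ler_normD _ _) _; rewrite lerD2r.
exact: an_dist_dist.
Qed.

Fact c_norm_eq0 X : c_norm X = 0 -> X = 0.
Proof.
elim/clsW: X => u u0; apply/clsP => e e0.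
have [N hN] := c_norm_cls u e0; exists N => n /hN.
by rewrite u0 !subr0 => /le_lt_trans; apply; exact: ler_norm.
Qed.

Fact c_normD X Y : c_norm (X + Y) <= c_norm X + c_norm Y.
Proof.
elim/clsW: X => u; elim/clsW: Y => v; rewrite clsD.
by apply: rlim_le (c_norm_cls _) (rlimD (c_norm_cls _) (c_norm_cls _)) _ => n;
  exact: (an_triangle np).
Qed.

Fact c_normZ (c : R[i]) X : c_norm (c *: X) = complex.Re `|c| * c_norm X.
Proof.
elim/clsW: X => u; rewrite clsZ; apply: rlim_eq (c_norm_cls _) _.
have := rlimM (rlim_cst (complex.Re `|c|)) (c_norm_cls u).
by congr rlim; apply/funext => n; rewrite -(an_scale np).
Qed.

Fact c_normM X Y : c_norm (X * Y) <= c_norm X * c_norm Y.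
Proof.
elim/clsW: X => u; elim/clsW: Y => v; rewrite clsM.
by apply: rlim_le (c_norm_cls _) (rlimM (c_norm_cls _) (c_norm_cls _)) _ => n;
  exact: (an_mul np).
Qed.

Fact c_norm_star X : c_norm (c_star X * X) = c_norm X ^+ 2.
Proof.
elim/clsW: X => u; rewrite cls_star clsM; apply: rlim_eq (c_norm_cls _) _.
have := rlimM (c_norm_cls u) (c_norm_cls u); rewrite -expr2.
by congr rlim; apply/funext => n; rewrite -expr2 -csn_id.
Qed.

Fact c_starK X : c_star (c_star X) = X.
Proof.
by elim/clsW: X => u; rewrite !cls_star; apply: cls_ext => n; exact: csn_starK.
Qed.

Fact c_starD X Y : c_star (X + Y) = c_star X + c_star Y.
Proof.
elim/clsW: X => u; elim/clsW: Y => v; rewrite clsD !cls_star clsD.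
by apply: cls_ext => n; exact: csn_starD.
Qed.

Fact c_starZ (c : R[i]) X : c_star (c *: X) = c^*%C *: c_star X.
Proof.
by elim/clsW: X => u; rewrite clsZ !cls_star clsZ; apply: cls_ext => n;
  exact: csn_starZ.
Qed.

Fact c_starM X Y : c_star (X * Y) = c_star Y * c_star X.
Proof.
elim/clsW: X => u; elim/clsW: Y => v; rewrite clsM !cls_star clsM.
by apply: cls_ext => n; exact: csn_starM.
Qed.

Let cn : algebra_norm c_norm := AlgebraNorm c_normD c_normZ c_normM.

Definition inc x : completion := cls (cs_const x).

Lemma inc_linear : linear inc.
Proof. by move=> c x y; rewrite /inc clsZ clsD; exact: cls_ext. Qed.

Lemma inc_monoid_morphism : monoid_morphism inc.
Proof. by split=> // x y; rewrite /inc clsM; exact: cls_ext. Qed.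

HB.instance Definition _ := GRing.isLinear.Build R[i] A completion *:%R inc
  inc_linear.
HB.instance Definition _ := GRing.isMonoidMorphism.Build A completion inc
  inc_monoid_morphism.

Lemma inc_star x : inc (st x) = c_star (inc x).
Proof. by rewrite cls_star; exact: cls_ext. Qed.

Lemma c_norm_inc x : c_norm (inc x) = p x.
Proof.
by apply: rlim_eq (c_norm_cls (cs_const x)) _; exact: (rlim_cst (p x)).
Qed.

(** The image of the algebra is dense: a class is the limit of the terms of any
    of its representatives. *)
Lemma inc_tends u : tends c_norm (fun n => inc (u n)) (cls u).
Proof.
move=> e e0; have [N hN] := cs_cauchy u (divr_gt0 e0 (ltr0n _ 2)).
exists N => n Nn; have -> : inc (u n) - cls u = cls (cs_add (cs_const (u n))
  (cs_scale (-1) u)).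
  by rewrite -clsD -clsZ scaleN1r.
apply: le_lt_trans (_ : e / 2 < e); last by lra.
have h := c_norm_cls (cs_add (cs_const (u n)) (cs_scale (-1) u)).
rewrite leNgt; apply/negP => lt; set l := c_norm _ in h lt.
have d0 : 0 < l - e / 2 by rewrite subr_gt0.
have [M hM] := h _ d0.
have := hM _ (leq_maxr N M); have /= := hN (n, maxn N M).
rewrite leq_min Nn leq_maxl scaleN1r => /(_ isT) h1.
by rewrite ltr_norml => /andP[]; lra.
Qed.

Fact c_norm_complete (U : nat -> completion) :
  (forall e : R, 0 < e -> exists N, forall m n, (N <= m)%N -> (N <= n)%N ->
     c_norm (U m - U n) < e) ->
  exists l, forall e : R, 0 < e -> exists N, forall n, (N <= n)%N ->
    c_norm (U n - l) < e.
Proof.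
move=> cU.
have approx n : exists x, c_norm (inc x - U n) < n.+1%:R^-1.
  have n0 : 0 < n.+1%:R^-1 :> R by rewrite invr_gt0.
  have [N /(_ N (leqnn N))] := inc_tends (repr (U n)) n0.
  by rewrite cls_repr; exists (repr (U n) N).
have [a ha] := choice approx.
have inv_small : null (fun n => n.+1%:R^-1 : R).
  move=> e e0; exists (Num.bound e^-1) => n hn.
  rewrite invf_plt ?posrE//; apply: lt_le_trans (archi_boundP _) _.
    by rewrite invr_ge0 ltW.
  by rewrite ler_nat leqW.
have ca : cauchy p a.
  move=> e e0; have e3 : 0 < e / 3 by rewrite divr_gt0.
  have [N hN] := inv_small _ e3; have [M hM] := cU _ e3.
  exists (maxn N M) => -[m n] /=;
    rewrite leq_min !geq_max => /andP[/andP[Nm Mm] /andP[Nn Mn]].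
  rewrite -c_norm_inc (linB inc_linear).
  have h1 := an_dist_triangle cn (inc (a m)) (U m) (inc (a n)).
  have h2 := an_dist_triangle cn (U m) (U n) (inc (a n)).
  have -> : e = e / 3 + (e / 3 + e / 3) by field.
  apply: le_lt_trans h1 (ltrD (lt_trans (ha m) (hN m Nm)) _).
  apply: le_lt_trans h2 (ltrD (hM m n Mm Mn) _).
  by rewrite (an_distC cn); exact: lt_trans (ha n) (hN n Nn).
exists (cls (CauchySeq ca)) => e e0; have e2 : 0 < e / 2 by rewrite divr_gt0.
have [N hN] := inv_small _ e2; have [M hM] := inc_tends (CauchySeq ca) e2.
exists (maxn N M) => n; rewrite geq_max => /andP[/hN h1 /hM /= h2].
have -> : e = e / 2 + e / 2 by field.
apply: le_lt_trans (an_dist_triangle cn (U n) (inc (a n)) _) (ltrD _ h2).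
by rewrite (an_distC cn); exact: lt_trans (ha n) h1.
Qed.

HB.instance Definition _ := Algebra_isCStarAlgebra.Build R completion
  c_starK c_starD c_starZ c_starM c_norm_eq0 c_normD c_normZ c_normM c_norm_star
  c_norm_complete.

(** * Extension of bounded maps to the completion *)

Section Extension.
Variables (B : cstarType R) (f : A -> B).
Hypotheses (lf : linear f) (fp : forall x, cnorm (f x) <= p x).

Let nB := @cnorm_algebra_norm R B.

Definition extend (X : completion) : B :=
  xget 0 [set l | tends (@cnorm R B) (fun n => f (repr X n)) l].

Lemma extend_cls u : tends (@cnorm R B) (fun n => f (u n)) (extend (cls u)).
Proof.
have [l hl] : exists l, tends (@cnorm R B) (fun n => f (repr (cls u) n)) l.
  apply: complete => e /(cs_cauchy (repr (cls u)))[N hN];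
    exists N => -[i j] /hN.
  by apply: le_lt_trans; rewrite -(linB lf).
have /= hr := xgetPex 0 (ex_intro
  [set l | tends (@cnorm R B) (fun n => f (repr (cls u) n)) l] l hl).
apply: (small_le2 ler01 (cs_close_sym (repr_cls u)) hr) => n /=; rewrite mul1r.
apply: le_trans (an_dist_triangle nB _ (f (repr (cls u) n)) _) _.
by rewrite lerD2r -(linB lf).
Qed.

Lemma extend_inc x : extend (inc x) = f x.
Proof.
by apply: tends_eq (extend_cls (cs_const x)) _; exact: (tends_cst nB (f x)).
Qed.

Lemma extend_linear : linear extend.
Proof.
move=> c; elim/clsW => u; elim/clsW => v; rewrite clsZ clsD.
apply: tends_eq (extend_cls _) _.
have := tendsD nB (tendsZ nB c (extend_cls u)) (extend_cls v).
by congr tends; apply/funext => n; rewrite -lf.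
Qed.

Lemma extend_bimodule (g : B -> A) :
  (forall b x c, f (g b * x * g c) = b * f x * c) ->
  forall b X c, extend (inc (g b) * X * inc (g c)) = b * extend X * c.
Proof.
move=> fg b; elim/clsW => u c;
  rewrite (clsM (cs_const (g b)) u) (clsM _ (cs_const (g c))).
apply: tends_eq (extend_cls _) _.
have := tendsM nB (tendsM nB (tends_cst nB b) (extend_cls u)) (tends_cst nB c).
by congr tends; apply/funext => n; rewrite -fg.
Qed.

Lemma extend_pos : (forall x, cpos (f (st x * x))) -> forall X, cpos X ->
  cpos (extend X).
Proof.
move=> fpos _ [Y ->]; elim/clsW: Y => u; apply: cpos_closed => e e0.
rewrite [star _]cls_star clsM;
  have [N /(_ N (leqnn N)) hN] := extend_cls (cs_mul (cs_star u) u) e0.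
exists (f (st (u N) * u N)); first exact: fpos.
by rewrite (an_distC nB).
Qed.

End Extension.

End Completion.

(** * Realization of distributions with exponentially bounded moments *)

Section ConstB.
Variables (R : realType) (B : cstarType R).

HB.instance Definition _ := GRing.isLinear.Build R[i] B (polyB B) *:%R (@constB
  R B)
  (@constB_linear R B).

Lemma constB_monoid_morphism : monoid_morphism (@constB R B).
Proof. by split=> // b c; rewrite constBM. Qed.

HB.instance Definition _ := GRing.isMonoidMorphism.Build B (polyB B) (@constB R
  B)
  constB_monoid_morphism.

End ConstB.

Section RealCombinations.
Variables (R : realType) (B : cstarType R).

(** Writing all terms as real combinations of the same four vectors reduces an
    identity in B to identities between real coefficients. *)
Definition comb (v1 v2 v3 v4 : B) (a1 a2 a3 a4 : R) : B :=
  a1 *r v1 + a2 *r v2 + a3 *r v3 + a4 *r v4.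

Lemma combD (v1 v2 v3 v4 : B) (a1 a2 a3 a4 b1 b2 b3 b4 : R) :
  comb v1 v2 v3 v4 a1 a2 a3 a4 + comb v1 v2 v3 v4 b1 b2 b3 b4 =
  comb v1 v2 v3 v4 (a1 + b1) (a2 + b2) (a3 + b3) (a4 + b4).
Proof.
by rewrite /comb !realrDl addrACA; congr (_ + _); rewrite addrACA;
  congr (_ + _); rewrite addrACA.
Qed.

Lemma combZ (v1 v2 v3 v4 : B) (t a1 a2 a3 a4 : R) :
  t *r comb v1 v2 v3 v4 a1 a2 a3 a4 = comb v1 v2 v3 v4 (t * a1) (t * a2) (t *
    a3) (t * a4).
Proof. by rewrite /comb !scalerDr !realrA. Qed.

Lemma realN1r (x : B) : (-1) *r x = - x.
Proof. by rewrite rmorphN1 scaleN1r. Qed.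

Lemma real0r (x : B) : 0 *r x = 0. Proof. by rewrite scale0r. Qed.

End RealCombinations.

Section OperatorSeminorm.
Variables (R : realType) (B : cstarType R).
Notation PB := (polyB B).
Variables (mu : PB -> B) (K : R).
Hypotheses (smu : Sigma mu) (K0 : 0 < K) (bmu : exp_bounded K (moment mu)).
Implicit Types (P Q xi eta : PB) (b c : B) (t u : R).

Let lmu : linear mu. Proof. by have [[]] := smu. Qed.
Let nB := @cnorm_algebra_norm R B.

Definition sq xi : B := mu (starP xi * xi).

Lemma sq_pos xi : cpos (sq xi). Proof. by have [_] := smu; apply. Qed.

Lemma starPB P Q : starP (P - Q) = starP P - starP Q.
Proof. by rewrite starPD -scaleN1r starPZ rmorphN1 scaleN1r. Qed.

Lemma starP_real t P : starP (t *r P) = t *r starP P.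
Proof. by rewrite starPZ conjc_real. Qed.

Lemma sqB xi eta :
  sq (xi - eta) = sq xi + sq eta - (mu (starP xi * eta) + mu (starP eta * xi)).
Proof.
rewrite /sq starPB mulrBl !mulrBr !(linB lmu) opprB opprD.
by rewrite addrACA [X in _ + X]addrC addrA addrAC -addrA.
Qed.

(** A bound t on the norm of left multiplication by P for the B-valued inner
    product of mu, stated with the order of B so that the rules below become
    algebraic identities between squares. *)
Definition op_bound t P := forall xi, cpos (t ^+ 2 *r sq xi - sq (P * xi)).

Lemma op_bound_mono t u P : 0 <= t -> t <= u -> op_bound t P -> op_bound u P.
Proof.
move=> t0 tu bt xi; have -> : u ^+ 2 *r sq xi - sq (P * xi) =
    (u ^+ 2 - t ^+ 2) *r sq xi + (t ^+ 2 *r sq xi - sq (P * xi)).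
  by rewrite addrA -realrDl subrK.
apply: cposD (bt xi); apply: cposZ (sq_pos _).
by rewrite subr_ge0 ler_pXn2r ?nnegrE// (le_trans t0).
Qed.

Lemma op_boundM t u P Q : op_bound t P -> op_bound u Q ->
  op_bound (t * u) (P * Q).
Proof.
move=> bP bQ xi; have -> : (t * u) ^+ 2 *r sq xi - sq (P * Q * xi) =
    t ^+ 2 *r (u ^+ 2 *r sq xi - sq (Q * xi)) + (t ^+ 2 *r sq (Q * xi) - sq (P
      * (Q * xi))).
  by rewrite scalerBr addrA subrK realrA exprMn mulrA.
by apply: cposD (bP _); apply: cposZ (bQ _); exact: sqr_ge0.
Qed.

Lemma normC_Re (a : R[i]) : (complex.Re `|a|)%:C%C = `|a|.
Proof. by rewrite RRe_real// normr_real. Qed.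

Lemma sqZ (c : R[i]) xi : sq (c *: xi) = (complex.Re `|c|) ^+ 2 *r sq xi.
Proof.
rewrite /sq starPZ -scalerAl -scalerAr scalerA (linZ lmu); congr (_ *: _).
by rewrite mulrC -sqr_normc -[in LHS](normC_Re c) -rmorphXn.
Qed.

Lemma op_boundZ (c : R[i]) t P : op_bound t P ->
  op_bound (complex.Re `|c| * t) (c *: P).
Proof.
move=> bP xi; rewrite -scalerAl sqZ exprMn -realrA -scalerBr.
by apply: cposZ (bP xi); exact: sqr_ge0.
Qed.

(** From 0 <= sq (u x - t y), with x and y the images of xi, one gets
    t u sq (x + y) <= (t + u) (u sq x + t sq y). *)
Lemma op_boundD t u P Q : 0 < t -> 0 < u ->
  op_bound t P -> op_bound u Q -> op_bound (t + u) (P + Q).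
Proof.
move=> t0 u0 bP bQ xi; set x := P * xi; set y := Q * xi.
pose C := mu (starP x * y) + mu (starP y * x).
pose L := comb (sq xi) (sq x) (sq y) C.
have E1 : t ^+ 2 *r sq xi - sq x = L (t ^+ 2) (-1) 0 0.
  by rewrite /L /comb !real0r realN1r !addr0.
have E2 : u ^+ 2 *r sq xi - sq y = L (u ^+ 2) 0 (-1) 0.
  by rewrite /L /comb !real0r realN1r !addr0.
have E3 : sq (u *r x - t *r y) = L 0 (u ^+ 2) (t ^+ 2) (- (u * t)).
  rewrite sqB !sqZ !Re_norm_real !ger0_norm ?ltW// /L /comb real0r add0r;
    congr (_ + _).
  rewrite !starP_real -!scalerAl -!scalerAr !scalerA -!rmorphM !(linZ lmu) [t *
    u]mulrC -scalerDr.
  by rewrite -scaleNr -rmorphN.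
have E4 : (t + u) ^+ 2 *r sq xi - sq ((P + Q) * xi) = L ((t + u) ^+ 2) (-1)
  (-1) (-1).
  have -> : (P + Q) * xi = x - (-1) *r y by rewrite mulrDl rmorphN1 scaleN1r
    opprK.
  rewrite sqB sqZ Re_norm_real normrN1 expr1n real1r starP_real -scalerAl
    -scalerAr.
  rewrite !(linZ lmu) !realN1r -opprD opprK /L /comb !realN1r !opprD.
  by rewrite !addrA.
rewrite E4; have -> : L ((t + u) ^+ 2) (-1) (-1) (-1) =
    ((t + u) / t) *r L (t ^+ 2) (-1) 0 0 + ((t + u) / u) *r L (u ^+ 2) 0 (-1) 0
    + (u * t)^-1 *r L 0 (u ^+ 2) (t ^+ 2) (- (u * t)).
  rewrite /L !combZ !combD; congr comb; field; by rewrite ?lt0r_neq0.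
rewrite -E1 -E2 -E3; apply: cposD; first apply: cposD.
- by apply: cposZ (bP xi); rewrite divr_ge0 ?addr_ge0 ?ltW.
- by apply: cposZ (bQ xi); rewrite divr_ge0 ?addr_ge0 ?ltW.
- by apply: cposZ (sq_pos _); rewrite invr_ge0 mulr_ge0 ?ltW.
Qed.

(** With T = P* P, expanding sq (t^2 xi - T xi) >= 0 and using
    sq (T xi) <= t^4 sq xi gives sq (P xi) <= t^2 sq xi. *)
Lemma op_bound_of_square t P : 0 < t -> op_bound (t ^+ 2) (starP P * P) ->
  op_bound t P.
Proof.
move=> t0 bP xi; set T := starP P * P.
have h := cposD (bP xi) (sq_pos (t ^+ 2 *r xi - T * xi)).
have Exy : mu (starP xi * (T * xi)) = sq (P * xi).
  by rewrite /sq starPM /T !mulrA.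
have Eyx : mu (starP (T * xi) * xi) = sq (P * xi).
  by rewrite /sq !starPM starPK !mulrA.
have -> : t ^+ 2 *r sq xi - sq (P * xi) = (2 * t ^+ 2)^-1 *r
   ((t ^+ 2) ^+ 2 *r sq xi - sq (T * xi) + sq (t ^+ 2 *r xi - T * xi)).
  rewrite sqB sqZ Re_norm_real ger0_norm ?sqr_ge0//.
  rewrite starP_real -scalerAl -scalerAr !(linZ lmu) Exy Eyx.
  pose L := comb (sq xi) (sq (P * xi)) (sq (T * xi)) 0.
  transitivity (L (t ^+ 2) (-1) 0 0);
    first by rewrite /L /comb !real0r realN1r !addr0.
  transitivity ((2 * t ^+ 2)^-1 *r (L ((t ^+ 2) ^+ 2) 0 (-1) 0 +
    L ((t ^+ 2) ^+ 2) (- (t ^+ 2 + t ^+ 2)) 1 0)).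
    rewrite /L combD combZ; congr comb; field; by rewrite ?lt0r_neq0.
  congr (_ *r (_ + _)); rewrite /L /comb !real0r ?realN1r ?real1r !addr0//.
  by rewrite rmorphN scaleNr realrDl addrAC.
by apply: cposZ h; rewrite invr_ge0 mulr_ge0 ?sqr_ge0.
Qed.

(** The same expansion, for sq (t^2 xi - P P* xi), with the bound on P applied
    to P* xi. *)
Lemma op_bound_star t P : 0 < t -> op_bound t P -> op_bound t (starP P).
Proof.
move=> t0 bP xi; set y := starP P * xi; set z := P * y.
have h := cposD (bP y) (sq_pos (t ^+ 2 *r xi - z)).
have Exz : mu (starP xi * z) = sq y by rewrite /sq /y starPM starPK /z !mulrA.
have Ezx : mu (starP z * xi) = sq y.
  by rewrite /sq /z !starPM mulrA.
have -> : t ^+ 2 *r sq xi - sq y = (t ^+ 2)^-1 *r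
   (t ^+ 2 *r sq y - sq z + sq (t ^+ 2 *r xi - z)).
  rewrite sqB sqZ Re_norm_real ger0_norm ?sqr_ge0//.
  rewrite starP_real -scalerAl -scalerAr !(linZ lmu) Exz Ezx.
  pose L := comb (sq xi) (sq y) (sq z) 0.
  transitivity (L (t ^+ 2) (-1) 0 0);
    first by rewrite /L /comb !real0r realN1r !addr0.
  transitivity ((t ^+ 2)^-1 *r (L 0 (t ^+ 2) (-1) 0 +
    L ((t ^+ 2) ^+ 2) (- (t ^+ 2 + t ^+ 2)) 1 0)).
    rewrite /L combD combZ; congr comb; field; by rewrite ?lt0r_neq0.
  congr (_ *r (_ + _)); rewrite /L /comb !real0r ?realN1r ?real1r ?add0r
    !addr0//.
  by rewrite rmorphN scaleNr realrDl addrAC.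
by apply: cposZ h; rewrite invr_ge0 ?sqr_ge0.
Qed.

Lemma op_bound_constB b : op_bound (cnorm b) (constB b).
Proof.
move=> xi; have [|||c Ec] := @cpos_ball _ B (cnorm b ^+ 2) (star b * b).
- exact: sqr_ge0.
- by rewrite starM starK.
- by rewrite cnorm_star.
have sqb d : sq (constB d * xi) = mu (starP xi * constB (star d * d) * xi).
  by rewrite /sq starPM starP_constB constBM !mulrA.
rewrite sqb; have := sq_pos (constB c * xi); rewrite sqb -Ec; congr cpos.
rewrite (linB (@constB_linear _ _)) constBZ mulrBr mulrBl (linB lmu).
by rewrite -scalerAr mulr1 -scalerAl (linZ lmu).
Qed.

(** * Boundedness of X *)

Definition wnorm (w : word B) : R := K ^+ size w.2 * (cnorm w.1 * cprod w.2).

Lemma wnorm_ge0 w : 0 <= wnorm w.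
Proof.
by rewrite mulr_ge0 ?exprn_ge0 ?(ltW K0)// mulr_ge0 ?cprod_ge0 ?(an_ge0 nB).
Qed.

Lemma wnormM w v : wnorm (wmul w v) <= wnorm w * wnorm v.
Proof.
case: w => b s; elim: s b => [|c s IHs] b.
  rewrite /wnorm /wmul /= ?mul1r [cprod [::]]big_nil mulr1 [leRHS]mulrCA.
  rewrite ler_wpM2l ?exprn_ge0 ?(ltW K0)// mulrA ler_wpM2r ?cprod_ge0//.
  exact: cnormM.
have E d (w' : word B) : wnorm (d, w'.1 :: w'.2) = K * cnorm d * wnorm w'.
  by rewrite /wnorm /= exprS /cprod big_cons; ring.
rewrite -[wmul _ _]/(b, (wmul (c, s) v).1 :: (wmul (c, s) v).2) E.
rewrite -[(b, c :: s)]/(b, (c, s).1 :: (c,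
  s).2) E -[leRHS]mulrA ler_wpM2l ?IHs//.
by rewrite mulr_ge0 ?(ltW K0) ?(an_ge0 nB).
Qed.

Lemma mu_mono_le w : cnorm (mu (mono w)) <= wnorm w.
Proof.
case: w => b s; case/lastP: s => [|s c].
  rewrite -[mono _]/(constB b); have [[_ _ ->] _] := smu.
  by rewrite /wnorm /= mul1r [cprod [::]]big_nil mulr1.
have [sa _] := smu; rewrite (Sigma_alg_mono_rcons _ _ _ sa).
apply: le_trans (cnormM _ _) _.
have -> : wnorm (b, rcons s c) = cnorm b * (K ^+ (size s).+1 * cprod s) * cnorm
  c.
  by rewrite /wnorm /= size_rcons /cprod -cats1 big_cat /= big_seq1; ring.
rewrite ler_wpM2r ?(an_ge0 nB)//; apply: le_trans (cnormM _ _) _.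
by rewrite ler_wpM2l ?(an_ge0 nB).
Qed.

Lemma varX_pow k : exists2 w, varX B ^+ k = mono w & wnorm w <= K ^+ k.
Proof.
elim: k => [|k [w Ew hw]].
  by exists (wcst 1) => //; rewrite /wnorm /= mul1r [cprod [::]]big_nil mulr1
    cnorm1.
exists (wmul (1, [:: 1]) w); first by rewrite exprS Ew monoM.
apply: le_trans (wnormM _ _) _; rewrite exprS.
rewrite {1}/wnorm /= expr1 cnorm1 mul1r /cprod big_seq1 cnorm1 mulr1.
by rewrite ler_wpM2l ?(ltW K0).
Qed.

Lemma mu_sandwich_le P Q : exists2 C, 0 <= C &
  forall k, cnorm (mu (P * varX B ^+ k * Q)) <= C * K ^+ k.
Proof.
have cnorm_sum_seq (I : Type) (r : seq I) (f : I -> B) (g : I -> R) :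
    (forall i, cnorm (f i) <= g i) ->
      cnorm (\sum_(i <- r) f i) <= \sum_(i <- r) g i.
  move=> fg; elim/big_rec2: _ => [|i y x _ h]; first by rewrite (an0 nB).
  by apply: le_trans (cnormD _ _) _; apply: lerD.
pose N P := \sum_(w <- repr P) wnorm w.
exists (N P * N Q) => [|k].
  by rewrite mulr_ge0// sumr_ge0// => w _; exact: wnorm_ge0.
have [w Ew hw] := varX_pow k; rewrite Ew {1}[P]polyE {1}[Q]polyE.
rewrite !mulr_suml (lin_sum lmu) /N; apply: (@cnorm_sum_seq _) => u.
rewrite mulr_sumr (lin_sum lmu) mulr_sumr mulr_suml;
  apply: (@cnorm_sum_seq _) => v.
rewrite !monoM; apply: le_trans (mu_mono_le _) _.
apply: le_trans (wnormM _ _) _; rewrite [leRHS]mulrAC.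
rewrite ler_wpM2r ?wnorm_ge0//; apply: le_trans (wnormM _ _) _.
by rewrite ler_wpM2l ?wnorm_ge0.
Qed.

(** The squares y_k of the vectors (X/2K)^k xi form a convex sequence in B that
    tends to 0, hence a decreasing one. *)
Lemma op_bound_varX : op_bound (2 * K) (varX B).
Proof.
move=> xi; pose L := 2 * K; have L0 : 0 < L by rewrite mulr_gt0.
pose Z : PB := L^-1 *r varX B.
have sZ k : starP (Z ^+ k) = Z ^+ k.
  elim: k => [|k IHk]; first by rewrite expr0 starP1.
  by rewrite exprS starPM IHk starP_real starP_varX -/Z -exprSr exprS.
pose y k := sq (Z ^+ k * xi); pose d k := y k - y k.+1.
have cross j l : mu (starP (Z ^+ j * xi) * (Z ^+ l * xi)) =
    mu (starP xi * Z ^+ (j + l) * xi).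
  by rewrite starPM sZ exprD !mulrA.
have yE k : y k = mu (starP xi * Z ^+ (k + k) * xi) by exact: cross.
have dd k : cpos (d k - d k.+1).
  have := sq_pos (Z ^+ k * xi - Z ^+ k.+2 * xi); rewrite sqB; congr cpos.
  rewrite (cross k k.+2) (cross k.+2 k) -/(y k) -/(y k.+2) /d.
  rewrite (_ : (k + k.+2)%N = (k.+1 + k.+1)%N) ?addnS ?addSn//.
  rewrite -[(k + k).+2]/((k.+1 + k).+1) -addnS -yE.
  by rewrite opprB addrACA -opprD.
have d0 k : cpos (d 0%N - d k).
  elim: k => [|k IHk]; first by rewrite subrr; exact: cpos0.
  by have := cposD IHk (dd k); rewrite addrA subrK.
have [C C0 hC] := mu_sandwich_le (starP xi) xi.
have yC k : cnorm (y k) <= C * (2^-1) ^+ k.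
  have ZX : Z ^+ (k + k) = (L^-1) ^+ (k + k) *r varX B ^+ (k + k).
    by rewrite /Z exprZn rmorphXn.
  rewrite yE ZX -scalerAr -scalerAl (linZ lmu) (an_real nB).
  rewrite ger0_norm ?exprn_ge0 ?invr_ge0 ?(ltW L0)//.
  apply: le_trans (ler_wpM2l _ (hC _)) _;
    first by rewrite exprn_ge0 ?invr_ge0 ?(ltW L0).
  rewrite mulrCA ler_wpM2l// -exprMn.
  have -> : L^-1 * K = 2^-1 by rewrite /L; field; rewrite lt0r_neq0.
  rewrite exprD ler_piMr ?exprn_ge0 ?invr_ge0//; apply: exprn_ile1;
    rewrite ?invr_ge0 ?invf_le1 ?ler1n ?ltr0n//.
suff h : cpos (d 0%N).
  have -> : (2 * K) ^+ 2 *r sq xi - sq (varX B * xi) = (2 * K) ^+ 2 *r d 0%N.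
    rewrite /d /y expr0 expr1 mul1r scalerBr; congr (_ - _).
    rewrite /Z -scalerAl sqZ Re_norm_real ger0_norm ?invr_ge0 ?(ltW L0)//
      realrA.
    by rewrite -exprMn mulfV ?lt0r_neq0// expr1n real1r.
  by apply: cposZ h; exact: sqr_ge0.
apply: cpos_closed => e e0.
have [k hk] : exists k, C * 2 < e * 2 ^+ k.
  exists (Num.bound (C * 2 / e)).
  rewrite [ltRHS]mulrC -ltr_pdivrMr//.
  apply: lt_trans (archi_boundP _) _; first by apply: divr_ge0;
    [exact: mulr_ge0 | exact: ltW].
  by rewrite -natrX ltr_nat ltn_expl.
exists (d 0%N - d k); first exact: d0.
rewrite subKr /d; apply: le_lt_trans (anB nB _ _) _.
have := yC k; have := yC k.+1; rewrite exprS !exprVn => h1 h2.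
have : C * (2 ^+ k)^-1 * 2 < e by rewrite mulrAC ltr_pdivrMr ?exprn_gt0.
have : 0 <= C * (2 ^+ k)^-1 by rewrite mulr_ge0// invr_ge0 exprn_ge0.
move: h1 h2; move: ((2 ^+ k)^-1) => q; lra.
Qed.

Lemma op_bounded P : exists2 t, 0 < t & op_bound t P.
Proof.
have step w : exists2 t, 0 < t & op_bound t (mono w).
  case: w => b s; elim: s b => [|c s IHs] b.
    exists (cnorm b + 1); first by rewrite ltr_wpDl ?(an_ge0 nB).
    apply: op_bound_mono (@op_bound_constB b); first exact: (an_ge0 nB).
    by rewrite lerDl.
  have [t t0 ht] := IHs c; rewrite monoE.
  exists ((cnorm b + 1) * (2 * K) * t).
    by rewrite !mulr_gt0// ltr_wpDl ?(an_ge0 nB).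
  apply: op_boundM ht; apply: op_boundM op_bound_varX.
  apply: op_bound_mono (@op_bound_constB b); first exact: (an_ge0 nB).
  by rewrite lerDl.
rewrite [P]polyE; elim: (repr P) => [|w r [t t0 ht]].
  exists 1 => // xi; rewrite big_nil mul0r expr1n real1r /sq mulr0 (lin0 lmu)
    subr0.
  exact: sq_pos.
rewrite big_cons; have [u u0 hu] := step w.
by exists (u + t); [exact: addr_gt0 | exact: op_boundD].
Qed.

(** * The seminorm *)

Definition op_norm P : R := inf [set t | 0 <= t /\ op_bound t P].

Lemma op_norm_has_inf P : has_inf [set t | 0 <= t /\ op_bound t P].
Proof.
split; last by exists 0 => t [].
by have [t t0 ht] := op_bounded P; exists t; split=> //; exact: ltW.
Qed.

Lemma op_norm_ge0 P : 0 <= op_norm P.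
Proof. by apply: lb_le_inf; [have [] := op_norm_has_inf P | move=> t []]. Qed.

Lemma op_norm_le t P : 0 <= t -> op_bound t P -> op_norm P <= t.
Proof. by move=> t0 bt; apply: ge_inf => //; have [] := op_norm_has_inf P. Qed.

Lemma op_bound_gt t P : op_norm P < t -> op_bound t P.
Proof.
move=> lt; have d0 : 0 < t - op_norm P by rewrite subr_gt0.
have [u [u0 bu] hu] := inf_adherent d0 (op_norm_has_inf P).
by apply: op_bound_mono u0 _ bu; move: hu; rewrite -/(op_norm P); lra.
Qed.

(** The infimum is attained because the cone is closed. *)
Lemma op_bound_norm P : op_bound (op_norm P) P.
Proof.
move=> xi; apply: cpos_closed => e e0; have p0 := op_norm_ge0 P.
set p := op_norm P in p0 *; have s0 := an_ge0 nB (sq xi);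
  set s := cnorm (sq xi) in s0 *.
(* For d <= 1 the increment of p^2 to (p + d)^2 is at most (2p + 1) d. *)
pose G := (2 * p + 1) * (s + 1).
have G0 : 0 < G by rewrite mulr_gt0; lra.
pose d := Num.min 1 (e / (2 * G)).
have d0 : 0 < d by rewrite lt_min ltr01 divr_gt0// mulr_gt0.
have [d1 dG] : d <= 1 /\ d <= e / (2 * G) by apply/andP; rewrite -le_min.
exists ((p + d) ^+ 2 *r sq xi - sq (P * xi)).
  by apply: op_bound_gt; rewrite -/p ltrDl.
rewrite opprB addrA subrK -scalerBl -rmorphB (an_real nB) -/s.
rewrite ler0_norm; last by nra.
have h : d * G <= e / 2.
  have : d * G <= e / (2 * G) * G by rewrite ler_wpM2r ?(ltW G0).
  by have -> : e / (2 * G) * G = e / 2 by field; rewrite lt0r_neq0.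
apply: le_lt_trans (_ : d * G < e); last by lra.
have : - (p ^+ 2 - (p + d) ^+ 2) <= d * (2 * p + 1) by nra.
rewrite /G mulrA; have : 0 <= d * (2 * p + 1) by nra.
move: (- _) (d * _) => X Y; nra.
Qed.

Lemma op_normD P Q : op_norm (P + Q) <= op_norm P + op_norm Q.
Proof.
apply/ler_addgt0Pr => e e0; have p0 := op_norm_ge0 P; have q0 := op_norm_ge0 Q.
have -> : op_norm P + op_norm Q + e = (op_norm P + e / 2) + (op_norm Q + e / 2)
  by field.
apply: op_norm_le; first by rewrite !addr_ge0// divr_ge0// ltW.
by apply: op_boundD; rewrite ?ltr_wpDl ?divr_gt0//; apply: op_bound_gt;
  rewrite ltrDl divr_gt0.
Qed.

Lemma op_normM P Q : op_norm (P * Q) <= op_norm P * op_norm Q.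
Proof.
by apply: op_norm_le; [rewrite mulr_ge0 ?op_norm_ge0 | apply: op_boundM;
  exact: op_bound_norm].
Qed.

Lemma op_normZ (c : R[i]) P : op_norm (c *: P) = complex.Re `|c| * op_norm P.
Proof.
have n0 (a : R[i]) : 0 <= complex.Re `|a| by rewrite normc_def /= sqrtr_ge0.
have le (a : R[i]) Q : op_norm (a *: Q) <= complex.Re `|a| * op_norm Q.
  apply: op_norm_le; first by rewrite mulr_ge0 ?op_norm_ge0.
  by apply: op_boundZ; exact: op_bound_norm.
apply/eqP; rewrite eq_le le andTb.
have [->|c0] := eqVneq c 0; first by rewrite normr0 mul0r op_norm_ge0.
have := le c^-1 (c *: P); rewrite scalerA mulVf// scale1r => h.
have cc : complex.Re `|c| * complex.Re `|c^-1| = 1.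
  by apply: (@complexI R); rewrite rmorphM /= !normC_Re -normrM mulfV// normr1.
by have := ler_wpM2l (n0 c) h; rewrite mulrA cc mul1r.
Qed.

Lemma op_norm_star_le P : op_norm (starP P) <= op_norm P.
Proof.
apply/ler_addgt0Pr => e e0; have p0 := op_norm_ge0 P.
have pe : 0 < op_norm P + e by rewrite ltr_wpDl.
apply: op_norm_le; first exact: ltW.
by apply: op_bound_star => //; apply: op_bound_gt; rewrite ltrDl.
Qed.

Lemma op_norm_starM P : op_norm (starP P * P) = op_norm P ^+ 2.
Proof.
have p0 := op_norm_ge0 P; have q0 := op_norm_ge0 (starP P * P).
apply/eqP; rewrite eq_le; apply/andP; split.
  apply: le_trans (op_normM _ _) _; rewrite expr2.
  by rewrite ler_wpM2r// op_norm_star_le.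
apply/ler_addgt0Pr => e e0; set q := op_norm (starP P * P) + e.
have q1 : 0 < q by rewrite /q ltr_wpDl.
rewrite -[q]sqr_sqrtr ?(ltW q1)// ler_pXn2r ?nnegrE ?sqrtr_ge0//.
apply: op_norm_le; first exact: sqrtr_ge0.
apply: op_bound_of_square; first by rewrite sqrtr_gt0.
by rewrite sqr_sqrtr ?(ltW q1)//; apply: op_bound_gt; rewrite ltrDl.
Qed.

Lemma mu_le_op_norm P : cnorm (mu P) <= op_norm P.
Proof.
have p0 := op_norm_ge0 P; have m0 := an_ge0 nB (mu P).
have [[_ bimod mu1] _] := smu.
rewrite -(@ler_pXn2r _ 2)// -cnorm_star.
apply: cpos_norm_le; [exact: sqr_ge0 | exact: cpos_starM|].
have := cposD (@op_bound_norm P 1) (sq_pos (P - constB (mu P))).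
rewrite sqB mulr1 {1}/sq starP1 mulr1 -[1]/(constB 1) mu1.
have mul b Q : mu (constB b * Q) = b * mu Q by have := bimod b Q 1;
  rewrite !mulr1.
have mur Q b : mu (Q * constB b) = mu Q * b by have := bimod 1 Q b;
  rewrite !mul1r.
rewrite mur starP_constB mul (Sigma_hermitian smu) /sq starP_constB mul mu1.
by rewrite opprD !addrA subrK addrK.
Qed.

Lemma op_norm_one : op_norm 1 != 0.
Proof.
have := mu_le_op_norm 1; have [[_ _ mu1] _] := smu.
by rewrite -[1]/(constB 1) mu1 cnorm1 => h;
  rewrite gt_eqF// (lt_le_trans ltr01).
Qed.

Definition op_seminorm : cstar_seminorm PB :=
  CStarSeminorm (@starPK R B) (@starPD R B) (@starPZ R B) (@starPM R B)
    (AlgebraNorm op_normD op_normZ op_normM) op_norm_starM op_norm_one.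

Lemma exp_bounded_Sigma0 : Sigma0 mu.
Proof.
have [[_ bimod mu1] pos] := smu.
have mu_le P : cnorm (mu P) <= op_seminorm P by exact: mu_le_op_norm.
pose M : cstarType R := completion op_seminorm.
pose iota : {lrmorphism B -> M} := inc op_seminorm \o @constB R B.
pose E : M -> B := extend mu.
have Einc P : E (inc op_seminorm P) = mu P by exact: extend_inc.
split=> //; exists M, iota, E, (inc op_seminorm (varX B)); split.
- split.
  + by move=> b c /(congr1 E); rewrite !Einc !mu1.
  + by move=> b; rewrite /iota /= -starP_constB; exact: inc_star.
  + split; first exact: extend_linear.
    by have := Einc (constB 1); rewrite mu1.
  + by move=> b m c; exact: (extend_bimodule lmu mu_le (g := @constB R B)
    bimod).
  + exact: (extend_pos lmu mu_le pos).
- by have := inc_star op_seminorm (varX B); rewrite /= starP_varX.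
- move=> b s; rewrite -Einc; congr E.
  elim: s b => [|c s IHs] b //=.
  by rewrite monoE !rmorphM /= IHs.
Qed.

End OperatorSeminorm.

(** * The bijection *)

Section PhiBijection.
Variables (R : realType) (B : cstarType R).
Implicit Types (beta mu : polyB B -> B).

Lemma Phi_first_return beta : linear beta ->
  first_return (Phi_series beta) (moment (Phi beta)).
Proof. by move=> lb; rewrite (Phi_mu_0 lb); exact: mu_0_first_return. Qed.

Lemma Phi_Sigma beta : linear beta -> cp beta -> Sigma (Phi beta).
Proof.
move=> lb cpb; rewrite (Phi_mu_0 lb); split; first exact: mu_0_Sigma_alg.
exact: mu_0_pos.
Qed.

Lemma Phi_BXB beta : linear beta -> forall P, BXB P -> Phi beta P = 0.
Proof.
move=> lb _ [s ->].
have sa : Sigma_alg (Phi beta) by rewrite (Phi_mu_0 lb); exact: mu_0_Sigma_alg.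
have [lmu _ _] := sa; rewrite (lin_sum lmu) big1// => -[b c] _.
rewrite (Sigma_alg_mono_rcons b [::] c sa) (Phi_first_return lb) big_ord1 /=.
by rewrite mul0r mulr0 mul0r.
Qed.

Lemma Phi_inj beta gamma : linear beta -> linear gamma ->
  Phi beta = Phi gamma -> beta = gamma.
Proof.
move=> lb lg e; have hb := Phi_first_return lb; have hg := Phi_first_return lg.
rewrite -e in hg; apply/funext; apply: linear_mono_eq => // -[b s].
exact: (first_return_inj hb hg (b :: s)).
Qed.

Lemma Phi_Sigma0 beta : linear beta -> cp beta -> Sigma0 (Phi beta) <->
  cp_bounded beta.
Proof.
move=> lb cpb; rewrite (cp_bounded_moment (Phi_first_return lb)).
split=> [[_ [M [iota [E [x [pE _ Emu]]]]]]|[K K0 bK]].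
  exact: Sigma0_exp_bounded pE Emu.
exact: exp_bounded_Sigma0 (Phi_Sigma lb cpb) K0 bK.
Qed.

Lemma Phi_covariance beta b : linear beta ->
  Phi beta (varX B * constB b * varX B) = beta (constB b).
Proof.
move=> lb; have := Phi_first_return lb [:: b].
rewrite !big_ord_recl big_ord0 /= mul0r mulr1 add0r addr0 => <-.
by rewrite /moment /= !monoM /wmul /= !mulr1 !mul1r.
Qed.

End PhiBijection.

Theorem corollary7p11 (R : realType) (B : cstarType R) :
  let CP := [set beta : polyB B -> B | linear beta /\ cp beta] in
  let Sigma_c := [set mu : polyB B -> B |
                   Sigma mu /\ forall P, BXB P -> mu P = 0] in
  [/\ forall beta, CP beta -> Phi beta = mu_0 beta,
      set_bij CP Sigma_c (@Phi R B),
      set_bij (CP `&` [set beta | cp_bounded beta])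
              (Sigma_c `&` [set mu | Sigma0 mu]) (@Phi R B)
    & set_bij (CP `&` [set beta | forall b, beta (constB b) = b])
              (Sigma_c `&` [set mu | forall b,
                 mu (varX B * constB b * varX B) = b]) (@Phi R B)].
Proof.
move=> CP Sigma_c.
have toSigma beta : CP beta -> Sigma_c (Phi beta).
  by move=> [lb cpb]; split; [exact: Phi_Sigma | exact: Phi_BXB].
have inj : {in CP &, injective (@Phi R B)}.
  by move=> beta gamma /set_mem[lb _] /set_mem[lg _]; exact: Phi_inj.
have surj mu : Sigma_c mu -> exists2 beta, CP beta & Phi beta = mu.
  move=> [smu mu0]; exists (Phi_inv mu); last exact: Phi_Phi_inv.
  by split; [exact: Phi_inv_linear | exact: Phi_inv_cp].
have restrict (D E : set (polyB B -> B)) :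
    (forall beta, CP beta -> D beta <-> E (Phi beta)) ->
    set_bij (CP `&` D) (Sigma_c `&` E) (@Phi R B).
  move=> DE; split.
  - by move=> beta [cb Db]; split; [exact: toSigma | exact/(DE _ cb)].
  - by move=> beta gamma /set_mem[cb _] /set_mem[cg _]; apply: inj; exact: mem_set.
  - move=> mu [/surj[beta cb <-] Eb]; exists beta => //; split=> //.
    exact/(DE _ cb).
split.
- by move=> beta [lb _]; exact: Phi_mu_0.
- by split; [exact: toSigma | exact: inj | move=> mu /surj[beta cb <-]; exists beta].
- by apply: restrict => beta [lb cpb]; apply: iff_sym; exact: Phi_Sigma0.
- apply: restrict => beta [lb _]; split=> h b; have := h b; by rewrite Phi_covariance.
Qed.
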